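(* Assume $\operatorname{char}(\Bbbk)\neq 2$. Let $B\subseteq A$ and $D\subseteq C$ be two homologically controllable extensions of $\Bbbk$-algebras. Then $B\otimes D\subseteq A\otimes C$ is homologically controllable, and $$\operatorname{gldim}(A\otimes C,\,B\otimes D)=\operatorname{gldim}(A,B)+\operatorname{gldim}(C,D).$$
   Context: Throughout, $\Bbbk$ is a perfect field and all algebras are Artin algebras over $\Bbbk$ (finite-dimensional, associative, unital); $\otimes=\otimes_\Bbbk$; $A^e=A\otimes A^{\mathrm{op}}$, and $A$-$A$-bimodules are left $A^e$-modules. An extension $B\subseteq A$ is an algebra $A$ with a unital subalgebra $B$; it induces the extension $B^e\subseteq A^e$. $J(A)$ is the Jacobson radical, and $A\text{-mod}$ is the category of finitely generated left $A$-modules. $\operatorname{gldim}(C)$ is the ordinary global dimension of an algebra $C$. A module $M\in A\text{-mod}$ is $(A,B)$-projective if the multiplication map $A\otimes_B M\to M$ is a split epimorphism of $A$-modules. An $(A,B)$-exact sequence is a complex of $A$-modules $(M_n,d_n)$ admitting a $B$-homotopy, i.e. $B$-linear maps $h_n:M_n\to M_{n+1}$ with $d_{n+1}h_n+h_{n-1}d_n=1_{M_n}$ for all $n$. An $(A,B)$-projective resolution of $M$ is an $(A,B)$-exact sequence $\cdots\to P_1\to P_0\to M\to 0$ with all $P_i$ being $(A,B)$-projective. $\operatorname{pd}_{(A,B)}M$ is the least length of such a resolution (of $P_\bullet$), or $\infty$, and $\operatorname{gldim}(A,B)=\sup\{\operatorname{pd}_{(A,B)}M : M\in A\text{-mod}\}$.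 The extension $B\subseteq A$ is controllable if $\operatorname{gldim}(A,B)=\operatorname{gldim}(A/AJ(B)A)$. It is homologically controllable if $AJ(B)$ is a two-sided ideal of $A$, the extension is controllable, and $\operatorname{gldim}(A,B)=\operatorname{pd}_{(A^e,B^e)}A$. *)

(* Defs.v *)
From HB Require Import structures.
From mathcomp Require Import all_boot all_order all_algebra all_field.
From mathcomp Require Import generic_quotient ring_quotient.
From mathcomp Require Import boolp classical_sets constructive_ereal.

Set Implicit Arguments.
Unset Strict Implicit.
Unset Printing Implicit Defensive.

Import GRing.Theory.
Local Open Scope ring_scope.

Definition perfect_field (k : fieldType) : Prop :=
  forall p : {poly k}, irreducible_poly p -> separable_poly p.

(* With [e] the basis [vbasis {:A}] of [A], the element
   [\sum_i e_i (x) f_i] of [A (x) C] is encoded by the family [f]. *)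

Definition tensor (k : fieldType) (A C : falgType k) : Type :=
  {ffun 'I_(\dim {:A}) -> C}.

HB.instance Definition _ (k : fieldType) (A C : falgType k) :=
  Vector.copy (tensor A C) {ffun 'I_(\dim {:A}) -> C}.

Section TensorAlgebra.
Variables (k : fieldType) (A C : falgType k).
Local Notation T := (tensor A C).
Local Notation e := (vbasis {:A}).

Definition tens (a : A) (c : C) : T := [ffun i => coord e i a *: c].

Definition tmul (f g : T) : T :=
  \sum_(i < \dim {:A}) \sum_(j < \dim {:A}) tens (e`_i * e`_j) (f i * g j).

Lemma tensDl c : {morph tens^~ c : a b / a + b}.
Proof. by move=> a b; apply/ffunP=> i; rewrite !ffunE linearD scalerDl. Qed.

Lemma tensDr a : {morph tens a : c d / c + d}.
Proof. by move=> c d; apply/ffunP=> i; rewrite !ffunE scalerDr. Qed.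

Lemma tensZl x a c : tens (x *: a) c = x *: tens a c.
Proof. by apply/ffunP=> i; rewrite !ffunE linearZ scalerA. Qed.

Lemma tensZr x a c : tens a (x *: c) = x *: tens a c.
Proof. by apply/ffunP=> i; rewrite !ffunE !scalerA mulrC. Qed.

Lemma tens0l c : tens 0 c = 0.
Proof. by rewrite -[0 in LHS](scale0r (0 : A)) tensZl scale0r. Qed.

Lemma tens_suml (I : Type) (r : seq I) (P : pred I) (F : I -> A) c :
  tens (\sum_(i <- r | P i) F i) c = \sum_(i <- r | P i) tens (F i) c.
Proof. exact: (big_morph _ (tensDl c) (tens0l c)). Qed.

Lemma tens_basis (f : T) : f = \sum_(i < \dim {:A}) tens e`_i (f i).
Proof.
apply/ffunP=> j; rewrite sum_ffunE (bigD1 j) //= big1 => [|i ij].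
  by rewrite ffunE coord_free ?(basis_free (vbasisP _)) // eqxx scale1r addr0.
rewrite ffunE coord_free ?(basis_free (vbasisP _)) //.
by rewrite (negPf ij) scale0r.
Qed.

Lemma tens_ind (P : T -> Prop) :
  (forall f g, P f -> P g -> P (f + g)) -> (forall a c, P (tens a c)) ->
  forall f, P f.
Proof.
move=> PD Pt f; rewrite (tens_basis f).
elim/big_ind: _ => [|x y|i _]; [|exact: PD|exact: Pt].
by rewrite -(tens0l 0); apply: Pt.
Qed.

Lemma tmulDl : left_distributive tmul +%R.
Proof.
move=> f g h; rewrite /tmul -big_split; apply: eq_bigr => i _.
rewrite -big_split; apply: eq_bigr => j _.
by rewrite ffunE mulrDl tensDr.
Qed.

Lemma tmulDr : right_distributive tmul +%R.
Proof.
move=> f g h; rewrite /tmul -big_split; apply: eq_bigr => i _.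
rewrite -big_split; apply: eq_bigr => j _.
by rewrite ffunE mulrDr tensDr.
Qed.

Lemma tmulZl x f g : tmul (x *: f) g = x *: tmul f g.
Proof.
rewrite /tmul scaler_sumr; apply: eq_bigr => i _.
rewrite scaler_sumr; apply: eq_bigr => j _.
by rewrite ffunE -scalerAl tensZr.
Qed.

Lemma tmulZr x f g : tmul f (x *: g) = x *: tmul f g.
Proof.
rewrite /tmul scaler_sumr; apply: eq_bigr => i _.
rewrite scaler_sumr; apply: eq_bigr => j _.
by rewrite ffunE -scalerAr tensZr.
Qed.

Lemma coord_vbasis_full (a : A) : a = \sum_(i < \dim {:A}) coord e i a *: e`_i.
Proof. exact: coord_vbasis (memvf a). Qed.

Lemma tmul_tens a b c d :
  tmul (tens a c) (tens b d) = tens (a * b) (c * d).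
Proof.
rewrite /tmul {2}(coord_vbasis_full a) mulr_suml tens_suml.
apply: eq_bigr => i _.
rewrite {2}(coord_vbasis_full b) mulr_sumr tens_suml; apply: eq_bigr => j _.
by rewrite !ffunE -!scalerAl -!scalerAr !tensZr !tensZl.
Qed.

Lemma tmulA : associative tmul.
Proof.
move=> f g h; elim/tens_ind: f => [f f' IHf IHf'|a a'].
  by rewrite !tmulDl IHf IHf'.
elim/tens_ind: g => [g g' IHg IHg'|b b'].
  by rewrite tmulDl !tmulDr tmulDl IHg IHg'.
elim/tens_ind: h => [h h' IHh IHh'|c c']; first by rewrite !tmulDr IHh IHh'.
by rewrite !tmul_tens !mulrA.
Qed.

Lemma tmul1l : left_id (tens 1 1) tmul.
Proof.
elim/tens_ind=> [f g IHf IHg|a c]; first by rewrite tmulDr IHf IHg.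
by rewrite tmul_tens !mul1r.
Qed.

Lemma tmul1r : right_id (tens 1 1) tmul.
Proof.
elim/tens_ind=> [f g IHf IHg|a c]; first by rewrite tmulDl IHf IHg.
by rewrite tmul_tens !mulr1.
Qed.

Lemma tens11_neq0 : tens 1 1 != 0.
Proof.
apply/eqP => h; have /eqP := oner_neq0 A; apply.
rewrite (coord_vbasis_full 1) big1 // => i _.
have /ffunP/(_ i) := h; rewrite !ffunE => /eqP.
by rewrite scaler_eq0 oner_eq0 orbF => /eqP ->; rewrite scale0r.
Qed.

End TensorAlgebra.

HB.instance Definition _ (k : fieldType) (A C : falgType k) :=
  GRing.Zmodule_isNzRing.Build (tensor A C) (@tmulA k A C) (@tmul1l k A C)
    (@tmul1r k A C) (@tmulDl k A C) (@tmulDr k A C) (@tens11_neq0 k A C).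

HB.instance Definition _ (k : fieldType) (A C : falgType k) :=
  GRing.Lmodule_isLalgebra.Build k (tensor A C)
    (fun x f g => esym (tmulZl x f g)).

HB.instance Definition _ (k : fieldType) (A C : falgType k) :=
  GRing.Lalgebra_isAlgebra.Build k (tensor A C)
    (fun x f g => esym (tmulZr x f g)).

HB.instance Definition _ (k : fieldType) (A C : falgType k) :=
  Algebra_isFalgebra.Build k (tensor A C).

Definition tensor_sub (k : fieldType) (A C : falgType k)
    (B : {vspace A}) (D : {vspace C}) : {vspace tensor A C} :=
  <<[seq tens b d | b <- vbasis B, d <- vbasis D]>>%VS.

Lemma tens_mem (k : fieldType) (A C : falgType k) (B : {vspace A})
    (D : {vspace C}) b d :
  b \in B -> d \in D -> tens b d \in tensor_sub B D.
Proof.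
move=> /coord_vbasis-> /coord_vbasis->.
rewrite tens_suml memv_suml // => i _.
rewrite (big_morph _ (tensDr _) (_ : tens _ 0 = 0)); last first.
  by apply/ffunP=> j; rewrite !ffunE scaler0.
rewrite memv_suml // => j _; rewrite tensZl tensZr !memvZ // memv_span //.
by apply: allpairs_f; apply: mem_nth; rewrite size_tuple.
Qed.

HB.instance Definition _ (k : fieldType) (A : falgType k) :=
  Vector.copy A^c A.

HB.instance Definition _ (k : fieldType) (A : falgType k) :=
  GRing.Lmodule_isLalgebra.Build k A^c
    (fun x (a b : A) => scalerAr x b a).

HB.instance Definition _ (k : fieldType) (A : falgType k) :=
  GRing.Lalgebra_isAlgebra.Build k A^c
    (fun x (a b : A) => scalerAl x b a).
HB.instance Definition _ (k : fieldType) (A : falgType k) :=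
  Falgebra.on A^c.

Definition op_sub (k : fieldType) (A : falgType k) (B : {vspace A}) :
  {vspace A^c} := <<(vbasis B : seq A^c)>>%VS.

Lemma mem_op_sub (k : fieldType) (A : falgType k) (B : {vspace A}) (x : A) :
  ((x : A^c) \in op_sub B) = (x \in B).
Proof.
apply/idP/idP=> [|/coord_vbasis->]; last first.
  apply: (@memv_suml _ A^c) => i _; apply: (@memvZ _ A^c).
  by apply: memv_span; apply: mem_nth; rewrite size_tuple.
move=> /(@coord_span _ A^c _ (in_tuple _))->.
apply: memv_suml => i _; apply: memvZ; apply: vbasis_mem.
by apply: mem_nth.
Qed.

Definition env (k : fieldType) (A : falgType k) : falgType k := tensor A A^c.

Definition env_sub (k : fieldType) (A : falgType k) (B : {vspace A}) :
  {vspace env A} := tensor_sub B (op_sub B).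

(* [A] as a left [env A]-module, [(a (x) b) *: x = a * x * b]. *)
Definition regular_bimod (k : fieldType) (A : falgType k) : Type := A.

HB.instance Definition _ (k : fieldType) (A : falgType k) :=
  GRing.Zmodule.copy (regular_bimod A) A.

Section RegularBimodule.
Variables (k : fieldType) (A : falgType k).
Local Notation e := (vbasis {:A}).

Definition bimod_act (f : env A) (x : regular_bimod A) : regular_bimod A :=
  \sum_(i < \dim {:A})
    (e`_i : A) * (x : A) * ((f : {ffun 'I_(\dim {:A}) -> A}) i : A).

Lemma bimod_actDl x : {morph bimod_act^~ x : f g / f + g}.
Proof.
move=> f g; rewrite /bimod_act -big_split; apply: eq_bigr => i _.
by rewrite ffunE mulrDr.
Qed.

Lemma bimod_actDr : right_distributive bimod_act +%R.
Proof.
move=> f x y; rewrite /bimod_act -big_split; apply: eq_bigr => i _.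
by rewrite mulrDr mulrDl.
Qed.

Lemma bimod_act_tens (a b : A) (x : A) :
  bimod_act (tens a (b : A^c)) x = a * x * b.
Proof.
rewrite [in RHS](coord_vbasis_full a) !mulr_suml; apply: eq_bigr => i _.
by rewrite ffunE -!scalerAl -scalerAr.
Qed.

Lemma bimod_act1 : left_id 1 bimod_act.
Proof. by move=> x; rewrite (bimod_act_tens 1 1) mul1r mulr1. Qed.

Lemma bimod_actA f g x : bimod_act f (bimod_act g x) = bimod_act (f * g) x.
Proof.
elim/tens_ind: f => [f f' IHf IHf'|a a'].
  by rewrite mulrDl !bimod_actDl IHf IHf'.
elim/tens_ind: g => [g g' IHg IHg'|b b'].
  by rewrite mulrDr !bimod_actDl bimod_actDr IHg IHg'.
have -> : tens a a' * tens b b' = tens (a * b) ((b' : A) * (a' : A) : A^c).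
  exact: tmul_tens.
by rewrite !bimod_act_tens !mulrA.
Qed.

End RegularBimodule.

HB.instance Definition _ (k : fieldType) (A : falgType k) :=
  GRing.Zmodule_isLmodule.Build (env A) (regular_bimod A)
    (@bimod_actA k A) (@bimod_act1 k A) (@bimod_actDr k A)
    (fun x => @bimod_actDl k A x).

Section Ideals.
Variables (k : fieldType) (A : falgType k).
Implicit Types (B I J : {vspace A}).

Definition unital_subalgebra B : Prop := (1 \in B) && (B * B <= B)%VS.

Definition two_sided_ideal I : Prop :=
  ({:A} * I <= I)%VS && (I * {:A} <= I)%VS.

Definition left_ideal B I : Prop := (I <= B)%VS && (B * I <= I)%VS.

Definition maximal_left_ideal B I : Prop :=
  [/\ left_ideal B I, I <> B &
      forall J, left_ideal B J -> (I <= J)%VS -> J = I \/ J = B].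

(* The intersection of the maximal left ideals of [B], see [jacobsonP]. *)
Definition jacobson B : {vspace A} :=
  xget 0%VS [set J : {vspace A} | forall x, x \in J <->
    x \in B /\ forall I, maximal_left_ideal B I -> x \in I]%classic.

Lemma jacobsonP B x :
  x \in jacobson B <->
  x \in B /\ forall I, maximal_left_ideal B I -> x \in I.
Proof.
rewrite /jacobson; case: xgetP => [J _ /(_ x) //|noJ].
suff [J HJ] : exists J : {vspace A}, forall x, x \in J <->
    x \in B /\ forall I, maximal_left_ideal B I -> x \in I.
  by case: (noJ J HJ).
suff jacU n : forall U : {vspace A}, (\dim U < n)%N -> (U <= B)%VS ->
    (forall y, y \in B -> (forall I, maximal_left_ideal B I -> y \in I) ->
      y \in U) ->
    exists J : {vspace A}, forall x, x \in J <->
      x \in B /\ forall I, maximal_left_ideal B I -> x \in I.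
  exact: (jacU (\dim B).+1 B).
elim: n => // n IHn U /ltnSE dimU UB HU.
have [HI|/existsNP[I /not_implyP[Imax /negP UI]]] :=
  pselect (forall I, maximal_left_ideal B I -> (U <= I)%VS).
  exists U => y; split=> [yU|[yB yI]]; last exact: HU.
  split; first exact: (subvP UB).
  by move=> I /HI /subvP; apply.
apply: (IHn (U :&: I)%VS) => [||y yB yI].
- apply: leq_trans dimU; rewrite ltn_neqAle dimvS ?capvSl // andbT.
  apply: contra UI => /eqP dimE; apply/capv_idPl/eqP.
  by rewrite eqEdim capvSl dimE /=.
- exact: subv_trans (capvSl _ _) UB.
- by rewrite memv_cap HU //= yI.
Qed.

End Ideals.

(* The quotient of [A] by the two-sided ideal generated by [X]; possibly the
   zero ring. *)
Definition ideal_of (k : fieldType) (A : falgType k) (X : {vspace A}) :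
  {vspace A} := ({:A} * X * {:A})%VS.

Definition quot_alg (k : fieldType) (A : falgType k) (X : {vspace A}) : Type :=
  Quotient.quot (pred_of_vspace (ideal_of X)).

HB.instance Definition _ (k : fieldType) (A : falgType k) (X : {vspace A}) :=
  GRing.Zmodule.on (quot_alg X).

Section QuotientAlgebra.
Variables (k : fieldType) (A : falgType k) (X : {vspace A}).
Local Notation Q := (quot_alg X).

Definition qproj (a : A) : Q :=
  (\pi_(Quotient.quot (pred_of_vspace (ideal_of X))) a)%qT.
Definition qrepr (x : Q) : A := repr x.

Lemma qreprK : cancel qrepr qproj. Proof. exact: reprK. Qed.

Lemma qprojD : {morph qproj : a b / a + b}.
Proof. by move=> a b; rewrite /qproj raddfD. Qed.

Lemma qproj_eq a b : qproj a = qproj b <-> a - b \in ideal_of X.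
Proof.
rewrite [_ - _ \in _](Quotient.idealrBE (pred_of_vspace (ideal_of X))).
by split=> [h|/eqP //]; apply/eqP.
Qed.

Lemma ideal_of_mull a b : b \in ideal_of X -> a * b \in ideal_of X.
Proof.
move=> bI; have: a * b \in ({:A} * ideal_of X)%VS by rewrite memv_mul ?memvf.
by apply/subvP; rewrite /ideal_of !prodvA !prodvSl ?subvf.
Qed.

Lemma ideal_of_mulr a b : a \in ideal_of X -> a * b \in ideal_of X.
Proof.
move=> aI; have: a * b \in (ideal_of X * {:A})%VS by rewrite memv_mul ?memvf.
by apply/subvP; rewrite /ideal_of -!prodvA !prodvSr ?subvf.
Qed.

Definition qmul (x y : Q) : Q := qproj (qrepr x * qrepr y).

Lemma qprojM a b : qmul (qproj a) (qproj b) = qproj (a * b).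
Proof.
have ha := (qproj_eq _ _).1 (qreprK (qproj a)).
have hb := (qproj_eq _ _).1 (qreprK (qproj b)).
rewrite /qmul; move: (qrepr (qproj a)) (qrepr (qproj b)) ha hb => a' b' ha hb.
apply: (qproj_eq _ _).2.
rewrite -[a' * b' - _](subrKA (a * b')) -mulrBl -mulrBr.
by apply: rpredD; [exact: ideal_of_mulr|exact: ideal_of_mull].
Qed.

Lemma qmulA : associative qmul.
Proof.
move=> x y z; rewrite -(qreprK x) -(qreprK y) -(qreprK z).
by rewrite !qprojM mulrA.
Qed.

Lemma qmul1l : left_id (qproj 1) qmul.
Proof. by move=> x; rewrite -(qreprK x) qprojM mul1r. Qed.

Lemma qmul1r : right_id (qproj 1) qmul.
Proof. by move=> x; rewrite -(qreprK x) qprojM mulr1. Qed.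

Lemma qmulDl : left_distributive qmul +%R.
Proof.
move=> x y z; rewrite -(qreprK x) -(qreprK y) -(qreprK z).
by rewrite -qprojD !qprojM mulrDl qprojD.
Qed.

Lemma qmulDr : right_distributive qmul +%R.
Proof.
move=> x y z; rewrite -(qreprK x) -(qreprK y) -(qreprK z).
by rewrite -qprojD !qprojM mulrDr qprojD.
Qed.

HB.instance Definition _ :=
  GRing.Zmodule_isPzRing.Build Q qmulA qmul1l qmul1r qmulDl qmulDr.

End QuotientAlgebra.

(* [A (x)_k M] is encoded as for [tensor], with [k] acting on [M] through
   [k -> A]; [A (x)_B M] is its quotient by the [A]-submodule generated by the
   elements [a b (x) m - a (x) b m] with [b] in [B]. *)

Definition free_ind (k : fieldType) (A : falgType k) (M : lmodType A) : Type :=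
  {ffun 'I_(\dim {:A}) -> M}.

HB.instance Definition _ (k : fieldType) (A : falgType k) (M : lmodType A) :=
  GRing.Zmodule.copy (free_ind M) {ffun 'I_(\dim {:A}) -> M}.

Section FreeInduction.
Variables (k : fieldType) (A : falgType k) (M : lmodType A).
Local Notation e := (vbasis {:A}).
Local Notation T := (free_ind M).

Definition ptens (a : A) (m : M) : T := [ffun i => (coord e i a)%:A *: m].

Definition free_ind_act (a : A) (f : T) : T :=
  \sum_(i < \dim {:A}) ptens (a * e`_i) (f i).

Lemma ptensDl m : {morph ptens^~ m : a b / a + b}.
Proof. by move=> a b; apply/ffunP=> i; rewrite !ffunE linearD !scalerDl. Qed.

Lemma ptensDr a : {morph ptens a : m n / m + n}.
Proof. by move=> m n; apply/ffunP=> i; rewrite !ffunE scalerDr. Qed.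

Lemma ptensZ x a m : ptens (x *: a) m = ptens a (x%:A *: m).
Proof.
apply/ffunP=> i; rewrite !ffunE linearZ /= scalerA; congr (_ *: m).
by rewrite -scalerAr mulr1 scalerA mulrC.
Qed.

Lemma ptens0l m : ptens 0 m = 0.
Proof. by apply/ffunP=> i; rewrite !ffunE linear0 !scale0r. Qed.

Lemma ptens_suml (I : Type) (r : seq I) (P : pred I) (F : I -> A) m :
  ptens (\sum_(i <- r | P i) F i) m = \sum_(i <- r | P i) ptens (F i) m.
Proof. exact: (big_morph _ (ptensDl m) (ptens0l m)). Qed.

Lemma ptens_basis (f : T) : f = \sum_(i < \dim {:A}) ptens e`_i (f i).
Proof.
apply/ffunP=> j; rewrite sum_ffunE (bigD1 j) //= big1 => [|i ij].
  rewrite ffunE coord_free ?(basis_free (vbasisP _)) // eqxx scale1r scale1r.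
  by rewrite addr0.
rewrite ffunE coord_free ?(basis_free (vbasisP _)) //.
by rewrite (negPf ij) !scale0r.
Qed.

Lemma ptens_ind (P : T -> Prop) :
  (forall f g, P f -> P g -> P (f + g)) -> (forall a m, P (ptens a m)) ->
  forall f, P f.
Proof.
move=> PD Pt f; rewrite (ptens_basis f).
elim/big_ind: _ => [|x y|i _]; [|exact: PD|exact: Pt].
by rewrite -(ptens0l 0); apply: Pt.
Qed.

Lemma free_ind_actDl f : {morph free_ind_act^~ f : a b / a + b}.
Proof.
move=> a b; rewrite /free_ind_act -big_split; apply: eq_bigr => i _.
by rewrite mulrDl ptensDl.
Qed.

Lemma free_ind_actDr : right_distributive free_ind_act +%R.
Proof.
move=> a f g; rewrite /free_ind_act -big_split; apply: eq_bigr => i _.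
by rewrite ffunE ptensDr.
Qed.

Lemma free_ind_act_ptens a b m :
  free_ind_act a (ptens b m) = ptens (a * b) m.
Proof.
rewrite [in RHS](coord_vbasis_full b) mulr_sumr ptens_suml.
by apply: eq_bigr => i _; rewrite ffunE -scalerAr ptensZ.
Qed.

Lemma free_ind_act1 : left_id 1 free_ind_act.
Proof.
elim/ptens_ind=> [f g IHf IHg|a m]; first by rewrite free_ind_actDr IHf IHg.
by rewrite free_ind_act_ptens mul1r.
Qed.

Lemma free_ind_actA a b f :
  free_ind_act a (free_ind_act b f) = free_ind_act (a * b) f.
Proof.
elim/ptens_ind: f => [f g IHf IHg|c m].
  by rewrite !free_ind_actDr IHf IHg.
by rewrite !free_ind_act_ptens mulrA.
Qed.

HB.instance Definition _ := GRing.Zmodule_isLmodule.Build A T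
  free_ind_actA free_ind_act1 free_ind_actDr free_ind_actDl.

Definition free_ind_mul (f : T) : M := \sum_(i < \dim {:A}) e`_i *: f i.

Lemma free_ind_mul_ptens a m : free_ind_mul (ptens a m) = a *: m.
Proof.
rewrite [in RHS](coord_vbasis_full a) scaler_suml; apply: eq_bigr => i _.
by rewrite ffunE scalerA -scalerAr mulr1.
Qed.

Lemma free_ind_mul_linear : linear free_ind_mul.
Proof.
have mulD f g : free_ind_mul (f + g) = free_ind_mul f + free_ind_mul g.
  rewrite /free_ind_mul -big_split; apply: eq_bigr => i _.
  by rewrite ffunE scalerDr.
move=> a f g; rewrite mulD; congr (_ + _).
elim/ptens_ind: f => [f f' IHf IHf'|b m].
  by rewrite scalerDr !mulD IHf IHf' scalerDr.
have -> : a *: ptens b m = ptens (a * b) m by exact: free_ind_act_ptens.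
by rewrite !free_ind_mul_ptens scalerA.
Qed.

End FreeInduction.

Section Induction.
Variables (k : fieldType) (A : falgType k) (B : {vspace A}) (M : lmodType A).

Definition balance_gen (g : free_ind M) : Prop := exists (a b : A) (m : M),
  b \in B /\ g = ptens (a * b) m - ptens a (b *: m).

Definition balance_rel : {pred free_ind M} := fun f =>
  `[< exists n (c : 'I_n -> A) (g : 'I_n -> free_ind M),
        (forall i, balance_gen (g i)) /\ f = \sum_i c i *: g i >].

Lemma balance_rel_submod : submod_closed balance_rel.
Proof.
split=> [|a f f' /asboolP[n [c [g [gB ->]]]] /asboolP[n' [c' [g' [gB' ->]]]]].
  by apply/asboolP; exists 0%N, (fun=> 0), (fun=> 0); split; [case|rewrite big_ord0].
apply/asboolP; exists (n + n')%N,
  (fun i => match split i with inl j => a * c j | inr j => c' j end),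
  (fun i => match split i with inl j => g j | inr j => g' j end).
split=> [i|]; first by case: (split i).
rewrite big_split_ord scaler_sumr; congr (_ + _); apply: eq_bigr => i _.
  by rewrite (unsplitK (inl _ i)) scalerA.
by rewrite (unsplitK (inr _ i)).
Qed.

HB.instance Definition _ :=
  GRing.isSubmodClosed.Build A (free_ind M) balance_rel balance_rel_submod.

Definition ind : Type := Quotient.quot balance_rel.

HB.instance Definition _ := GRing.Zmodule.on ind.

Definition ind_proj (f : free_ind M) : ind :=
  (\pi_(Quotient.quot balance_rel) f)%qT.
Definition ind_repr (x : ind) : free_ind M := repr x.

Lemma ind_reprK : cancel ind_repr ind_proj. Proof. exact: reprK. Qed.

Lemma ind_projD : {morph ind_proj : f g / f + g}.
Proof. by move=> f g; rewrite /ind_proj raddfD. Qed.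

Lemma ind_proj_eq f g : ind_proj f = ind_proj g <-> f - g \in balance_rel.
Proof.
rewrite [_ - _ \in _](Quotient.idealrBE balance_rel).
by split=> [h|/eqP //]; apply/eqP.
Qed.

Definition ind_act (a : A) (x : ind) : ind := ind_proj (a *: ind_repr x).

Lemma ind_act_proj a f : ind_act a (ind_proj f) = ind_proj (a *: f).
Proof.
by apply/ind_proj_eq; rewrite -scalerBr rpredZ //; apply/ind_proj_eq/ind_reprK.
Qed.

Lemma ind_actA a b x : ind_act a (ind_act b x) = ind_act (a * b) x.
Proof. by rewrite -(ind_reprK x) !ind_act_proj scalerA. Qed.

Lemma ind_act1 : left_id 1 ind_act.
Proof. by move=> x; rewrite -(ind_reprK x) ind_act_proj scale1r. Qed.

Lemma ind_actDr : right_distributive ind_act +%R.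
Proof.
move=> a x y; rewrite -(ind_reprK x) -(ind_reprK y).
by rewrite -ind_projD !ind_act_proj scalerDr ind_projD.
Qed.

Lemma ind_actDl x : {morph ind_act^~ x : a b / a + b}.
Proof.
by move=> a b; rewrite -(ind_reprK x) !ind_act_proj scalerDl ind_projD.
Qed.

HB.instance Definition _ := GRing.Zmodule_isLmodule.Build A ind
  ind_actA ind_act1 ind_actDr ind_actDl.

Definition ind_mul (x : ind) : M := free_ind_mul (ind_repr x).

Lemma ind_mul_proj f : ind_mul (ind_proj f) = free_ind_mul f.
Proof.
apply/eqP; rewrite -subr_eq0; apply/eqP.
have mulB g h : free_ind_mul (g - h) = free_ind_mul g - free_ind_mul h.
  by rewrite (addrC g) -(scaleN1r h) free_ind_mul_linear scaleN1r addrC.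
have mul0 : free_ind_mul (0 : free_ind M) = 0.
  by rewrite -[X in free_ind_mul X](subrr 0) mulB subrr.
have: ind_repr (ind_proj f) - f \in balance_rel.
  exact/ind_proj_eq/ind_reprK.
rewrite /ind_mul -mulB => /asboolP[n [c [g [gB ->]]]].
elim/big_rec: _ => // i h _ hE.
rewrite (free_ind_mul_linear (c i)) hE addr0.
have [a [b [m [_ ->]]]] := gB i.
by rewrite mulB !free_ind_mul_ptens scalerA subrr scaler0.
Qed.

Lemma ind_mul_ptens a m : ind_mul (ind_proj (ptens a m)) = a *: m.
Proof. by rewrite ind_mul_proj free_ind_mul_ptens. Qed.

End Induction.

(* [+oo] if [S] is empty. *)
Definition least (S : nat -> Prop) : \bar int :=
  match pselect (exists n, `[< S n >]) with
  | left ex => (Posz (ex_minn ex))%:E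
  | right _ => +oo%E
  end.

Section Complexes.
Variable R : pzRingType.

Definition fin_gen (M : lmodType R) : Prop :=
  exists n (g : 'I_n -> M), forall x, exists c : 'I_n -> R,
    x = \sum_i c i *: g i.

(* The complex [... -> P 1 -> P 0 -> M]. *)
Definition augment (M : lmodType R) (P : nat -> lmodType R) (n : nat) :
  lmodType R := if n is m.+1 then P m else M.

(* The complexes below are of the form [... -> X 2 -> X 1 -> X 0 -> 0]. *)
Definition is_complex (X : nat -> lmodType R)
    (d : forall n, {linear X n.+1 -> X n}) : Prop :=
  forall n x, d n (d n.+1 x) = 0.

Definition exact_complex (X : nat -> lmodType R)
    (d : forall n, {linear X n.+1 -> X n}) : Prop :=
  [/\ is_complex d, forall x, exists y, d 0%N y = x &
      forall n x, d n x = 0 -> exists y, d n.+1 y = x].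

Definition projective (P : lmodType R) : Prop :=
  forall (M N : lmodType R) (p : {linear M -> N}) (f : {linear P -> N}),
  (forall y, exists x, p x = y) ->
  exists g : {linear P -> M}, forall x, p (g x) = f x.

Definition vanishes_above (P : nat -> lmodType R) (l : nat) : Prop :=
  forall n, (l < n)%N -> forall x : P n, x = 0.

Definition pd (M : lmodType R) : \bar int :=
  least (fun l => exists (P : nat -> lmodType R)
      (d : forall n, {linear augment M P n.+1 -> augment M P n}),
    [/\ forall n, fin_gen (P n), forall n, projective (P n),
        exact_complex d & vanishes_above P l]).

(* The supremum of [pd M] over the finitely generated [M], as the least upper
   bound in the naturals extended with [+oo]. *)
Definition gldim : \bar int :=
  least (fun l => forall M : lmodType R,
    fin_gen M -> (pd M <= (Posz l)%:E)%E).

End Complexes.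

Section RelativeDimension.
Variables (k : fieldType) (A : falgType k) (B : {vspace A}).

Definition linear_over (M N : lmodType A) (h : M -> N) : Prop :=
  (forall x y, h (x + y) = h x + h y) /\
  (forall b x, b \in B -> h (b *: x) = b *: h x).

Definition rel_exact_complex (X : nat -> lmodType A)
    (d : forall n, {linear X n.+1 -> X n}) : Prop :=
  is_complex d /\
  exists h : forall n, X n -> X n.+1,
    [/\ forall n, linear_over (h n),
        forall x, d 0%N (h 0%N x) = x &
        forall n x, d n.+1 (h n.+1 x) + h n (d n x) = x].

Definition rel_projective (M : lmodType A) : Prop :=
  exists s : {linear M -> ind B M}, forall x, ind_mul (s x) = x.

Definition rel_pd (M : lmodType A) : \bar int :=
  least (fun l => exists (P : nat -> lmodType A)
      (d : forall n, {linear augment M P n.+1 -> augment M P n}),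
    [/\ forall n, fin_gen (P n), forall n, rel_projective (P n),
        rel_exact_complex d & vanishes_above P l]).

Definition rel_gldim : \bar int :=
  least (fun l => forall M : lmodType A,
    fin_gen M -> (rel_pd M <= (Posz l)%:E)%E).

Definition controllable : Prop := rel_gldim = gldim (quot_alg (jacobson B)).

End RelativeDimension.

Definition homologically_controllable (k : fieldType) (A : falgType k)
    (B : {vspace A}) : Prop :=
  [/\ unital_subalgebra B,
      two_sided_ideal ({:A} * jacobson B)%VS,
      controllable B &
      rel_gldim B = rel_pd (env_sub B) (regular_bimod A)].

(* Main.v *)
Require Import Defs.
From HB Require Import structures.
From mathcomp Require Import all_boot all_order all_algebra all_field.
From mathcomp Require Import generic_quotient ring_quotient.
From mathcomp Require Import boolp classical_sets constructive_ereal.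

Set Implicit Arguments.
Unset Strict Implicit.
Unset Printing Implicit Defensive.

Import GRing.Theory.
Local Open Scope ring_scope.

(* Write [I = A J(B)], [I' = C J(D)]. In the chain
   gldim A/I + gldim C/I' <= gldim of the quotient of [A (x) C] by the ideal of
   J(B (x) D) <= gldim(A (x) C, B (x) D) <= pd of [A (x) C] over its enveloping
   extension <= pd_(A^e, B^e) A + pd_(C^e, D^e) C
   the two ends agree by hypothesis.
   - Since [k] is perfect, J(B (x) D) = J(B) (x) D + B (x) J(D), so [M (x) N] is
     killed by it when [M] and [N] are killed by J(B) and J(D). For modules
     killed by J(B), projective dimension over A/I and relative projective
     dimension coincide, because [B]-module maps split modulo J(B).
   - The first inequality then says that pd(M (x) N) = pd M + pd N for relative
     projective dimensions; after replacing [M] and [N] by syzygies it reduces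
     to: if pd(M (x) N) <= 1, then [M] or [N] is relatively projective.
   - The third applies [- (x)_A M] to a relative bimodule resolution of [A], and
     the last one tensors two resolutions together.
   Relative projective dimension is handled through the syzygy functor
   [omega M = ker (A (x)_B M -> M)]. *)

(** The dimension is measured by [rpd n M]: the n-th iterate of [omega] is relatively projective.
    Since [omega] is functorial in B-linear maps, comparing dimensions along a B-split sequence
    needs neither Schanuel's lemma nor a horseshoe; resolutions are met only where [rel_pd] and [pd]
    are unfolded. The case pd(M (x) N) <= 1 avoids relative Ext groups. M fails to be relatively
    projective exactly when the identity of [omega M] does not extend to [ind B M]. A functional
    that vanishes on the extendable endomorphisms and is 1 on the identity, contracted with a
    lifting that pd(M (x) N) <= 1 provides, splits N off its induced module. For the radical,
    semisimplicity is used as von Neumann regularity (each s equals s x s for some x); a nil ideal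
    in a tensor product of two regular algebras over k must vanish. In characteristic 0 traces of
    idempotents show it; in characteristic p the way leads to centres of corner algebras, where p-th
    powers are additive and k has p-th roots. Bimodule resolutions are split over B on both sides,
    whereas - (x)_A M needs right A-linear splittings; [right_proj] supplies them. *)

(** * Additive maps, kernels, restriction of scalars, maps linear over a subspace *)

Lemma additive0 (U V : zmodType) (f : U -> V) : {morph f : x y / x + y} -> f 0 = 0.
Proof. by move=> fD; apply: (addrI (f 0)); rewrite -fD !addr0. Qed.

Lemma additiveN (U V : zmodType) (f : U -> V) :
  {morph f : x y / x + y} -> {morph f : x / - x}.
Proof.
by move=> fD x; apply: (addrI (f x)); rewrite -fD !subrr (additive0 fD).
Qed.

Lemma additiveB (U V : zmodType) (f : U -> V) :
  {morph f : x y / x + y} -> {morph f : x y / x - y}.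
Proof. by move=> fD x y; rewrite fD (additiveN fD). Qed.

Lemma additive_sum (U V : zmodType) (f : U -> V) I (r : seq I) (P : pred I) F :
  {morph f : x y / x + y} ->
  f (\sum_(i <- r | P i) F i) = \sum_(i <- r | P i) f (F i).
Proof. by move=> fD; exact: (big_morph _ fD (additive0 fD)). Qed.

Section Bundling.
Variables (R : pzRingType) (M N : lmodType R) (f : M -> N).
Hypotheses (fD : {morph f : x y / x + y}) (fZ : forall a x, f (a *: x) = a *: f x).

Lemma lin_of_linear : linear f. Proof. by move=> a x y; rewrite fD fZ. Qed.
Definition lin_of : {linear M -> N} :=
  HB.pack f (GRing.isLinear.Build R M N *:%R f lin_of_linear).
End Bundling.

Section Kernel.
Variables (R : pzRingType) (M N : lmodType R) (f : {linear M -> N}).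

Definition kerp : {pred M} := fun x => f x == 0.
Lemma kerp_submod : submod_closed kerp.
Proof.
have kE x : (x \in kerp) = (f x == 0) by [].
split=> [|a x y]; rewrite !kE ?linear0 //; move=> /eqP fx /eqP fy.
by rewrite linearP fx fy scaler0 addr0.
Qed.
HB.instance Definition _ := GRing.isSubmodClosed.Build R M kerp kerp_submod.

Definition kermod : Type := {x : M | x \in kerp}.
HB.instance Definition _ := [isSub of kermod for @sval M (fun x => x \in kerp)].
HB.instance Definition _ := [Choice of kermod by <:].
HB.instance Definition _ := [SubChoice_isSubLmodule of kermod by <:].

Definition kerin (x : kermod) : M := sval x.
Lemma kerinP x : f (kerin x) = 0. Proof. by apply/eqP; case: x. Qed.
Lemma kerin_inj : injective kerin. Proof. exact: val_inj. Qed.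
Lemma kerinD : {morph kerin : x y / x + y}. Proof. by []. Qed.
Lemma kerinZ a x : kerin (a *: x) = a *: kerin x. Proof. by []. Qed.
Definition kermk (x : M) (fx : f x = 0) : kermod :=
  exist _ x (introT eqP fx : x \in kerp).
Lemma kermkK x (fx : f x = 0) : kerin (kermk fx) = x. Proof. by []. Qed.
End Kernel.

(** The carrier is literally M, so a map between R'-modules is by conversion a map between their
    restrictions. *)
Definition resmod (R R' : pzRingType) (t : {rmorphism R -> R'}) (M : lmodType R') :
  Type := M.

Section Restriction.
Variables (R R' : pzRingType) (t : {rmorphism R -> R'}).
Local Notation resmod := (resmod t).

HB.instance Definition _ M := GRing.Zmodule.on (resmod M).
Definition res_act (M : lmodType R') (a : R) (x : resmod M) : resmod M :=
  t a *: (x : M).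
Section Res.
Variable M : lmodType R'.
Lemma res_actA a b (x : resmod M) : res_act a (res_act b x) = res_act (a * b) x.
Proof. by rewrite /res_act scalerA rmorphM. Qed.
Lemma res_act1 : left_id 1 (@res_act M).
Proof. by move=> x; rewrite /res_act rmorph1 scale1r. Qed.
Lemma res_actDr : right_distributive (@res_act M) +%R.
Proof. by move=> a x y; rewrite /res_act scalerDr. Qed.
Lemma res_actDl (x : resmod M) : {morph (@res_act M)^~ x : a b / a + b}.
Proof. by move=> a b; rewrite /res_act rmorphD scalerDl. Qed.
HB.instance Definition _ := GRing.Zmodule_isLmodule.Build R (resmod M)
  res_actA res_act1 res_actDr res_actDl.
Lemma resE a (x : resmod M) : a *: x = (t a *: (x : M)) :> M. Proof. by []. Qed.
End Res.
End Restriction.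

Section LinearOver.
Variables (k : fieldType) (A : falgType k).
Implicit Types (U V : {vspace A}) (M N P : lmodType A).

Lemma lo_D U M N (h : M -> N) : linear_over U h -> {morph h : x y / x + y}.
Proof. by case. Qed.

Lemma lo_Z U M N (h : M -> N) b x :
  linear_over U h -> b \in U -> h (b *: x) = b *: h x.
Proof. by case=> _ hZ bU; apply: hZ. Qed.

Lemma lo_B U M N (h : M -> N) : linear_over U h -> {morph h : x y / x - y}.
Proof. by move/lo_D/additiveB. Qed.

Lemma lo_0 U M N (h : M -> N) : linear_over U h -> h 0 = 0.
Proof. by move/lo_D/additive0. Qed.

Lemma lo_sub U V M N (h : M -> N) :
  (forall x, x \in U -> x \in V) -> linear_over V h -> linear_over U h.
Proof. by move=> UV [hD hZ]; split=> // b x /UV; apply: hZ. Qed.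

Lemma lo_full U M N (h : M -> N) : linear_over {:A} h -> linear_over U h.
Proof. by apply: lo_sub => x; rewrite memvf. Qed.

Lemma lo_id U M : linear_over U (@id M). Proof. by []. Qed.

Lemma lo_comp U M N P (g : N -> P) (h : M -> N) :
  linear_over U g -> linear_over U h -> linear_over U (fun x => g (h x)).
Proof.
by move=> [gD gZ] [hD hZ]; split=> [x y|b x bU]; rewrite ?hD ?gD ?hZ ?gZ.
Qed.

Lemma lo_add U M N (g h : M -> N) :
  linear_over U g -> linear_over U h -> linear_over U (fun x => g x + h x).
Proof.
move=> [gD gZ] [hD hZ]; split=> [x y|b x bU]; first by rewrite gD hD addrACA.
by rewrite gZ // hZ // scalerDr.
Qed.

Lemma lo_opp U M N (h : M -> N) :
  linear_over U h -> linear_over U (fun x => - h x).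
Proof.
by move=> [hD hZ]; split=> [x y|b x bU]; rewrite ?hD ?hZ ?opprD ?scalerN.
Qed.

Lemma lo_subr U M N (g h : M -> N) :
  linear_over U g -> linear_over U h -> linear_over U (fun x => g x - h x).
Proof. by move=> gU /lo_opp; apply: lo_add. Qed.

Lemma lo_linear U M N (h : {linear M -> N}) : linear_over U h.
Proof. by split=> [x y|b x _]; rewrite ?linearD ?linearZ. Qed.

Lemma lo_kerin U M N (f : {linear M -> N}) : linear_over U (@kerin _ _ _ f).
Proof. by []. Qed.

Lemma lo_bundle M N (h : M -> N) :
  linear_over {:A} h -> exists g : {linear M -> N}, forall x, g x = h x.
Proof.
by case=> hD hZ; exists (lin_of hD (fun a x => hZ a x (memvf a))).
Qed.

End LinearOver.

(** * Relative projective dimension by syzygies *)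

Section Ind.
Variables (k : fieldType) (A : falgType k) (B : {vspace A}).
Implicit Types (M N P X K : lmodType A).

Definition itens M (a : A) (m : M) : ind B M := ind_proj B (ptens a m).

Lemma itensDl M (m : M) : {morph (fun a => itens a m) : a b / a + b}.
Proof. by move=> a b; rewrite /itens ptensDl ind_projD. Qed.

Lemma itensDr M (a : A) : {morph @itens M a : m n / m + n}.
Proof. by move=> m n; rewrite /itens ptensDr ind_projD. Qed.

Lemma ind_scale_proj M (a : A) (f : free_ind M) :
  a *: ind_proj B f = ind_proj B (a *: f).
Proof. exact: ind_act_proj. Qed.

Lemma itensZ M (a b : A) (m : M) : a *: itens b m = itens (a * b) m.
Proof.
by rewrite /itens ind_scale_proj; congr ind_proj; apply: free_ind_act_ptens.
Qed.

Lemma itens_bal M (a b : A) (m : M) : b \in B -> itens (a * b) m = itens a (b *: m).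
Proof.
move=> bB; apply/ind_proj_eq/asboolP.
exists 1%N, (fun=> 1), (fun=> ptens (a * b) m - ptens a (b *: m)).
by split=> [_|]; [exists a, b, m | rewrite big_ord1 scale1r].
Qed.

Lemma itens_scale M (x : k) (a : A) (m : M) :
  itens (x *: a) m = itens a (x%:A *: m).
Proof. by rewrite /itens ptensZ. Qed.

Lemma itens_linl M (b : A) (m : M) : b \in B -> b *: itens 1 m = itens 1 (b *: m).
Proof. by move=> bB; rewrite itensZ mulr1 -[b in LHS]mul1r itens_bal. Qed.

Lemma ind_ind M (P : ind B M -> Prop) :
  (forall x y, P x -> P y -> P (x + y)) -> (forall a m, P (itens a m)) ->
  forall x, P x.
Proof.
move=> PD Pt x; rewrite -(ind_reprK x); move: (ind_repr x).
by apply: ptens_ind => [f g Pf Pg|a m]; [rewrite ind_projD; apply: PD|apply: Pt].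
Qed.

Lemma ind_eq M (Z : zmodType) (f g : ind B M -> Z) :
  {morph f : x y / x + y} -> {morph g : x y / x + y} ->
  (forall a m, f (itens a m) = g (itens a m)) -> forall x, f x = g x.
Proof.
by move=> fD gD fg; elim/ind_ind=> [x y fx fy|//]; rewrite fD gD fx fy.
Qed.

Lemma ind_mulE M a (m : M) : ind_mul (itens a m) = a *: m.
Proof. exact: ind_mul_ptens. Qed.

Lemma free_ind_mulD M : {morph @free_ind_mul k A M : f g / f + g}.
Proof. by move=> f g; have := free_ind_mul_linear 1 f g; rewrite !scale1r. Qed.

Lemma ind_mulD M : {morph @ind_mul k A B M : x y / x + y}.
Proof.
move=> x y; rewrite -(ind_reprK x) -(ind_reprK y) -ind_projD !ind_mul_proj.
exact: free_ind_mulD.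
Qed.

Lemma ind_mulZ M a (x : ind B M) : ind_mul (a *: x) = a *: ind_mul x.
Proof.
elim/ind_ind: x => [x y xZ yZ|b m]; first by rewrite scalerDr !ind_mulD xZ yZ scalerDr.
by rewrite itensZ !ind_mulE scalerA.
Qed.

Definition imul M : {linear ind B M -> M} := lin_of (@ind_mulD M) (@ind_mulZ M).

Lemma lo_imul U M : linear_over U (@ind_mul k A B M).
Proof. exact: (lo_linear U (imul M)). Qed.

Lemma lo_itens1 M : linear_over B (@itens M 1).
Proof. by split=> [x y|b x bB]; rewrite ?itensDr ?itens_linl. Qed.

Section Lift.
Hypothesis B1 : 1 \in B.
Variables (M : lmodType A) (Z : zmodType) (f : A -> M -> Z).
Hypotheses (fDl : forall m, {morph f^~ m : a b / a + b})
  (fDr : forall a, {morph f a : m n / m + n})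
  (fB : forall a b m, b \in B -> f (a * b) m = f a (b *: m)).

Let flift (g : free_ind M) : Z := \sum_(i < \dim {:A}) f (vbasis {:A})`_i (g i).

Let fliftD : {morph flift : g h / g + h}.
Proof.
move=> g h; rewrite /flift -big_split; apply: eq_bigr => i _.
by rewrite ffunE fDr.
Qed.

Let flift_ptens a m : flift (ptens a m) = f a m.
Proof.
rewrite [in RHS](coord_vbasis_full a) (additive_sum _ _ _ (fDl m)).
apply: eq_bigr => i _; rewrite ffunE.
by rewrite -fB ?rpredZ // -scalerAr mulr1.
Qed.

(** Universal property of A (x)_B M. The encoding by families indexed by a basis of A also needs f
    balanced over k; that is the case of the scalars x%:A, which lie in B because 1 does. *)
Definition ind_lift (x : ind B M) : Z := flift (ind_repr x).

Let ind_lift_proj g : ind_lift (ind_proj B g) = flift g.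
Proof.
apply/eqP; rewrite -subr_eq0 -(additiveB fliftD); apply/eqP.
have /asboolP[n [c [h [hB ->]]]] : ind_repr (ind_proj B g) - g \in @balance_rel k A B M.
  by apply/ind_proj_eq; apply: ind_reprK.
rewrite (additive_sum _ _ _ fliftD) big1 // => i _.
have [a [b [m [bB ->]]]] := hB i.
have -> : c i *: (ptens (a * b) m - ptens a (b *: m)) =
  ptens (c i * a * b) m - ptens (c i * a) (b *: m).
  rewrite scalerBr; congr (_ - _); last exact: free_ind_act_ptens.
  by rewrite -mulrA; apply: free_ind_act_ptens.
by rewrite (additiveB fliftD) !flift_ptens fB // subrr.
Qed.

Lemma ind_liftE a m : ind_lift (itens a m) = f a m.
Proof. by rewrite ind_lift_proj flift_ptens. Qed.

Lemma ind_liftD : {morph ind_lift : x y / x + y}.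
Proof.
move=> x y; rewrite -(ind_reprK x) -(ind_reprK y) -ind_projD !ind_lift_proj.
exact: fliftD.
Qed.
End Lift.

Lemma ind_lift_lo (U : {vspace A}) M N (f : A -> M -> N) : 1 \in B ->
  (forall m, {morph f^~ m : a b / a + b}) ->
  (forall a, {morph f a : m n / m + n}) ->
  (forall a b m, b \in B -> f (a * b) m = f a (b *: m)) ->
  (forall a b m, a \in U -> f (a * b) m = a *: f b m) ->
  linear_over U (@ind_lift M N f).
Proof.
move=> B1 fDl fDr fB fU; have D := ind_liftD B1 fDl fDr fB; split=> // b x bU.
elim/ind_ind: x => [x y xE yE|a m]; first by rewrite scalerDr !D xE yE scalerDr.
by rewrite itensZ !ind_liftE // fU.
Qed.

End Ind.
Arguments itens {k A} B {M} a m.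

Section Relative.
Variables (k : fieldType) (A : falgType k) (B : {vspace A}).
Hypothesis B1 : 1 \in B.
Implicit Types (M N P X K : lmodType A).
Local Notation alin := (linear_over {:A}).
Local Notation blin := (linear_over B).

Definition imap M N (h : M -> N) : ind B M -> ind B N :=
  ind_lift (fun a m => itens B a (h m)).

Section Imap.
Variables (M N : lmodType A) (h : M -> N) (hB : blin h).
Let hDl m : {morph (fun a => itens B a (h m)) : a b / a + b}.
Proof. exact: itensDl. Qed.
Let hDr a : {morph (fun m => itens B a (h m)) : m n / m + n}.
Proof. by move=> m n; rewrite (lo_D hB) itensDr. Qed.
Let hbal a b m : b \in B -> itens B (a * b) (h m) = itens B a (h (b *: m)).
Proof. by move=> bB; rewrite itens_bal // (lo_Z _ hB). Qed.
Lemma imapE a m : imap h (itens B a m) = itens B a (h m).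
Proof. exact: (ind_liftE B1 hDl hDr hbal). Qed.
Lemma lo_imap : alin (imap h).
Proof.
apply: ind_lift_lo => // a b m _; by rewrite itensZ.
Qed.
Lemma imap_mul : alin h -> forall x, ind_mul (imap h x) = h (ind_mul x).
Proof.
move=> hA; apply: ind_eq.
- apply: lo_D (lo_comp (lo_imul _ _ _) lo_imap).
- by apply: lo_D; apply: lo_comp hA (lo_imul _ _ _).
by move=> a m; rewrite imapE !ind_mulE (lo_Z _ hA) ?memvf.
Qed.
End Imap.

Lemma imap_comp M N P (g : N -> P) (h : M -> N) : blin g -> blin h ->
  forall x, imap g (imap h x) = imap (fun m => g (h m)) x.
Proof.
move=> gB hB; have ghB := lo_comp gB hB.
apply: ind_eq => [||a m]; last by rewrite !imapE.
  exact: lo_D (lo_comp (lo_imap gB) (lo_imap hB)).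
exact: lo_D (lo_imap ghB).
Qed.

Lemma imap_id M (x : ind B M) : imap (@id M) x = x.
Proof.
move: x; apply: ind_eq => [|//|a m]; last by rewrite imapE.
exact: lo_D (lo_imap (lo_id B M)).
Qed.

Definition relproj M : Prop :=
  exists s : M -> ind B M, alin s /\ forall x, ind_mul (s x) = x.

Lemma rel_projectiveE M : rel_projective B M <-> relproj M.
Proof.
split=> [[s sE]|[s [sA sE]]]; first by exists s; split=> //; apply: lo_linear.
by have [t tE] := lo_bundle sA; exists t => x; rewrite tE.
Qed.

Lemma relproj_retract M N (f : N -> M) (g : M -> N) :
  alin f -> alin g -> (forall x, g (f x) = x) -> relproj M -> relproj N.
Proof.
move=> fA gA gf [s [sA sE]]; exists (fun x => imap g (s (f x))).
have gB := lo_full B gA.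
split; first exact: lo_comp (lo_imap gB) (lo_comp sA fA).
by move=> x; rewrite imap_mul // sE gf.
Qed.

Lemma relproj_ind M : relproj (ind B M).
Proof.
exists (imap (@itens k A B M 1)); have iB := @lo_itens1 k A B M.
split; first exact: lo_imap.
apply: ind_eq => [|//|a m]; first exact: lo_D (lo_comp (lo_imul _ _ _) (lo_imap iB)).
by rewrite imapE // ind_mulE itensZ mulr1.
Qed.

(** The lift is the composite M -> A (x)_B M -> X with second map a (x) m |-> a s(f m). A B-linear s
    suffices, since induction makes this map A-linear. *)
Lemma relproj_lift M X N (p : X -> N) (s : N -> X) (f : M -> N) :
  relproj M -> alin p -> blin s -> (forall x, p (s x) = x) -> alin f ->
  exists2 g : M -> X, alin g & forall x, p (g x) = f x.
Proof.
move=> [t [tA tE]] pA sB ps fA; have sfB := lo_comp sB (lo_full B fA).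
exists (fun x => ind_mul (imap (fun m => s (f m)) (t x))).
  exact: lo_comp (lo_imul _ _ _) (lo_comp (lo_imap sfB) tA).
move=> x; rewrite -[in RHS](tE x); move: (t x) => {x}.
apply: ind_eq => [||a m].
- by apply: lo_D; apply: lo_comp pA (lo_comp (lo_imul _ _ _) (lo_imap sfB)).
- by apply: lo_D; apply: lo_comp fA (lo_imul _ _ _).
by rewrite imapE // !ind_mulE (lo_Z _ pA) ?memvf // ps (lo_Z _ fA) ?memvf.
Qed.

(** The (A,B)-exact short sequences 0 -> K -> X -> M -> 0. The relation p i = 0 follows from the
    three identities that are kept ([ses_pi]). *)
Definition split_ses K X M (i : K -> X) (p : X -> M) (s : M -> X) (r : X -> K) :=
  [/\ alin i, alin p, blin s & blin r] /\
  [/\ forall m, p (s m) = m, forall y, r (i y) = y &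
      forall x, i (r x) + s (p x) = x].

Definition ses K X M : Prop :=
  exists i p s r, @split_ses K X M i p s r.

Lemma ses_pi K X M i p s r : @split_ses K X M i p s r -> forall y, p (i y) = 0.
Proof.
move=> [[iA pA sB rB] [ps ri d]].
have pir x : p (i (r x)) = 0.
  have := congr1 p (d x); rewrite (lo_D pA) ps => /(congr1 (fun z => z - p x)).
  by rewrite addrK subrr.
by move=> y; rewrite -(ri y).
Qed.

Lemma ses_split K X M i p s r : @split_ses K X M i p s r -> relproj M ->
  exists (t : M -> X) (q : X -> K), [/\ alin t, alin q, forall m, p (t m) = m,
    forall y, q (i y) = y & forall x, i (q x) + t (p x) = x].
Proof.
move=> S Mproj; have [[iA pA sB rB] [ps ri d]] := S.
have [t tA pt] := relproj_lift Mproj pA sB ps (lo_id {:A} M).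
(* The element x - t(p x) lies in the kernel of p, which is the image of i; applying r to it
   therefore gives an A-linear retraction although r is only B-linear. *)
have iq x : i (r (x - t (p x))) = x - t (p x).
  by have := d (x - t (p x)); rewrite (lo_B pA) pt subrr (lo_0 sB) addr0.
have iI : injective i by move=> x y /(congr1 r); rewrite !ri.
exists t, (fun x => r (x - t (p x))); split=> // [|y|x].
- have qA := lo_subr (lo_id {:A} X) (lo_comp tA pA).
  split=> [x y|b x _]; apply: iI; rewrite iq.
    by rewrite (lo_D qA) (lo_D iA) !iq.
  by rewrite (lo_Z _ qA) ?memvf // (lo_Z _ iA) ?memvf // iq.
- by rewrite (ses_pi S) (lo_0 tA) subr0 ri.
by rewrite iq subrK.
Qed.

Lemma relproj_ext K X M : ses K X M -> relproj K -> relproj M -> relproj X.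
Proof.
move=> [i [p [s [r S]]]] [sK [sKA sKE]] Mp; have [sM [sMA sME]] := Mp.
have [t [q [tA qA pt qi d]]] := ses_split S Mp; have [[iA pA _ _] _] := S.
have iB := lo_full B iA; have tB := lo_full B tA.
exists (fun x => imap i (sK (q x)) + imap t (sM (p x))); split.
  apply: lo_add; first exact: lo_comp (lo_imap iB) (lo_comp sKA qA).
  exact: lo_comp (lo_imap tB) (lo_comp sMA pA).
by move=> x; rewrite ind_mulD !imap_mul // sKE sME.
Qed.

Definition omega M : lmodType A := kermod (imul B M).

Lemma omega_subproof M (x : ind B M) : imul B M (x - itens B 1 (ind_mul x)) = 0.
Proof. by rewrite /= ind_mulD (additiveN (@ind_mulD _ _ _ _)) ind_mulE scale1r subrr. Qed.

(** The B-linear projection of A (x)_B M onto [omega M] along 1 (x) M. *)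
Definition orho M (x : ind B M) : omega M := kermk (omega_subproof x).

Lemma orhoE M (x : ind B M) : kerin (orho x) = x - itens B 1 (ind_mul x).
Proof. by []. Qed.

Lemma lo_orho M : blin (@orho M).
Proof.
have H := lo_subr (lo_id B (ind B M)) (lo_comp (lo_itens1 B M) (lo_imul B B M)).
by split=> [x y|b x bB]; apply: kerin_inj; rewrite ?kerinD ?kerinZ !orhoE
  ?(lo_D H) ?(lo_Z _ H).
Qed.

Lemma orho_itens1 M (m : M) : orho (itens B 1 m) = 0.
Proof. by apply: kerin_inj; rewrite orhoE ind_mulE scale1r subrr. Qed.

Lemma orho_kerin M (z : omega M) : orho (kerin z) = z.
Proof.
apply: kerin_inj; rewrite orhoE; have := kerinP z; rewrite /= => ->.
by rewrite (additive0 (@itensDr _ _ _ _ _)) subr0.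
Qed.

Lemma ses_omega_split M :
  split_ses (@kerin _ _ _ (imul B M)) (@ind_mul k A B M) (@itens k A B M 1) (@orho M).
Proof.
split; split; [by []|exact: lo_imul|exact: lo_itens1|exact: lo_orho| | | ].
- by move=> m; rewrite ind_mulE scale1r.
- exact: orho_kerin.
by move=> x; rewrite orhoE subrK.
Qed.

Lemma ses_omega M : ses (omega M) (ind B M) M.
Proof. by do 4 eexists; exact: ses_omega_split. Qed.

(* [omega M] is [(A/B) (x)_B M] as a left [B]-module, hence functorial in
   [B]-linear maps. *)
Definition omap M N (h : M -> N) (z : omega M) : omega N := orho (imap h (kerin z)).

Lemma lo_omap M N (h : M -> N) : blin h -> blin (omap h).
Proof.
move=> hB; apply: lo_comp (lo_orho N) (lo_comp (lo_full B (lo_imap hB)) _).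
exact: lo_kerin.
Qed.

(** For A-linear h the correction term of [orho] vanishes on the kernel of multiplication, so
    [omap h] is a plain restriction. *)
Lemma kerin_omap M N (h : M -> N) : alin h -> forall z,
  kerin (omap h z) = imap h (kerin z).
Proof.
move=> hA z; have hB := lo_full B hA; rewrite orhoE imap_mul //.
have := kerinP z; rewrite /= => ->.
by rewrite (lo_0 hA) (additive0 (@itensDr _ _ _ _ _)) subr0.
Qed.

Lemma lo_omapA M N (h : M -> N) : alin h -> alin (omap h).
Proof.
move=> hA; have hB := lo_full B hA; have iA := lo_imap hB.
by split=> [x y|b x _]; apply: kerin_inj;
  rewrite ?kerinD ?kerinZ !kerin_omap // ?kerinD ?kerinZ ?(lo_D iA) ?(lo_Z _ iA) ?memvf.
Qed.

Lemma orho_imap M N (h : M -> N) (x : ind B M) : blin h ->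
  omap h (orho x) = orho (imap h x).
Proof.
move=> hB; have iA := lo_imap hB; rewrite /omap orhoE (lo_B iA) imapE //.
by rewrite (lo_B (lo_orho N)) orho_itens1 subr0.
Qed.

Lemma omap_comp M N P (g : N -> P) (h : M -> N) : blin g -> blin h ->
  forall z, omap g (omap h z) = omap (fun m => g (h m)) z.
Proof. by move=> gB hB z; rewrite orho_imap // imap_comp. Qed.

Lemma omap_ext M N (g h : M -> N) : g =1 h -> omap g =1 omap h.
Proof. by move=> /funext ->. Qed.

Lemma omap_id M : omap (@id M) =1 id.
Proof.
by move=> z; rewrite /omap imap_id orho_kerin.
Qed.

Lemma omap_add M N (g h : M -> N) : blin g -> blin h ->
  forall z, omap (fun x => g x + h x) z = omap g z + omap h z.
Proof.
move=> gB hB z; rewrite /omap -(lo_D (lo_orho N)); congr orho.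
have ghB := lo_add gB hB.
move: (kerin z); apply: ind_eq => [||a m]; first exact: lo_D (lo_imap ghB).
  exact: lo_D (lo_add (lo_imap gB) (lo_imap hB)).
by rewrite !imapE // itensDr.
Qed.

(** The splitting identities are preserved because [omega] is an additive functor on B-linear maps;
    i and p stay A-linear by [lo_omapA]. *)
Lemma omega_ses K X M : ses K X M -> ses (omega K) (omega X) (omega M).
Proof.
move=> [i [p [s [r [[iA pA sB rB] [ps ri d]]]]]].
have iB := lo_full B iA; have pB := lo_full B pA.
exists (omap i), (omap p), (omap s), (omap r); split; split.
- exact: lo_omapA.
- exact: lo_omapA.
- exact: lo_omap.
- exact: lo_omap.
- by move=> z; rewrite omap_comp // (omap_ext ps) omap_id.
- by move=> z; rewrite omap_comp // (omap_ext ri) omap_id.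
move=> z; rewrite !omap_comp // -omap_add ?(omap_ext d) ?omap_id //.
  exact: lo_comp.
exact: lo_comp.
Qed.

(** Relative projective dimension at most n, tested on one canonical syzygy; [rel_pd_le] identifies
    it with the definition by resolutions. *)
Fixpoint rpd n M : Prop := if n is m.+1 then rpd m (omega M) else relproj M.

Lemma rpd_ext n K X M : ses K X M -> rpd n K -> rpd n M -> rpd n X.
Proof.
elim: n K X M => [|n IHn] K X M; first exact: relproj_ext.
by move=> /omega_ses; apply: IHn.
Qed.

Lemma rpd_retract n M N (f : N -> M) (g : M -> N) :
  alin f -> alin g -> (forall x, g (f x) = x) -> rpd n M -> rpd n N.
Proof.
elim: n M N f g => [|n IHn] M N f g fA gA gf; first exact: relproj_retract gf.
apply: (IHn _ _ (omap f) (omap g)); [exact: lo_omapA|exact: lo_omapA|move=> z].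
by rewrite omap_comp ?(omap_ext gf) ?omap_id //; apply: lo_full.
Qed.

Lemma relproj_omega M : relproj M -> relproj (omega M).
Proof.
move=> /(ses_split (ses_omega_split M))[t [q [tA qA _ qi _]]].
by apply: (relproj_retract (lo_kerin _ _) qA qi); apply: relproj_ind.
Qed.

Lemma rpd_proj n M : relproj M -> rpd n M.
Proof. by elim: n M => [|n IHn] M //= /relproj_omega; apply: IHn. Qed.

Lemma rpdS n M : rpd n M -> rpd n.+1 M.
Proof. by elim: n M => [|n IHn] M; [apply: relproj_omega|apply: IHn]. Qed.

Lemma rpd_leq m n M : (m <= n)%N -> rpd m M -> rpd n M.
Proof.
by move=> /subnK <-; elim: (n - m)%N => // j IHj Hm; rewrite addSn; apply/rpdS/IHj.
Qed.

(* The pullback of [ind B M -> M] along [X -> M] is an extension in two ways. *)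
Lemma ses_rotate K X M : ses K X M -> exists E, [/\ ses (omega M) E X,
  exists (f : K -> E) g, [/\ alin f, alin g & forall x, g (f x) = x] &
  forall n, rpd n K -> rpd n E].
Proof.
move=> [i [p [s [r S]]]]; have [[iA pA sB rB] [ps ri d]] := S.
pose P := ind B M.
pose h (z : X * P) : M := p z.1 - ind_mul z.2.
have hD : {morph h : x y / x + y}.
  by move=> x y; rewrite /h /= (lo_D pA) ind_mulD opprD addrACA.
have hZ a x : h (a *: x) = a *: h x.
  by rewrite /h /= (lo_Z _ pA) ?memvf // ind_mulZ scalerBr.
pose H := lin_of hD hZ; pose E := kermod H.
have EP (z : E) : ind_mul (kerin z).2 = p (kerin z).1.
  by apply/esym/eqP; rewrite -subr_eq0; apply/eqP; apply: (kerinP z).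
have mkP x y : ind_mul y = p x -> H (x, y) = 0.
  by move=> yx; rewrite /= /h /= yx subrr.
have [[wA mA oB rhoB] [mo rhok dO]] := ses_omega_split M.
have K0 (z : omega M) : ind_mul (kerin z) = 0 := kerinP z.
have I1 (z : omega M) : ind_mul (kerin z) = p 0 by rewrite K0 (lo_0 pA).
have S1 x : ind_mul (itens B 1 (p x)) = p x by rewrite ind_mulE scale1r.
have I2 y : ind_mul (0 : P) = p (i y) by rewrite (ses_pi S) (additive0 (@ind_mulD _ _ _ _)).
have S2 (y : P) : ind_mul y = p (s (ind_mul y)) by rewrite ps.
have sE1 : split_ses (fun z => kermk (mkP _ _ (I1 z)) : E) (fun z : E => (kerin z).1)
    (fun x => kermk (mkP _ _ (S1 x)) : E) (fun z : E => orho (kerin z).2).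
  have pair_eq (x y : X * P) : x.1 = y.1 -> x.2 = y.2 -> x = y.
    by case: x y => [? ?] [? ?] /= -> ->.
  split; split=> //.
  - by split=> [x y|b x _]; apply: kerin_inj; apply: pair_eq; rewrite //= ?addr0 ?scaler0.
  - by split=> [x y|b x bB]; apply: kerin_inj; apply: pair_eq => //=;
      rewrite ?(lo_D pA) ?(lo_Z _ pA) ?memvf ?itensDr ?itens_linl.
  - by split=> [x y|b x bB] /=; rewrite ?(lo_D rhoB) ?(lo_Z _ rhoB).
  move=> z; apply: kerin_inj; apply: pair_eq; rewrite /= ?add0r //.
  by rewrite EP subrK.
have sE2 : split_ses (fun y => kermk (mkP _ _ (I2 y)) : E) (fun z : E => (kerin z).2)
    (fun y => kermk (mkP _ _ (S2 y)) : E) (fun z : E => r (kerin z).1).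
  have pair_eq (x y : X * P) : x.1 = y.1 -> x.2 = y.2 -> x = y.
    by case: x y => [? ?] [? ?] /= -> ->.
  have smB := lo_comp sB (lo_full B mA).
  split; split=> //.
  - by split=> [x y|b x _]; apply: kerin_inj; apply: pair_eq;
      rewrite //= ?addr0 ?scaler0 ?(lo_D iA) ?(lo_Z _ iA) ?memvf.
  - by split=> [x y|b x bB]; apply: kerin_inj; apply: pair_eq => //=;
      rewrite ?(lo_D smB) ?(lo_Z _ smB).
  - by split=> [x y|b x bB] /=; rewrite ?(lo_D rB) ?(lo_Z _ rB).
  move=> z; apply: kerin_inj; apply: pair_eq; rewrite /= ?add0r //.
  by rewrite EP d.
exists E; split.
- by do 4 eexists; exact: sE1.
(* E -> ind B M is a B-split surjection onto a relative projective, so it splits over A and K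
   becomes a summand of E. *)
- have [t [q [tA qA _ qi _]]] := ses_split sE2 (relproj_ind M).
  by eexists; exists q; split; [case: sE2 => -[]|exact: qA|exact: qi].
move=> n Kn; apply: (rpd_ext (K := K) (M := P)) => //; last exact/rpd_proj/relproj_ind.
by do 4 eexists; exact: sE2.
Qed.

(** K is a direct summand of the pullback E of [ses_rotate], and E is an extension of X by
    [omega M]. *)
Lemma rpd_sub n K X M : ses K X M -> rpd n X -> rpd n.+1 M -> rpd n K.
Proof.
move=> /ses_rotate[E [sE [f [g [fA gA gf]]] _]] Xn Mn.
by apply: (rpd_retract fA gA gf); apply: (rpd_ext sE).
Qed.

(** In the rotated sequence 0 -> omega M -> E -> X -> 0 the syzygy of M is the kernel, so [rpd_sub]
    applies to it. *)
Lemma rpd_quo n K X M : ses K X M -> rpd n K -> rpd n.+1 X -> rpd n.+1 M.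
Proof.
move=> /ses_rotate[E [sE _ KE]] Kn Xn.
exact: (rpd_sub sE (KE n Kn)).
Qed.

Lemma rpd_ses n K P M : ses K P M -> relproj P -> rpd n K <-> rpd n.+1 M.
Proof.
move=> sM Pp; split=> H; first exact: (rpd_quo sM H (rpd_proj _ Pp)).
exact: (rpd_sub sM (rpd_proj _ Pp) H).
Qed.

Lemma rpd_iter m n M : rpd (m + n) M <-> rpd n (iter m omega M).
Proof.
by elim: m M => [|m IHm] M //; rewrite iterSr -IHm.
Qed.

End Relative.

(** * Splicing and truncating complexes *)

Section Splice.
Variable R : pzRingType.

Definition comp_lin (X Y Z : lmodType R) (g : {linear Y -> Z}) (f : {linear X -> Y}) :
  {linear X -> Z} := (g \o f)%FUN.

Definition corest (X Y Z : lmodType R) (f : {linear X -> Y}) (g : {linear Y -> Z})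
  (gf : forall x, g (f x) = 0) (x : X) : kermod g := kermk (gf x).

Section Corest.
Variables (X Y Z : lmodType R) (f : {linear X -> Y}) (g : {linear Y -> Z})
  (gf : forall x, g (f x) = 0).
Lemma corestD : {morph corest gf : x y / x + y}.
Proof. by move=> x y; apply: kerin_inj; rewrite kerinD !kermkK linearD. Qed.
Lemma corestZ a x : corest gf (a *: x) = a *: corest gf x.
Proof. by apply: kerin_inj; rewrite kerinZ !kermkK linearZ. Qed.
Definition corest_lin : {linear X -> kermod g} := lin_of corestD corestZ.
End Corest.

Section Def.
Variables (K P0 M : lmodType R) (i : {linear K -> P0}) (p : {linear P0 -> M})
  (P : nat -> lmodType R)
  (d : forall n, {linear augment K P n.+1 -> augment K P n}).

Definition splice (n : nat) : lmodType R := if n is m.+1 then P m else P0.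

Definition splice_d n : {linear augment M splice n.+1 -> augment M splice n} :=
  match n return {linear augment M splice n.+1 -> augment M splice n} with
  | O => p
  | m.+1 => match m return {linear augment M splice m.+2 -> augment M splice m.+1} with
            | O => comp_lin i (d 0)
            | l.+1 => d l.+1
            end
  end.

Lemma splice_complex : (forall y, p (i y) = 0) -> is_complex d -> is_complex splice_d.
Proof. by move=> pi dd [|[|n]] x /=; rewrite ?pi ?dd ?linear0. Qed.

Lemma splice_exact : (forall y, p (i y) = 0) -> injective i ->
  (forall x, p x = 0 -> exists y, i y = x) -> (forall x, exists y, p y = x) ->
  exact_complex d -> exact_complex splice_d.
Proof.
move=> pi iI ip ps [dd d0 dE]; split; [exact: splice_complex|exact: ps|].
case=> [|[|n]] x /=; [move=> /ip[y <-]|move=> ix|exact: (dE n.+1)].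
  by have [z <-] := d0 y; exists z.
by apply: (dE 0); apply: iI; rewrite [LHS]ix linear0.
Qed.

Lemma splice_vanish l : vanishes_above P l -> vanishes_above splice l.+1.
Proof. by move=> Pl [|n] //; apply: Pl. Qed.
End Def.

Section Undo.
Variables (M : lmodType R) (P : nat -> lmodType R)
  (d : forall n, {linear augment M P n.+1 -> augment M P n}).
Hypothesis dd : is_complex d.
Local Notation K := (kermod (d 0)).

Definition unsplice (n : nat) : lmodType R := P n.+1.

Definition unsplice_d n : {linear augment K unsplice n.+1 -> augment K unsplice n} :=
  match n return {linear augment K unsplice n.+1 -> augment K unsplice n} with
  | O => corest_lin (f := d 1%N) (g := d 0) (dd (n := 0))
  | m.+1 => d m.+2
  end.

Lemma unsplice_exact : exact_complex d -> exact_complex unsplice_d.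
Proof.
move=> [_ d0 dE]; split.
- case=> [|n] x /=; last exact: (@dd n.+2).
  by apply: kerin_inj; apply: (@dd 1).
- move=> x; have [y yx] := dE 0 _ (kerinP x).
  by exists y; apply: kerin_inj; rewrite -yx.
case=> [|n] x /=; last exact: (dE n.+2).
by move=> /(congr1 (@kerin _ _ _ _)) /= /(dE 1%N).
Qed.

Lemma unsplice_vanish l : vanishes_above P l.+1 -> vanishes_above unsplice l.
Proof. by move=> Pl n ln; apply: Pl. Qed.
End Undo.

(** Zero padding: complexes are indexed by all of nat, so a finite resolution continues with zero
    modules. *)
Definition zeromod (M : lmodType R) : lmodType R := kermod (idfun : {linear M -> M}).

Lemma zeromod0 M (x : zeromod M) : x = 0.
Proof. by apply: kerin_inj; apply: (kerinP x). Qed.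

Lemma zeromod_fin_gen M : fin_gen (zeromod M).
Proof.
by exists 0%N, (fun=> 0) => x; exists (fun=> 0); rewrite big_ord0 (zeromod0 x).
Qed.

Definition zero_lin (X Y : lmodType R) : {linear X -> Y} :=
  lin_of (f := fun=> 0) (fun _ _ => esym (addr0 _)) (fun a _ => esym (scaler0 _ a)).

Lemma augment_zero M n (x : augment (zeromod M) (fun=> zeromod M) n) : x = 0.
Proof. by case: n x => [|n] x; apply: zeromod0. Qed.

Definition zero_d M n : {linear augment (zeromod M) (fun=> zeromod M) n.+1 ->
  augment (zeromod M) (fun=> zeromod M) n} := zero_lin _ _.

Lemma zero_exact M : exact_complex (zero_d M).
Proof.
split=> [n x|x|n x _] //; first by exists 0; rewrite [LHS]augment_zero [RHS]augment_zero.
by exists 0; rewrite [LHS]augment_zero [RHS]augment_zero.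
Qed.

End Splice.

(** * Finite-dimensional modules *)

Section FiniteDim.
Variables (k : fieldType).

(** Finite generation over k through the scalars c%:A. Unlike [fin_gen], it passes along maps that
    are only k-linear, also between modules over different algebras. *)
Definition fd (A : falgType k) (M : lmodType A) : Prop :=
  exists n (g : 'I_n -> M), forall x, exists c : 'I_n -> k,
    x = \sum_i (c i)%:A *: g i.

Lemma fd_fintype (A : falgType k) (M : lmodType A) (I : finType) (g : I -> M) :
  (forall x, exists c : I -> k, x = \sum_i (c i)%:A *: g i) -> fd M.
Proof.
move=> gM; exists #|I|, (fun j => g (enum_val j)) => x; have [c ->] := gM x.
exists (fun j => c (enum_val j)).
by rewrite (reindex _ (onW_bij _ (enum_val_bij I))).
Qed.

Lemma fd_surj (A A' : falgType k) (M : lmodType A) (N : lmodType A') (f : M -> N) :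
  {morph f : x y / x + y} -> (forall c x, f (c%:A *: x) = c%:A *: f x) ->
  (forall y, exists x, f x = y) -> fd M -> fd N.
Proof.
move=> fD fZ fS [n [g gM]]; exists n, (fun i => f (g i)) => y.
have [x <-] := fS y; have [c ->] := gM x; exists c.
by rewrite (additive_sum _ _ _ fD); apply: eq_bigr => i _.
Qed.

Lemma fd_fin_gen (A : falgType k) (M : lmodType A) : fd M <-> fin_gen M.
Proof.
split=> [[n [g gM]]|[n [g gM]]].
  by exists n, g => x; have [c ->] := gM x; exists (fun i => (c i)%:A).
apply: (fd_fintype (g := fun ij : 'I_n * 'I_(\dim {:A}) =>
  (vbasis {:A})`_ij.2 *: g ij.1)) => x.
have [c ->] := gM x; exists (fun ij => coord (vbasis {:A}) ij.2 (c ij.1)).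
rewrite -(pair_bigA _ (fun i j => (coord (vbasis {:A}) j (c i))%:A *:
  ((vbasis {:A})`_j *: g i))) /=; apply: eq_bigr => i _.
rewrite [in LHS](coord_vbasis_full (c i)) scaler_suml; apply: eq_bigr => j _.
by rewrite scalerA -scalerAl mul1r.
Qed.

Variables (A : falgType k) (B : {vspace A}).
Hypothesis B1 : 1 \in B.

Lemma scalar_mem (c : k) : c%:A \in B. Proof. exact: rpredZ. Qed.

Lemma fd_ind (M : lmodType A) : fd M -> fd (ind B M).
Proof.
move=> [n [g gM]].
apply: (fd_fintype (g := fun ij : 'I_(\dim {:A}) * 'I_n =>
  itens B (vbasis {:A})`_ij.1 (g ij.2))).
elim/ind_ind => [x y [c ->] [c' ->]|a m].
  exists (fun ij => c ij + c' ij); rewrite -big_split; apply: eq_bigr => i _.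
  by rewrite scalerDl scalerDl.
have [c ->] := gM m.
exists (fun ij => coord (vbasis {:A}) ij.1 a * c ij.2).
rewrite -(pair_bigA _ (fun i j => (coord (vbasis {:A}) i a * c j)%:A *:
  itens B (vbasis {:A})`_i (g j))) /=.
rewrite [in LHS](coord_vbasis_full a) (additive_sum _ _ _ (@itensDl _ _ B M _)).
apply: eq_bigr => i _; rewrite (additive_sum _ _ _ (@itensDr _ _ B M _)).
apply: eq_bigr => j _.
by rewrite -itens_scale itensZ -scalerAl mul1r scalerA [in RHS]mulrC.
Qed.

(** K is the image of X under the retraction r, which is k-linear because k lies in B. *)
Lemma fd_ses_l (K X M : lmodType A) : ses B K X M -> fd X -> fd K.
Proof.
move=> [i [p [s [r [[_ _ _ rB] [_ ri _]]]]]].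
apply: fd_surj (lo_D rB) _ _ => [c x|y]; last by exists (i y).
by rewrite (lo_Z _ rB) ?scalar_mem.
Qed.

Lemma fd_omega M : fd M -> fd (omega B M).
Proof. by move=> Mfd; exact: fd_ses_l (ses_omega B M) (fd_ind Mfd). Qed.

Lemma fd_iter_omega m M : fd M -> fd (iter m (@omega _ _ B) M).
Proof. by elim: m => //= m IHm /IHm; apply: fd_omega. Qed.

End FiniteDim.

Section Least.
Variable S : nat -> Prop.
Hypothesis S_mono : forall m n, (m <= n)%N -> S m -> S n.

Lemma least_le n : (least S <= (Posz n)%:E)%E <-> S n.
Proof.
rewrite /least; case: pselect => [ex|nex]; last first.
  by split=> // Sn; case: nex; exists n; apply/asboolP.
case: ex_minnP => m /asboolP Sm mmin; rewrite lee_fin lez_nat.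
by split=> [mn|Sn]; [apply: S_mono mn Sm|apply: mmin; apply/asboolP].
Qed.

End Least.

Lemma least_cases S : least S = +oo%E \/ exists n, least S = (Posz n)%:E.
Proof. by rewrite /least; case: pselect => [ex|_]; [right; eexists|left]. Qed.

Lemma vanishes_mono (R : pzRingType) (P : nat -> lmodType R) m n :
  (m <= n)%N -> vanishes_above P m -> vanishes_above P n.
Proof. by move=> mn Pm i ni; apply: Pm; apply: leq_ltn_trans ni. Qed.

(** * Relative resolutions and iterated syzygies *)

Section RelativeResolutions.
Variables (k : fieldType) (A : falgType k) (B : {vspace A}).
Hypothesis B1 : 1 \in B.
Implicit Types (M K X : lmodType A).

Definition has_rel_res l M := exists (P : nat -> lmodType A)
  (d : forall n, {linear augment M P n.+1 -> augment M P n}),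
  [/\ forall n, fin_gen (P n), forall n, rel_projective B (P n),
      rel_exact_complex B d & vanishes_above P l].

Lemma relproj_zeromod M : relproj B (zeromod M).
Proof.
by exists (fun=> 0); split=> [|x]; rewrite ?[RHS]zeromod0 ?[LHS]zeromod0 //;
  split=> [x y|b x _]; rewrite ?addr0 ?scaler0.
Qed.

Lemma rel_res0 M : fd M -> relproj B M -> has_rel_res 0 M.
Proof.
move=> Mfd Mp.
exists (splice M (fun=> zeromod M)),
  (splice_d (zero_lin (zeromod M) M) (idfun : {linear M -> M}) (zero_d M)).
split.
- by case=> [|n]; [apply/fd_fin_gen|apply: zeromod_fin_gen].
- by case=> [|n]; apply/rel_projectiveE => //; apply: relproj_zeromod.
- split; first by apply: splice_complex.
  exists (fun n => match n return augment M (splice M (fun=> zeromod M)) n ->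
    augment M (splice M (fun=> zeromod M)) n.+1 with O => id | m.+1 => fun=> 0 end).
  split=> [[|n]|//|[|[|n]] x] //=.
  - by split=> [x y|b x _]; rewrite ?addr0 ?scaler0.
  - exact: add0r.
  - by rewrite [LHS]zeromod0 [RHS]zeromod0.
  by rewrite [LHS]zeromod0 [RHS]zeromod0.
by case=> [|n] // _ x; apply: zeromod0.
Qed.

Lemma rel_res_splice l K X M : ses B K X M -> fd X -> relproj B X ->
  has_rel_res l K -> has_rel_res l.+1 M.
Proof.
move=> [i [p [s [r S]]]] Xfd Xp [P [d [Pfg Pp [dd [h [hB h0 hE]]] Pl]]].
have [[iA pA sB rB] [ps ri isr]] := S; have pi := ses_pi S.
have [i' i'E] := lo_bundle iA; have [p' p'E] := lo_bundle pA.
exists (splice X P), (splice_d i' p' d); split; last exact: splice_vanish.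
- by case=> [|n]; [apply/fd_fin_gen|apply: Pfg].
- by case=> [|n]; [apply/rel_projectiveE|apply: Pp].
split; first by apply: splice_complex => // y; rewrite i'E p'E.
(* Contracting homotopy of the spliced complex: s, then h 0 after the retraction r onto K, then the
   homotopy of the resolution of K. *)
exists (fun n => match n return augment M (splice X P) n -> augment M (splice X P) n.+1 with
  | O => s
  | m.+1 => match m return augment M (splice X P) m.+1 -> augment M (splice X P) m.+2 with
    | O => fun x => h 0%N (r x) | l.+1 => h l.+1 end end).
split=> [[|[|n]]|x|[|[|n]] x] //=.
- exact: lo_comp (hB 0%N) rB.
- exact: (hB n.+1).
- by rewrite p'E.
- by rewrite h0 i'E p'E.
- by rewrite i'E ri; apply: (hE 0%N).
exact: (hE n.+1).
Qed.

Lemma rpd_rel_res l M : fd M -> rpd B l M -> has_rel_res l M.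
Proof.
elim: l M => [|l IHl] M Mfd; first exact: rel_res0.
move=> /(IHl _ (fd_omega B1 Mfd)); apply: rel_res_splice (ses_omega B M) _ _.
  exact: fd_ind.
exact: relproj_ind.
Qed.

(** With only P 0 left, h 0 is a two-sided inverse of d 0 and therefore A-linear. Otherwise the
    truncated complex resolves the kernel of d 0, and the dimension is shifted. *)
Lemma rel_res_rpd l M : has_rel_res l M -> rpd B l M.
Proof.
elim: l M => [|l IHl] M [P [d [Pfg Pp [dd [h [hB h0 hE]]] Pl]]].
  have /rel_projectiveE Q := Pp 0%N.
  have P1 (x : P 1%N) : x = 0 by apply: Pl.
  have hd (x : P 0%N) : h 0%N (d 0%N x) = x.
    have := hE 0%N x; rewrite [X in d 1%N X](P1 (h 1%N x)) linear0 add0r.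
    by [].
  have h0A : linear_over {:A} (h 0%N).
    have dI (x y : P 0%N) : d 0%N x = d 0%N y -> x = y.
      by move=> /(congr1 (h 0%N)); rewrite !hd.
    split=> [x y|b x _]; apply: dI; rewrite ?linearD ?linearZ !h0 //.
  exact: (relproj_retract B1 h0A (lo_linear {:A} (d 0%N)) h0 Q).
have [K0 H1] : ses B (kermod (d 0%N)) (P 0%N) M /\ has_rel_res l (kermod (d 0%N)).
  have hd (x : P 0%N) : d 0%N x = 0 -> d 1%N (h 1%N x) = x.
    by move=> dx; have := hE 0%N x; rewrite dx (lo_0 (hB 0%N)) addr0.
  split.
    (* By the homotopy identity d 1 (h 1 x) = x - h 0 (d 0 x), the B-linear projection onto the
       kernel of d 0. *)
    pose r (x : P 0%N) : kermod (d 0%N) := corest_lin (dd 0) (h 1%N x).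
    exists (@kerin _ _ _ (d 0%N)), (d 0%N), (h 0%N), r.
    split; split=> //.
    - exact: lo_linear.
    - exact: (hB 0%N).
    - exact: (lo_comp (lo_linear B (corest_lin (dd 0))) (hB 1%N)).
    - by move=> y; apply: kerin_inj; apply: (hd _ (kerinP y)).
    exact: (hE 0%N).
  exists (unsplice P), (unsplice_d dd); split=> [n|n||]; last exact: unsplice_vanish.
  - exact: Pfg.
  - exact: Pp.
  split.
    case=> [|n] x /=; last exact: (dd n.+2).
    by apply: kerin_inj; apply: (dd 1).
  exists (fun n => match n return augment (kermod (d 0%N)) (unsplice P) n ->
      augment (kermod (d 0%N)) (unsplice P) n.+1 with
    | O => fun x => h 1%N (kerin x) | m.+1 => h m.+2 end).
  split=> [[|n]|x|[|n] x] /=.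
  - exact: (lo_comp (hB 1%N) (lo_kerin B (d 0%N))).
  - exact: (hB n.+2).
  - by apply: kerin_inj; apply: (hd _ (kerinP x)).
  - exact: (hE 1%N).
  exact: (hE n.+2).
have /rel_projectiveE Q := Pp 0%N.
by apply/(rpd_ses B1 l K0 Q); apply: IHl.
Qed.

Lemma rel_pd_le l M : fd M -> (rel_pd B M <= (Posz l)%:E)%E <-> rpd B l M.
Proof.
move=> Mfd; rewrite /rel_pd least_le => [|m n mn [P [d [? ? ? Pm]]]]; last first.
  by exists P, d; split=> //; apply: vanishes_mono Pm.
by split; [apply: rel_res_rpd|apply: rpd_rel_res].
Qed.

Lemma rel_gldim_le l : (rel_gldim B <= (Posz l)%:E)%E <->
  forall M, fd M -> rpd B l M.
Proof.
rewrite /rel_gldim least_le => [|m n mn H M /H Hm]; last first.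
  by apply: (Order.POrderTheory.le_trans Hm); rewrite lee_fin lez_nat.
split=> H M Mf; first by apply/rel_pd_le => //; apply: H; apply/fd_fin_gen.
by apply/rel_pd_le; [apply/fd_fin_gen|apply: H; apply/fd_fin_gen].
Qed.

End RelativeResolutions.

(** * Balanced tensor products *)

(* The tensor product of [U] and [V] balanced over operators [W] acting by [r]
   on [U] and by [l] on [V]: finite formal sums of pairs, two of which are
   identified when every balanced biadditive map takes the same value on them. *)
Section GTens.
Variables (U V : zmodType) (W : Type) (r : W -> U -> U) (l : W -> V -> V).

Definition balanced (Z : zmodType) (f : U -> V -> Z) : Prop :=
  [/\ forall v, {morph f^~ v : x y / x + y}, forall u, {morph f u : x y / x + y} &
      forall w u v, f (r w u) v = f u (l w v)].

Definition geval (Z : zmodType) (f : U -> V -> Z) (s : seq (U * V)) : Z :=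
  \sum_(p <- s) f p.1 p.2.

Definition grel (s t : seq (U * V)) : bool :=
  `[< forall (Z : zmodType) (f : U -> V -> Z), balanced f -> geval f s = geval f t >].

Lemma grel_refl : reflexive grel. Proof. by move=> s; apply/asboolP. Qed.
Lemma grel_sym : symmetric grel.
Proof. by move=> s t; apply/asboolP/asboolP=> H Z f fb; rewrite H. Qed.
Lemma grel_trans : transitive grel.
Proof. by move=> s t u /asboolP H /asboolP H'; apply/asboolP=> Z f fb; rewrite H // H'. Qed.

Definition grel_equiv := EquivRel grel grel_refl grel_sym grel_trans.

Definition gtens : Type := {eq_quot grel_equiv}%qT.
HB.instance Definition _ := Choice.on gtens.

Definition gpi (s : seq (U * V)) : gtens := (\pi_({eq_quot grel_equiv}) s)%qT.
Definition grepr (x : gtens) : seq (U * V) := repr (x : {eq_quot grel_equiv}%qT).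

Lemma greprK : cancel grepr gpi. Proof. exact: reprK. Qed.

Lemma gpi_eq s t : gpi s = gpi t <->
  forall (Z : zmodType) (f : U -> V -> Z), balanced f -> geval f s = geval f t.
Proof.
split=> [/eqquotP/asboolP //|H].
by apply/eqquotP/asboolP.
Qed.

Lemma geval_repr (Z : zmodType) (f : U -> V -> Z) s : balanced f ->
  geval f (grepr (gpi s)) = geval f s.
Proof. by apply: (gpi_eq _ _).1; rewrite greprK. Qed.

Lemma geval_cat (Z : zmodType) (f : U -> V -> Z) s t :
  geval f (s ++ t) = geval f s + geval f t.
Proof. by rewrite /geval big_cat. Qed.

Definition gneg (s : seq (U * V)) := [seq (- p.1, p.2) | p <- s].

Lemma geval_neg (Z : zmodType) (f : U -> V -> Z) s : balanced f ->
  geval f (gneg s) = - geval f s.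
Proof.
move=> [fDl _ _]; rewrite /geval big_map -sumrN; apply: eq_bigr => p _ /=.
by rewrite (additiveN (fDl p.2)).
Qed.

Definition gadd x y := gpi (grepr x ++ grepr y).
Definition gopp x := gpi (gneg (grepr x)).
Definition gzero := gpi [::].

Lemma gaddA : associative gadd.
Proof.
move=> x y z; apply/gpi_eq => Z f fb.
by rewrite !geval_cat !geval_repr // !geval_cat addrA.
Qed.
Lemma gaddC : commutative gadd.
Proof. by move=> x y; apply/gpi_eq => Z f fb; rewrite !geval_cat addrC. Qed.
Lemma gadd0 : left_id gzero gadd.
Proof.
move=> x; rewrite -[RHS]greprK; apply/gpi_eq => Z f fb.
by rewrite geval_cat geval_repr // /geval big_nil add0r.
Qed.
Lemma gaddN : left_inverse gzero gopp gadd.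
Proof.
move=> x; apply/gpi_eq => Z f fb.
by rewrite geval_cat geval_repr // geval_neg // addNr /geval big_nil.
Qed.

HB.instance Definition _ := GRing.isZmodule.Build gtens gaddA gaddC gadd0 gaddN.

Definition gt (u : U) (v : V) : gtens := gpi [:: (u, v)].

Lemma gtDl v : {morph gt^~ v : x y / x + y}.
Proof.
move=> x y; apply/gpi_eq => Z f fb; have [fDl _ _] := fb.
by rewrite geval_cat !geval_repr // /geval !big_seq1 /= fDl.
Qed.

Lemma gtDr u : {morph gt u : x y / x + y}.
Proof.
move=> x y; apply/gpi_eq => Z f fb; have [_ fDr _] := fb.
by rewrite geval_cat !geval_repr // /geval !big_seq1 /= fDr.
Qed.

Lemma gt_bal w u v : gt (r w u) v = gt u (l w v).
Proof. by apply/gpi_eq => Z f fb; have [_ _ fB] := fb; rewrite /geval !big_seq1 /= fB. Qed.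

Definition glift (Z : zmodType) (f : U -> V -> Z) (x : gtens) : Z := geval f (grepr x).

Section Lift.
Variables (Z : zmodType) (f : U -> V -> Z) (fb : balanced f).
Lemma gliftE u v : glift f (gt u v) = f u v.
Proof. by rewrite /glift geval_repr // /geval big_seq1. Qed.
Lemma gliftD : {morph glift f : x y / x + y}.
Proof. by move=> x y; rewrite /glift geval_repr // geval_cat. Qed.
End Lift.

Lemma gt_ind (P : gtens -> Prop) :
  (forall x y, P x -> P y -> P (x + y)) -> (forall u v, P (gt u v)) -> forall x, P x.
Proof.
move=> PD Pt x; rewrite -(greprK x); elim: (grepr x) => [|[u v] s IHs].
  have -> : gpi [::] = 0 by [].
  by rewrite -(additive0 (gtDr 0)).
have -> : gpi ((u, v) :: s) = gt u v + gpi s; last exact: PD.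
apply/gpi_eq => Z f fb; rewrite geval_cat !geval_repr //.
by rewrite /geval big_cons big_seq1.
Qed.

Lemma gt_eq (Z : zmodType) (f g : gtens -> Z) :
  {morph f : x y / x + y} -> {morph g : x y / x + y} ->
  (forall u v, f (gt u v) = g (gt u v)) -> forall x, f x = g x.
Proof.
by move=> fD gD fg; elim/gt_ind=> [x y fx fy|//]; rewrite fD gD fx fy.
Qed.

End GTens.

Section GMap.
Variables (U V U' V' : zmodType) (W : Type) (r : W -> U -> U) (l : W -> V -> V)
  (r' : W -> U' -> U') (l' : W -> V' -> V').
Local Notation T := (gtens r l).
Local Notation T' := (gtens r' l').

Definition gmap (f : U -> U') (g : V -> V') : T -> T' :=
  glift (fun u v => gt r' l' (f u) (g v)).

Definition gmorph (f : U -> U') (g : V -> V') :=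
  [/\ {morph f : x y / x + y}, forall w u, f (r w u) = r' w (f u),
      {morph g : x y / x + y} & forall w v, g (l w v) = l' w (g v)].

Variables (f : U -> U') (g : V -> V') (fg : gmorph f g).

Let fb : balanced r l (fun u v => gt r' l' (f u) (g v)).
Proof.
have [fD fr gD gl] := fg; split=> [v x y|u x y|w u v].
- by rewrite fD gtDl.
- by rewrite gD gtDr.
by rewrite fr gl gt_bal.
Qed.

Lemma gmapE u v : gmap f g (gt r l u v) = gt r' l' (f u) (g v).
Proof. exact: gliftE. Qed.
Lemma gmapD : {morph gmap f g : x y / x + y}.
Proof. exact: gliftD. Qed.
End GMap.

Section TensorLift.
Variables (k : fieldType) (A C : falgType k).

Section Lift.
Variables (Z : zmodType) (f : A -> C -> Z).
Hypotheses (fDl : forall c, {morph f^~ c : x y / x + y})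
  (fDr : forall a, {morph f a : x y / x + y})
  (fB : forall (x : k) a c, f (x *: a) c = f a (x *: c)).

Definition tlift (z : tensor A C) : Z :=
  \sum_(i < \dim {:A}) f (vbasis {:A})`_i (z i).

Lemma tliftD : {morph tlift : x y / x + y}.
Proof.
move=> x y; rewrite /tlift -big_split; apply: eq_bigr => i _.
by rewrite ffunE fDr.
Qed.

Lemma tliftE a c : tlift (tens a c) = f a c.
Proof.
rewrite [in RHS](coord_vbasis_full a) (additive_sum _ _ _ (fDl c)).
by apply: eq_bigr => i _; rewrite ffunE fB.
Qed.
End Lift.

Lemma tensM (a b : A) (c d : C) : tens a c * tens b d = tens (a * b) (c * d).
Proof. exact: tmul_tens. Qed.

Lemma tens1 : tens 1 1 = 1 :> tensor A C. Proof. by []. Qed.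

Lemma tensor_scale (x : k) : x%:A = tens x%:A 1 :> tensor A C.
Proof. by rewrite tensZl tens1. Qed.

End TensorLift.

(** The action of k through k -> A. An A-module here carries no separate k-module structure, so M
    (x)_k N is balanced over these operators. *)
Definition kact (k : fieldType) (A : falgType k) (M : lmodType A) (x : k) (m : M) : M :=
  x%:A *: m.

Section MTens.
Variables (k : fieldType) (A C : falgType k) (M : lmodType A) (N : lmodType C).

Definition mtens : Type := gtens (@kact k A M) (@kact k C N).
HB.instance Definition _ := GRing.Zmodule.on mtens.

Definition mt (m : M) (n : N) : mtens := gt (@kact k A M) (@kact k C N) m n.

Lemma kact_scale (a : A) x (m : M) : a *: kact x m = kact x (a *: m).
Proof. by rewrite /kact !scalerA -scalerAl -scalerAr mulr1 mul1r. Qed.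

Lemma kact_scaleC (a : C) x (m : N) : a *: kact x m = kact x (a *: m).
Proof. by rewrite /kact !scalerA -scalerAl -scalerAr mulr1 mul1r. Qed.

Lemma scale_kact (a : A) x (m : M) : (x *: a) *: m = kact x (a *: m).
Proof. by rewrite /kact !scalerA -scalerAl mul1r. Qed.

Lemma scale_kactC (a : C) x (m : N) : (x *: a) *: m = kact x (a *: m).
Proof. by rewrite /kact !scalerA -scalerAl mul1r. Qed.

Definition mact (a : A) (c : C) : mtens -> mtens :=
  @gmap _ _ _ _ _ (@kact k A M) (@kact k C N) (@kact k A M) (@kact k C N)
    (fun m => a *: m) (fun n => c *: n).

Let mact_morph a c : gmorph (@kact k A M) (@kact k C N) (@kact k A M) (@kact k C N)
    (fun m => a *: m) (fun n => c *: n).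
Proof.
split=> [x y|x m|x y|x m]; rewrite ?scalerDr //.
  exact: kact_scale.
exact: kact_scaleC.
Qed.

Lemma mtDl n : {morph mt^~ n : x y / x + y}. Proof. exact: gtDl. Qed.
Lemma mtDr m : {morph mt m : x y / x + y}. Proof. exact: gtDr. Qed.
Lemma mt_bal x m n : mt (kact x m) n = mt m (kact x n). Proof. exact: gt_bal. Qed.

Let mactE a c m n : mact a c (mt m n) = mt (a *: m) (c *: n).
Proof. exact: (gmapE (mact_morph a c)). Qed.
Let mactD a c : {morph mact a c : x y / x + y}.
Proof. exact: (gmapD (mact_morph a c)). Qed.

Definition mscale (z : tensor A C) (x : mtens) : mtens :=
  tlift (fun a c => mact a c x) z.

Let mDl x c : {morph (fun a => mact a c x) : a b / a + b}.
Proof.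
move=> a b /=; elim/gt_ind: x => [x y xE yE|m n]; last first.
  by rewrite [LHS]mactE [mact a c _]mactE [mact b c _]mactE scalerDl mtDl.
by rewrite !mactD xE yE addrACA.
Qed.
Let mDr x a : {morph (fun c => mact a c x) : c d / c + d}.
Proof.
move=> c d /=; elim/gt_ind: x => [x y xE yE|m n]; last first.
  by rewrite [LHS]mactE [mact a c _]mactE [mact a d _]mactE scalerDl mtDr.
by rewrite !mactD xE yE addrACA.
Qed.
Let mB x (t : k) a c : mact (t *: a) c x = mact a (t *: c) x.
Proof.
elim/gt_ind: x => [x y xE yE|m n]; last first.
  by rewrite [LHS]mactE [RHS]mactE scale_kact scale_kactC mt_bal.
by rewrite !mactD xE yE.
Qed.

Let mscaleD x : {morph mscale^~ x : a b / a + b}.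
Proof. exact: (tliftD (mDr x)). Qed.
Let mscale_tens a c x : mscale (tens a c) x = mact a c x.
Proof. exact: (tliftE (mDl x) (mB x)). Qed.

Let mscaleDr : right_distributive mscale +%R.
Proof.
move=> z x y; elim/tens_ind: z => [a b aE bE|a c]; last by rewrite !mscale_tens mactD.
by rewrite !mscaleD aE bE addrACA.
Qed.
Let mscale1 : left_id 1 mscale.
Proof.
move=> x; rewrite -tens1 mscale_tens; elim/gt_ind: x => [x y xE yE|m n].
  by rewrite mactD xE yE.
by rewrite [LHS]mactE !scale1r.
Qed.
Let mscaleA a b x : mscale a (mscale b x) = mscale (a * b) x.
Proof.
elim/tens_ind: a => [a a' aE bE|a c]; first by rewrite mulrDl !mscaleD aE bE.
elim/tens_ind: b => [b b' aE bE|b d].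
  by rewrite mulrDr !mscaleD mscaleDr aE bE.
rewrite tensM !mscale_tens; elim/gt_ind: x => [x y xE yE|m n].
  by rewrite !mactD xE yE.
by rewrite [mact b d _]mactE [LHS]mactE [RHS]mactE !scalerA.
Qed.

HB.instance Definition _ := GRing.Zmodule_isLmodule.Build (tensor A C) mtens
  mscaleA mscale1 mscaleDr mscaleD.

Lemma mtZ a c m n : tens a c *: mt m n = mt (a *: m) (c *: n).
Proof. by rewrite [LHS]mscale_tens mactE. Qed.

Lemma mt_ind (P : mtens -> Prop) :
  (forall x y, P x -> P y -> P (x + y)) -> (forall u v, P (mt u v)) -> forall x, P x.
Proof. exact: gt_ind. Qed.

Lemma mt_eq (Z : zmodType) (f g : mtens -> Z) :
  {morph f : x y / x + y} -> {morph g : x y / x + y} ->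
  (forall u v, f (mt u v) = g (mt u v)) -> forall x, f x = g x.
Proof. exact: gt_eq. Qed.

Lemma mtens_scale x m n : x%:A *: mt m n = mt (kact x m) n.
Proof. by rewrite tensor_scale mtZ scale1r. Qed.

End MTens.
Arguments mt {k A C M N} m n.

(** * Relative projective dimension of a tensor product of modules *)

Section TensorSub.
Variables (k : fieldType) (A C : falgType k).
Implicit Types (B : {vspace A}) (D : {vspace C}).

Lemma tensor_sub_ind B D (P : tensor A C -> Prop) :
  P 0 -> (forall x y, P x -> P y -> P (x + y)) ->
  (forall b d, b \in B -> d \in D -> P (tens b d)) ->
  forall x, x \in tensor_sub B D -> P x.
Proof.
move=> P0 PD Pt x; rewrite /tensor_sub => /(@coord_span _ _ _ (in_tuple _)) ->.
elim/big_ind: _ => // i _.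
have /allpairsP[[b d] [/= bB dD ->]] := mem_nth 0 (ltn_ord i).
by rewrite -tensZl; apply: Pt; rewrite ?rpredZ ?vbasis_mem.
Qed.

Lemma tensor_sub1 B D : 1 \in B -> 1 \in D -> 1 \in tensor_sub B D.
Proof. by move=> B1 D1; rewrite -tens1; apply: tens_mem. Qed.

Lemma lo_tensor B D (M N : lmodType (tensor A C)) (h : M -> N) :
  {morph h : x y / x + y} ->
  (forall b d x, b \in B -> d \in D -> h (tens b d *: x) = tens b d *: h x) ->
  linear_over (tensor_sub B D) h.
Proof.
move=> hD ht; split=> // z x; move: z; apply: tensor_sub_ind => [|y z yE zE|b d bB dD].
- by rewrite !scale0r (additive0 hD).
- by rewrite !scalerDl hD yE zE.
exact: ht.
Qed.

Lemma lo_tensor_full (M N : lmodType (tensor A C)) (h : M -> N) :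
  {morph h : x y / x + y} -> (forall a c x, h (tens a c *: x) = tens a c *: h x) ->
  linear_over {: tensor A C} h.
Proof.
move=> hD ht; split=> // z x _; elim/tens_ind: z => [y z yE zE|a c]; last exact: ht.
by rewrite !scalerDl hD yE zE.
Qed.

Lemma tensor_split (a : A) (c : C) : tens a c = tens a 1 * tens 1 c.
Proof. by rewrite tensM mulr1 mul1r. Qed.

Lemma tensor_splitC (a : A) (c : C) : tens a c = tens 1 c * tens a 1.
Proof. by rewrite tensM mulr1 mul1r. Qed.

Definition tensl (a : A) : tensor A C := tens a 1.
Definition tensr (c : C) : tensor A C := tens 1 c.

Lemma tensl_add : zmod_morphism tensl.
Proof. exact: (additiveB (tensDl 1)). Qed.
Lemma tensl_mul : monoid_morphism tensl.
Proof. by split=> // a b; rewrite /tensl tensM mulr1. Qed.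
Lemma tensr_add : zmod_morphism tensr.
Proof. exact: (additiveB (tensDr 1)). Qed.
Lemma tensr_mul : monoid_morphism tensr.
Proof. by split=> // a b; rewrite /tensr tensM mulr1. Qed.

HB.instance Definition _ := GRing.isZmodMorphism.Build A (tensor A C) tensl tensl_add.
HB.instance Definition _ := GRing.isMonoidMorphism.Build A (tensor A C) tensl tensl_mul.
HB.instance Definition _ := GRing.isZmodMorphism.Build C (tensor A C) tensr tensr_add.
HB.instance Definition _ := GRing.isMonoidMorphism.Build C (tensor A C) tensr tensr_mul.

Definition resl (X : lmodType (tensor A C)) : lmodType A := resmod tensl X.
Definition resr (X : lmodType (tensor A C)) : lmodType C := resmod tensr X.

Lemma reslE (X : lmodType (tensor A C)) a (x : resl X) : a *: x = (tens a 1 *: (x : X)).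
Proof. by []. Qed.
Lemma resrE (X : lmodType (tensor A C)) a (x : resr X) : a *: x = (tens 1 a *: (x : X)).
Proof. by []. Qed.

End TensorSub.

Section Mmap.
Variables (k : fieldType) (A C : falgType k).

Lemma lo_kact (A' : falgType k) (U : {vspace A'}) (M M' : lmodType A') (f : M -> M') x m :
  1 \in U -> linear_over U f -> f (kact x m) = kact x (f m).
Proof. by move=> U1 fU; rewrite /kact (lo_Z _ fU) ?rpredZ. Qed.

Definition mmap (M M' : lmodType A) (N N' : lmodType C) (f : M -> M') (g : N -> N') :
  mtens M N -> mtens M' N' :=
  @gmap _ _ _ _ _ (@kact k A M) (@kact k C N) (@kact k A M') (@kact k C N') f g.

Variables (B : {vspace A}) (D : {vspace C}).
Hypotheses (B1 : 1 \in B) (D1 : 1 \in D).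
Local Notation S := (tensor_sub B D).

Section Basic.
Variables (M M' : lmodType A) (N N' : lmodType C) (f : M -> M') (g : N -> N').
Hypotheses (fB : linear_over B f) (gD : linear_over D g).

Let fg : gmorph (@kact k A M) (@kact k C N) (@kact k A M') (@kact k C N') f g.
Proof.
split; [exact: lo_D fB| |exact: lo_D gD|] => x m; first exact: lo_kact B1 fB.
exact: lo_kact D1 gD.
Qed.

Lemma mmapE m n : mmap f g (mt m n) = mt (f m) (g n).
Proof. exact: (gmapE fg). Qed.

Lemma mmapD : {morph mmap f g : x y / x + y}.
Proof. exact: (gmapD fg). Qed.

Lemma lo_mmap : linear_over S (mmap f g).
Proof.
apply: lo_tensor mmapD _ => b d x bB dD.
elim/mt_ind: x => [x y xE yE|m n].
  by rewrite scalerDr !mmapD xE yE scalerDr.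
by rewrite mtZ !mmapE mtZ (lo_Z _ fB) // (lo_Z _ gD).
Qed.

Lemma lo_mmap_full : linear_over {:A} f -> linear_over {:C} g ->
  linear_over {: tensor A C} (mmap f g).
Proof.
move=> fA gC; apply: lo_tensor_full mmapD _ => a c x.
elim/mt_ind: x => [x y xE yE|m n].
  by rewrite scalerDr !mmapD xE yE scalerDr.
by rewrite mtZ !mmapE mtZ (lo_Z _ fA) ?memvf // (lo_Z _ gC) ?memvf.
Qed.
End Basic.

Lemma mmap_comp (M M' M'' : lmodType A) (N N' N'' : lmodType C) (f' : M' -> M'')
  (g' : N' -> N'') (f : M -> M') (g : N -> N') :
  linear_over B f' -> linear_over D g' -> linear_over B f -> linear_over D g ->
  forall x, mmap f' g' (mmap f g x) = mmap (fun m => f' (f m)) (fun n => g' (g n)) x.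
Proof.
move=> f'B g'D fB gD; have fB' := lo_comp f'B fB; have gD' := lo_comp g'D gD.
apply: mt_eq => [x y|x y|m n]; last by rewrite !mmapE.
  by rewrite !mmapD.
by rewrite !mmapD.
Qed.

Lemma mmap_id (M : lmodType A) (N : lmodType C) (f : M -> M) (g : N -> N) :
  f =1 id -> g =1 id -> mmap f g =1 id.
Proof.
move=> /funext -> /funext ->.
by apply: mt_eq => [|//|m n]; [apply: mmapD; apply: lo_id|rewrite mmapE //; apply: lo_id].
Qed.

Lemma mmap_addl (M M' : lmodType A) (N N' : lmodType C) (f f' : M -> M') (g : N -> N') :
  linear_over B f -> linear_over B f' -> linear_over D g ->
  forall x, mmap (fun m => f m + f' m) g x = mmap f g x + mmap f' g x.
Proof.
move=> fB f'B gD; have ffB := lo_add fB f'B.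
apply: mt_eq => [x y|x y|m n]; last by rewrite !mmapE // mtDl.
  by rewrite !mmapD.
by rewrite !mmapD // addrACA.
Qed.

Lemma mmap_addr (M M' : lmodType A) (N N' : lmodType C) (f : M -> M') (g g' : N -> N') :
  linear_over B f -> linear_over D g -> linear_over D g' ->
  forall x, mmap f (fun m => g m + g' m) x = mmap f g x + mmap f g' x.
Proof.
move=> fB gD g'D; have ggD := lo_add gD g'D.
apply: mt_eq => [x y|x y|m n]; last by rewrite !mmapE // mtDr.
  by rewrite !mmapD.
by rewrite !mmapD // addrACA.
Qed.

Lemma ses_mtensl (K X M : lmodType A) (N : lmodType C) (i : K -> X) (p : X -> M)
    (s : M -> X) (r : X -> K) : split_ses B i p s r ->
  split_ses S (mmap i (@id N)) (mmap p (@id N)) (mmap s (@id N)) (mmap r (@id N)).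
Proof.
move=> [[iA pA sB rB] [ps ri d]]; have iB := lo_full B iA; have pB := lo_full B pA.
have N1 := lo_id D N.
split; split.
- by apply: lo_mmap_full => //; apply: lo_id.
- by apply: lo_mmap_full => //; apply: lo_id.
- exact: lo_mmap.
- exact: lo_mmap.
- by move=> x; rewrite mmap_comp // mmap_id.
- by move=> x; rewrite mmap_comp // mmap_id.
move=> x; rewrite !mmap_comp // -mmap_addl ?mmap_id //; exact: lo_comp.
Qed.

Lemma ses_mtensr (K X N : lmodType C) (M : lmodType A) (i : K -> X) (p : X -> N)
    (s : N -> X) (r : X -> K) : split_ses D i p s r ->
  split_ses S (mmap (@id M) i) (mmap (@id M) p) (mmap (@id M) s) (mmap (@id M) r).
Proof.
move=> [[iA pA sB rB] [ps ri d]]; have iB := lo_full D iA; have pB := lo_full D pA.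
have N1 := lo_id B M.
split; split.
- by apply: lo_mmap_full => //; apply: lo_id.
- by apply: lo_mmap_full => //; apply: lo_id.
- exact: lo_mmap.
- exact: lo_mmap.
- by move=> x; rewrite mmap_comp // mmap_id.
- by move=> x; rewrite mmap_comp // mmap_id.
move=> x; rewrite !mmap_comp // -mmap_addr ?mmap_id //; exact: lo_comp.
Qed.

Let S1 : 1 \in S := tensor_sub1 B1 D1.

Section RelProj.
Variables (P : lmodType A) (Q : lmodType C).
Local Notation IS := (ind S (mtens P Q)).

(** First stage, with a and p fixed, of the map [b2] from (A (x)_B P) x (C (x)_D Q) to (A (x) C)
    (x)_S (P (x) Q). It combines sections of the two multiplication maps into a section of the
    third. *)
Let b1 a p (y : ind D Q) : IS := ind_lift (fun c q => itens S (tens a c) (mt p q)) y.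

Let b1E a p c q : b1 a p (itens D c q) = itens S (tens a c) (mt p q).
Proof.
apply: (ind_liftE D1) => [m x y|x m n|x d m dD].
- by rewrite tensDr itensDl.
- by rewrite mtDr itensDr.
by rewrite -[a in LHS]mulr1 -tensM itens_bal ?tens_mem // mtZ scale1r.
Qed.

Let b1D a p : {morph b1 a p : x y / x + y}.
Proof.
apply: (ind_liftD D1) => [m x y|x m n|x d m dD].
- by rewrite tensDr itensDl.
- by rewrite mtDr itensDr.
by rewrite -[a in LHS]mulr1 -tensM itens_bal ?tens_mem // mtZ scale1r.
Qed.

Let b2 (x : ind B P) (y : ind D Q) : IS := ind_lift (fun a p => b1 a p y) x.

Let b1_props (y : ind D Q) : [/\ forall p, {morph (fun a => b1 a p y) : a b / a + b},
  forall a, {morph (fun p => b1 a p y) : m n / m + n} &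
  forall a b p, b \in B -> b1 (a * b) p y = b1 a (b *: p) y].
Proof.
split=> [p a b|a p q|a b p bB]; elim/ind_ind: y => [x y xE yE|c q'].
- by rewrite !b1D xE yE addrACA.
- by rewrite !b1E tensDl itensDl.
- by rewrite !b1D xE yE addrACA.
- by rewrite !b1E mtDl itensDr.
- by rewrite !b1D xE yE.
by rewrite !b1E -[c in LHS]mulr1 -tensM itens_bal ?tens_mem // mtZ scale1r.
Qed.

Let b2E a p y : b2 (itens B a p) y = b1 a p y.
Proof. by have [H1 H2 H3] := b1_props y; apply: (ind_liftE B1). Qed.

Let b2Dl y : {morph b2^~ y : x z / x + z}.
Proof. by have [H1 H2 H3] := b1_props y; apply: (ind_liftD B1). Qed.

Let b2Dr x : {morph b2 x : y z / y + z}.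
Proof.
move=> y z; elim/ind_ind: x => [x x' xE x'E|a p]; last by rewrite !b2E b1D.
by rewrite !b2Dl xE x'E addrACA.
Qed.

Let b2Z a c x y : b2 (a *: x) (c *: y) = tens a c *: b2 x y.
Proof.
elim/ind_ind: x => [x x' xE x'E|b p]; first by rewrite scalerDr !b2Dl xE x'E scalerDr.
elim/ind_ind: y => [y y' yE y'E|d q]; first by rewrite scalerDr !b2Dr yE y'E scalerDr.
by rewrite !itensZ !b2E !b1E itensZ tensM.
Qed.

Let b2_mul x y : ind_mul (b2 x y) = mt (ind_mul x) (ind_mul y).
Proof.
elim/ind_ind: x => [x x' xE x'E|b p]; first by rewrite b2Dl !ind_mulD xE x'E mtDl.
elim/ind_ind: y => [y y' yE y'E|d q]; first by rewrite b2Dr !ind_mulD yE y'E mtDr.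
by rewrite b2E b1E !ind_mulE mtZ.
Qed.

Lemma relproj_mtens : relproj B P -> relproj D Q -> relproj S (mtens P Q).
Proof.
move=> [s [sA sE]] [t [tC tE]].
have bal : balanced (@kact k A P) (@kact k C Q) (fun p q => b2 (s p) (t q)).
  split=> [q x y|p x y|w p q].
  - by rewrite (lo_D sA) b2Dl.
  - by rewrite (lo_D tC) b2Dr.
  rewrite (lo_kact _ _ (memvf 1) sA) (lo_kact _ _ (memvf 1) tC).
  rewrite /kact -[t q in LHS]scale1r -[s p in RHS]scale1r !b2Z.
  by rewrite tensZl tensZr.
pose g : mtens P Q -> IS := glift (fun p q => b2 (s p) (t q)).
have gD : {morph g : x y / x + y} := gliftD bal.
have gE p q : g (mt p q) = b2 (s p) (t q) := gliftE bal p q.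
exists g; split.
  apply: (lo_tensor_full gD) => a c x; elim/mt_ind: x => [x y xE yE|p q].
    by rewrite scalerDr !gD xE yE scalerDr.
  by rewrite mtZ !gE (lo_Z _ sA) ?memvf // (lo_Z _ tC) ?memvf.
apply: mt_eq => // [x y|p q]; first by rewrite gD ind_mulD.
by rewrite gE b2_mul sE tE.
Qed.
End RelProj.

(** Tensoring a syzygy sequence with a fixed module keeps it split over B (x) D, so each syzygy of
    either factor costs one. The case of relatively projective M is settled first, by induction on
    the bound for N. *)
Lemma rpd_mtens m n (M : lmodType A) (N : lmodType C) :
  rpd B m M -> rpd D n N -> rpd S (m + n) (mtens M N).
Proof.
have base (P : lmodType A) j (Y : lmodType C) : relproj B P -> rpd D j Y ->
    rpd S j (mtens P Y).
  move=> Pp; elim: j Y => [|j IHj] Y; first exact: relproj_mtens.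
  move=> /IHj; apply: (rpd_ses S1 j _ (relproj_mtens Pp (relproj_ind D1 Y))).1.
  by do 4 eexists; apply: ses_mtensr (ses_omega_split D Y).
elim: m M => [|m IHm] M Mm Nn; first exact: base.
rewrite addSn; apply: (rpd_quo S1 (K := mtens (omega B M) N) (X := mtens (ind B M) N)).
- by do 4 eexists; apply: ses_mtensl (ses_omega_split B M).
- exact: IHm.
(* The middle term [ind B M] (x) N has dimension at most n, within the bound m + n + 1 that
   [rpd_quo] asks of it. *)
apply: (rpd_leq S1 (m := n)); first by rewrite -addSn leq_addl.
by apply: base Nn; apply: relproj_ind.
Qed.

Section Restrict.
Variable X : lmodType (tensor A C).
Local Notation Y := (resr X).

(** This induces (A (x) C) (x)_S X -> C (x)_D X, (a (x) c) (x) x |-> c (x) a x, which carries a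
    section of multiplication over S to one over D. *)
Let rr (x : X) (a : A) (c : C) : ind D Y := itens D c (tens a 1 *: x : Y).
Let rrDl x c : {morph (fun a => rr x a c) : a b / a + b}.
Proof. by move=> a b; rewrite /rr tensDl scalerDl (itensDr D (M := Y)). Qed.
Let rrDr x a : {morph rr x a : b c / b + c}.
Proof. by move=> b c; rewrite /rr itensDl. Qed.
Let rrB x (t : k) a c : rr x (t *: a) c = rr x a (t *: c).
Proof.
rewrite /rr itens_scale; congr itens; rewrite resrE scalerA tensM mul1r mulr1.
by rewrite tensZl tensZr.
Qed.
Let rr2 z x := tlift (rr x) z.
Let rr2D x : {morph rr2^~ x : y z / y + z}. Proof. exact: (tliftD (rrDr x)). Qed.
Let rr2E a c x : rr2 (tens a c) x = rr x a c.
Proof. exact: (tliftE (rrDl x) (rrB x)). Qed.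
Let rr2Dr z : {morph rr2 z : x y / x + y}.
Proof.
move=> x y; elim/tens_ind: z => [z z' zE z'E|a c]; first by rewrite !rr2D zE z'E addrACA.
by rewrite !rr2E /rr scalerDr (itensDr D (M := Y)).
Qed.
Let rr2B z z' x : z' \in S -> rr2 (z * z') x = rr2 z (z' *: x).
Proof.
move=> z'S; elim/tens_ind: z => [z w zE wE|a c]; first by rewrite mulrDl !rr2D zE wE.
move: z' z'S; apply: tensor_sub_ind => [|u v uE vE|b d bB dD].
- by rewrite mulr0 scale0r (additive0 (rr2D _)) (additive0 (rr2Dr _)).
- by rewrite mulrDr rr2D uE vE scalerDl rr2Dr.
rewrite tensM !rr2E /rr (itens_bal (M := Y)) // resrE !scalerA !tensM.
by rewrite !mul1r !mulr1.
Qed.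

Let rmap : ind S X -> ind D Y := ind_lift rr2.
Let rmapE a c x : rmap (itens S (tens a c) x) = itens D c (tens a 1 *: x : Y).
Proof. by rewrite -[RHS]rr2E; apply: (ind_liftE S1). Qed.
Let rmapD : {morph rmap : x y / x + y}. Proof. exact: (ind_liftD S1). Qed.

Let rmap_scale a (x : ind S X) :
  rmap (tens a 1 *: x) = imap (B := D) (fun y : Y => tens a 1 *: (y : X) : Y) (rmap x).
Proof.
have aD : linear_over D (fun y : Y => tens a 1 *: (y : X) : Y).
  by split=> [y z|d y dD]; rewrite ?scalerDr // !resrE !scalerA !tensM !mul1r !mulr1.
have iD := lo_D (lo_imap D1 aD).
elim/ind_ind: x => [x y xE yE|z x]; first by rewrite scalerDr !rmapD iD xE yE.
elim/tens_ind: z => [z w zE wE|b c].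
  by rewrite (itensDl S (M := X)) scalerDr !rmapD iD zE wE.
by rewrite itensZ tensM !rmapE imapE // scalerA tensM mul1r mul1r.
Qed.

Let rmap_scaler c (x : ind S X) : rmap (tens 1 c *: x) = c *: rmap x.
Proof.
elim/ind_ind: x => [x y xE yE|z x]; first by rewrite scalerDr !rmapD scalerDr xE yE.
elim/tens_ind: z => [z w zE wE|b d].
  by rewrite (itensDl S (M := X)) scalerDr !rmapD scalerDr zE wE.
by rewrite itensZ tensM !rmapE itensZ mul1r.
Qed.

Let rmap_mul (x : ind S X) : ind_mul (rmap x) = ind_mul x.
Proof.
elim/ind_ind: x => [x y xE yE|z x]; first by rewrite rmapD !ind_mulD xE yE.
elim/tens_ind: z => [z w zE wE|b d].
  by rewrite (itensDl S (M := X)) rmapD !ind_mulD zE wE.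
by rewrite rmapE !ind_mulE resrE scalerA tensM mul1r mulr1.
Qed.

(** The last clause keeps track of the action of A. For a bimodule X over A it says that a section
    on the right commutes with left multiplications, as [right_proj] demands. *)
Lemma relproj_resr_section : relproj S X -> exists s : Y -> ind D Y,
  [/\ linear_over {:C} s, forall x, ind_mul (s x) = x &
  forall a x, s (tens a 1 *: (x : X)) =
    imap (B := D) (fun y : Y => tens a 1 *: (y : X) : Y) (s x)].
Proof.
move=> [s [sA sE]]; exists (fun x => rmap (s x)); split=> [|x|a x].
- split=> [x y|c x _]; first by rewrite (lo_D sA) rmapD.
  by rewrite resrE (lo_Z _ sA) ?memvf // rmap_scaler.
- by rewrite rmap_mul sE.
by rewrite (lo_Z _ sA) ?memvf // rmap_scale.
Qed.

Lemma relproj_resr : relproj S X -> relproj D Y.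
Proof. by move=> /relproj_resr_section[s [sA sE _]]; exists s. Qed.
End Restrict.

Section Restrictl.
Variable X : lmodType (tensor A C).
Local Notation Y := (resl X).

(** The mirror image, (a (x) c) (x) x |-> a (x) c x, with the roles of the two factors exchanged. *)
Let rr (x : X) (a : A) (c : C) : ind B Y := itens B a (tens 1 c *: x : Y).
Let rrDl x c : {morph (fun a => rr x a c) : a b / a + b}.
Proof. by move=> b c'; rewrite /rr itensDl. Qed.
Let rrDr x a : {morph rr x a : b c / b + c}.
Proof. by move=> a' b; rewrite /rr tensDr scalerDl (itensDr B (M := Y)). Qed.
Let rrB x (t : k) a c : rr x (t *: a) c = rr x a (t *: c).
Proof.
rewrite /rr itens_scale; congr itens; rewrite reslE scalerA tensM mul1r mulr1.
by rewrite tensZl tensZr.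
Qed.
Let rr2 z x := tlift (rr x) z.
Let rr2D x : {morph rr2^~ x : y z / y + z}. Proof. exact: (tliftD (rrDr x)). Qed.
Let rr2E a c x : rr2 (tens a c) x = rr x a c.
Proof. exact: (tliftE (rrDl x) (rrB x)). Qed.
Let rr2Dr z : {morph rr2 z : x y / x + y}.
Proof.
move=> x y; elim/tens_ind: z => [z z' zE z'E|a c]; first by rewrite !rr2D zE z'E addrACA.
by rewrite !rr2E /rr scalerDr (itensDr B (M := Y)).
Qed.
Let rr2B z z' x : z' \in S -> rr2 (z * z') x = rr2 z (z' *: x).
Proof.
move=> z'S; elim/tens_ind: z => [z w zE wE|a c]; first by rewrite mulrDl !rr2D zE wE.
move: z' z'S; apply: tensor_sub_ind => [|u v uE vE|b d bB dD].
- by rewrite mulr0 scale0r (additive0 (rr2D _)) (additive0 (rr2Dr _)).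
- by rewrite mulrDr rr2D uE vE scalerDl rr2Dr.
rewrite tensM !rr2E /rr (itens_bal (M := Y)) // reslE !scalerA !tensM.
by rewrite !mul1r !mulr1.
Qed.

Let rmap : ind S X -> ind B Y := ind_lift rr2.
Let rmapE a c x : rmap (itens S (tens a c) x) = itens B a (tens 1 c *: x : Y).
Proof. by rewrite -[RHS]rr2E; apply: (ind_liftE S1). Qed.
Let rmapD : {morph rmap : x y / x + y}. Proof. exact: (ind_liftD S1). Qed.

Let lmap_scale c (x : ind S X) :
  rmap (tens 1 c *: x) = imap (B := B) (fun y : Y => tens 1 c *: (y : X) : Y) (rmap x).
Proof.
have aD : linear_over B (fun y : Y => tens 1 c *: (y : X) : Y).
  by split=> [y z|d y dD]; rewrite ?scalerDr // !reslE !scalerA !tensM !mul1r !mulr1.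
have iD := lo_D (lo_imap B1 aD).
elim/ind_ind: x => [x y xE yE|z x]; first by rewrite scalerDr !rmapD iD xE yE.
elim/tens_ind: z => [z w zE wE|b d].
  by rewrite (itensDl S (M := X)) scalerDr !rmapD iD zE wE.
by rewrite itensZ tensM !rmapE imapE // scalerA tensM mul1r mul1r.
Qed.

Let rmap_scaler c (x : ind S X) : rmap (tens c 1 *: x) = c *: rmap x.
Proof.
elim/ind_ind: x => [x y xE yE|z x]; first by rewrite scalerDr !rmapD scalerDr xE yE.
elim/tens_ind: z => [z w zE wE|b d].
  by rewrite (itensDl S (M := X)) scalerDr !rmapD scalerDr zE wE.
by rewrite itensZ tensM !rmapE itensZ mul1r.
Qed.

Let rmap_mul (x : ind S X) : ind_mul (rmap x) = ind_mul x.
Proof.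
elim/ind_ind: x => [x y xE yE|z x]; first by rewrite rmapD !ind_mulD xE yE.
elim/tens_ind: z => [z w zE wE|b d].
  by rewrite (itensDl S (M := X)) rmapD !ind_mulD zE wE.
by rewrite rmapE !ind_mulE reslE scalerA tensM mul1r mulr1.
Qed.

Lemma relproj_resl_section : relproj S X -> exists s : Y -> ind B Y,
  [/\ linear_over {:A} s, forall x, ind_mul (s x) = x &
  forall c x, s (tens 1 c *: (x : X)) =
    imap (B := B) (fun y : Y => tens 1 c *: (y : X) : Y) (s x)].
Proof.
move=> [s [sA sE]]; exists (fun x => rmap (s x)); split=> [|x|a x].
- split=> [x y|c x _]; first by rewrite (lo_D sA) rmapD.
  by rewrite reslE (lo_Z _ sA) ?memvf // rmap_scaler.
- by rewrite rmap_mul sE.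
by rewrite (lo_Z _ sA) ?memvf // lmap_scale.
Qed.

Lemma relproj_resl : relproj S X -> relproj B Y.
Proof. by move=> /relproj_resl_section[s [sA sE _]]; exists s. Qed.
End Restrictl.

(** The restriction of [omega S X] need not be the syzygy of the restriction of X, but it is the
    kernel of a D-split surjection from a relative projective, so the dimension shift applies. *)
Lemma rpd_resr l (X : lmodType (tensor A C)) : rpd S l X -> rpd D l (resr X).
Proof.
elim: l X => [|l IHl] X; first exact: relproj_resr.
move=> /IHl; have [[iA pA sB rB] eqs] := ses_omega_split S X.
apply: (rpd_ses D1 l (P := resr (ind S X)) _ (relproj_resr (relproj_ind S1 X))).1.
exists (@kerin _ _ _ (imul S X)), (@ind_mul _ _ S X), (itens S 1), (@orho _ _ S X).
split=> //; split=> //.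
- by split=> [x y|c x _]; [exact: (lo_D pA x y)|exact: (lo_Z (b := tens 1 c) x pA (memvf _))].
- split=> [x y|c x cD]; first exact: (lo_D sB x y).
  by apply: (lo_Z (b := tens 1 c) x sB); apply: tens_mem.
split=> [x y|c x cD]; first exact: (lo_D rB x y).
by apply: (lo_Z (b := tens 1 c) x rB); apply: tens_mem.
Qed.

Lemma rpd_resl l (X : lmodType (tensor A C)) : rpd S l X -> rpd B l (resl X).
Proof.
elim: l X => [|l IHl] X; first exact: relproj_resl.
move=> /IHl; have [[iA pA sB rB] eqs] := ses_omega_split S X.
apply: (rpd_ses B1 l (P := resl (ind S X)) _ (relproj_resl (relproj_ind S1 X))).1.
exists (@kerin _ _ _ (imul S X)), (@ind_mul _ _ S X), (itens S 1), (@orho _ _ S X).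
split=> //; split=> //.
- by split=> [x y|c x _]; [exact: (lo_D pA x y)|exact: (lo_Z (b := tens c 1) x pA (memvf _))].
- split=> [x y|c x cD]; first exact: (lo_D sB x y).
  by apply: (lo_Z (b := tens c 1) x sB); apply: tens_mem.
split=> [x y|c x cD]; first exact: (lo_D rB x y).
by apply: (lo_Z (b := tens c 1) x rB); apply: tens_mem.
Qed.

(** N is a direct summand of M (x) N over C: n |-> m0 (x) n is split by m (x) n |-> f(m) n. *)
Lemma rpd_mtensr l (M : lmodType A) (N : lmodType C) (m0 : M) (f : M -> k) :
  {morph f : x y / x + y} -> (forall c x, f (kact c x) = c * f x) -> f m0 = 1 ->
  rpd S l (mtens M N) -> rpd D l N.
Proof.
move=> fD fZ f1 /rpd_resr.
have bal : balanced (@kact k A M) (@kact k C N) (fun m n => kact (f m) n).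
  split=> [n x y|m x y|c x n]; rewrite /kact ?scalerDr //.
    by rewrite fD !scalerDl.
  by rewrite fZ scalerA -scalerAl mul1r scalerA mulrC.
pose g : mtens M N -> N := glift (fun m n => kact (f m) n).
have gD : {morph g : x y / x + y} := gliftD bal.
have gE m n : g (mt m n) = kact (f m) n := gliftE bal m n.
apply: (rpd_retract D1 (f := (fun n => mt m0 n : resr (mtens M N))) (g := g)).
- by split=> [x y|c x _]; [apply: mtDr|rewrite resrE mtZ scale1r].
- split=> // c x _; elim/mt_ind: x => [x y xE yE|m n].
    by rewrite scalerDr !gD xE yE scalerDr.
  by rewrite resrE mtZ scale1r !gE kact_scaleC.
by move=> n; rewrite gE f1 /kact !scale1r.
Qed.

Lemma rpd_mtensl l (M : lmodType A) (N : lmodType C) (n0 : N) (f : N -> k) :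
  {morph f : x y / x + y} -> (forall c x, f (kact c x) = c * f x) -> f n0 = 1 ->
  rpd S l (mtens M N) -> rpd B l M.
Proof.
move=> fD fZ f1 /rpd_resl.
have bal : balanced (@kact k A M) (@kact k C N) (fun m n => kact (f n) m).
  split=> [n x y|m x y|c x n]; rewrite /kact ?scalerDr //.
    by rewrite fD !scalerDl.
  by rewrite fZ scalerA -scalerAl mul1r scalerA mulrC.
pose g : mtens M N -> M := glift (fun m n => kact (f n) m).
have gD : {morph g : x y / x + y} := gliftD bal.
have gE m n : g (mt m n) = kact (f n) m := gliftE bal m n.
apply: (rpd_retract B1 (f := (fun m => mt m n0 : resl (mtens M N))) (g := g)).
- by split=> [x y|c x _]; [apply: mtDl|rewrite reslE mtZ scale1r].
- split=> // c x _; elim/mt_ind: x => [x y xE yE|m n].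
    by rewrite scalerDr !gD xE yE scalerDr.
  by rewrite reslE mtZ scale1r !gE kact_scale.
by move=> n; rewrite gE f1 /kact !scale1r.
Qed.

End Mmap.

(** * Enveloping algebras *)

Section EnvBasics.
Variables (k : fieldType) (A : falgType k).

Lemma envM (a b : A) (c d : A) :
  tens a (c : A^c) * tens b (d : A^c) = tens (a * b) (d * c : A^c).
Proof. exact: tmul_tens. Qed.

Lemma bimodZ (a b : A) (x : regular_bimod A) :
  tens a (b : A^c) *: x = (a * (x : A) * b : regular_bimod A).
Proof. exact: bimod_act_tens. Qed.

Lemma op_sub1 (B : {vspace A}) : 1 \in B -> (1 : A^c) \in op_sub B.
Proof. by move=> B1; rewrite (mem_op_sub B (1 : A)). Qed.

Lemma env_sub1 (B : {vspace A}) : 1 \in B -> 1 \in env_sub B.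
Proof. by move=> B1; apply: tensor_sub1 => //; apply: op_sub1. Qed.

End EnvBasics.

Section OneSided.
Variables (k : fieldType) (A : falgType k) (B : {vspace A}).
Hypothesis B1 : 1 \in B.
Implicit Types (X Y : lmodType (env A)).
Local Notation Bo := (op_sub B).
Local Notation Se := (env_sub B).
Local Notation Sr := (tensor_sub B {: A^c}).
Local Notation lm X b := (fun y : resr X => tens b 1 *: (y : X) : resr X).

Let Bo1 : (1 : A^c) \in Bo := op_sub1 B1.
Let Se1 : 1 \in Se := env_sub1 B1.

(* [X] is a [B]-[A]-bimodule summand of [X (x)_B A]. *)
Definition right_proj X : Prop := exists t : resr X -> ind Bo (resr X),
  [/\ linear_over {: A^c} t, forall x, ind_mul (t x) = x &
  forall b x, b \in B -> t (tens b 1 *: (x : X)) = imap (B := Bo) (lm X b) (t x)].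

Lemma lo_lm X b : linear_over {: A^c} (lm X b).
Proof.
by split=> [y z|c y _]; rewrite ?scalerDr // !resrE !scalerA !tensM !mul1r !mulr1.
Qed.

Lemma relproj_right_proj X : relproj Se X -> right_proj X.
Proof.
move=> /(relproj_resr_section B1 Bo1)[t [tA tE tB]].
by exists t; split.
Qed.

Lemma lo_resr U X Y (h : X -> Y) : linear_over (tensor_sub B U) h ->
  linear_over U (h : resr X -> resr Y).
Proof.
move=> hU; split=> [x y|c x cU]; first exact: (lo_D hU x y).
by apply: (lo_Z (b := tens 1 c) x hU); apply: tens_mem.
Qed.

(** The new section is the composite X -> X (x)_B A -> Y (x)_B A -> Y, right A-linear by induction
    and still left B-linear by the last clause of [right_proj]. Such sections survive - (x)_A M. *)
Lemma right_proj_section X Y (p : Y -> X) (s : X -> Y) : right_proj X ->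
  linear_over {: env A} p -> linear_over Se s -> (forall x, p (s x) = x) ->
  exists2 s' : X -> Y, linear_over Sr s' & forall x, p (s' x) = x.
Proof.
move=> [t [tA tE tB]] pA sB ps.
have sB' := lo_resr sB.
have pA' : linear_over {: A^c} (p : resr Y -> resr X) := lo_resr (lo_full _ pA).
pose s' (x : X) : Y := ind_mul (imap (B := Bo) (s : resr X -> resr Y) (t x)).
have s'A : linear_over {: A^c} (s' : resr X -> resr Y).
  exact: lo_comp (lo_imul _ _ _) (lo_comp (lo_imap Bo1 sB') tA).
exists s' => [|x].
  apply: lo_tensor => [x y|b d x bB dB]; first exact: (lo_D s'A x y).
  rewrite tensor_splitC -!scalerA.
  rewrite [LHS](lo_Z (b := d) (tens b 1 *: x : resr X) s'A) ?memvf //.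
  rewrite resrE; congr (_ *: _); rewrite /s' tB //.
  have bX := lo_full Bo (lo_lm X b); have bY := lo_full Bo (lo_lm Y b).
  rewrite imap_comp //.
  have -> : (fun m => s (tens b 1 *: m)) = (fun m => lm Y b (s m)).
    by apply/funext => m; rewrite (lo_Z _ sB) // tens_mem.
  by rewrite -(imap_comp Bo1 bY sB') (imap_mul Bo1 bY (lo_lm Y b)).
rewrite /s' -(imap_mul Bo1 (lo_full Bo pA') pA') imap_comp //; last exact: lo_full.
have -> : (fun m => p (s m)) = id by apply/funext.
by rewrite imap_id // tE.
Qed.

(** Induced bimodules are [right_proj], and the improved section makes the syzygy a B-A-summand of
    one. Iterated from A, this splits every syzygy sequence over B (x) A^op. *)
Lemma right_proj_omega X : right_proj X -> right_proj (omega Se X) /\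
  ses Sr (omega Se X) (ind Se X) X.
Proof.
move=> Xr; have [[iA pA sB rB] [ps ri d]] := ses_omega_split Se X.
have [s' s'B ps'] := right_proj_section Xr pA sB ps.
have Kp x : imul Se X (x - s' (ind_mul x)) = 0.
  by rewrite /= (lo_B pA) ps' subrr.
pose r' (x : ind Se X) : omega Se X := kermk (Kp x).
have H := lo_subr (lo_id Sr (ind Se X)) (lo_comp s'B (lo_full Sr pA)).
have r'B : linear_over Sr r'.
  by split=> [x y|b x bS]; apply: kerin_inj;
    rewrite ?kerinD ?kerinZ !kermkK ?(lo_D H) ?(lo_Z _ H).
have ri' y : r' (kerin y) = y.
  apply: kerin_inj; rewrite kermkK; have := kerinP y; rewrite /= => ->.
  by rewrite (lo_0 s'B) subr0.
split; last first.
  exists (@kerin _ _ _ (imul Se X)), (@ind_mul _ _ Se X), s', r'.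
  by split; split=> // x; rewrite kermkK subrK.
have [t [tA tE tB]] := relproj_right_proj (relproj_ind Se1 X).
have r'A := lo_resr r'B.
have iA' : linear_over {: A^c} (@kerin _ _ _ (imul Se X) : resr (omega Se X) -> resr (ind Se X)).
  exact: lo_resr (lo_full _ iA).
exists (fun z : resr (omega Se X) =>
  imap (B := Bo) (r' : resr (ind Se X) -> resr (omega Se X))
    (t (kerin (z : kermod (imul Se X)) : resr (ind Se X)))); split.
- exact: lo_comp (lo_imap Bo1 (lo_full Bo r'A)) (lo_comp tA iA').
- by move=> z; rewrite (imap_mul Bo1 (lo_full Bo r'A) r'A) tE ri'.
move=> b z bB; rewrite kerinZ tB //.
have bP := lo_full Bo (lo_lm (ind Se X) b); have bK := lo_full Bo (lo_lm (omega Se X) b).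
have r'o := lo_full Bo r'A.
rewrite !imap_comp //; congr (imap _ _); apply/funext => x.
by rewrite (lo_Z _ r'B) // tens_mem // memvf.
Qed.

(** In A (x)_B A the section is x |-> 1 (x) x: right A-linear, and left B-linear because b passes
    through the tensor sign. *)
Lemma right_proj_regular : right_proj (regular_bimod A).
Proof.
pose X : lmodType (env A) := regular_bimod A.
exists (fun x : resr X => itens Bo ((x : A) : A^c) ((1 : A) : resr X)); split.
- split=> [x y|c x _]; first exact: itensDl.
  rewrite itensZ resrE bimodZ; congr itens.
  by rewrite mul1r.
- by move=> x; rewrite ind_mulE resrE bimodZ !mul1r.
move=> b x bB; rewrite imapE //; last exact: lo_full (lo_lm X b).
rewrite !bimodZ !mulr1.
have -> : ((b * (x : A) : A) : A^c) = ((x : A) : A^c) * ((b : A) : A^c) by [].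
rewrite itens_bal ?mem_op_sub // resrE bimodZ mul1r; congr itens.
by rewrite mul1r.
Qed.

End OneSided.

(** * Tensoring bimodules with a module over A *)

Section ATens.
Variables (k : fieldType) (A : falgType k).

Definition ract (X : lmodType (env A)) (a : A) (x : X) : X := tens 1 (a : A^c) *: x.
Definition lact (M : lmodType A) (a : A) (m : M) : M := a *: m.

Definition atens (X : lmodType (env A)) (M : lmodType A) : Type :=
  gtens (@ract X) (@lact M).

Section Structure.
Variables (X : lmodType (env A)) (M : lmodType A).
HB.instance Definition _ := GRing.Zmodule.on (atens X M).

Definition at_ (x : X) (m : M) : atens X M := gt (@ract X) (@lact M) x m.
Lemma atDl m : {morph at_^~ m : x y / x + y}. Proof. exact: gtDl. Qed.
Lemma atDr x : {morph at_ x : m n / m + n}. Proof. exact: gtDr. Qed.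
Lemma at_bal (a : A) x m : at_ (tens 1 (a : A^c) *: x) m = at_ x (a *: m).
Proof. exact: gt_bal. Qed.

Definition ascale (a : A) : atens X M -> atens X M :=
  @gmap _ _ _ _ _ (@ract X) (@lact M) (@ract X) (@lact M) (fun x => tens a 1 *: x) id.

Let am a : gmorph (@ract X) (@lact M) (@ract X) (@lact M) (fun x => tens a 1 *: x) id.
Proof.
split=> [x y|c x|//|//]; first by rewrite scalerDr.
by rewrite /ract !scalerA -tensor_splitC -tensor_split.
Qed.
Let ascaleE a x m : ascale a (at_ x m) = at_ (tens a 1 *: x) m.
Proof. exact: (gmapE (am a)). Qed.
Let ascaleDr : right_distributive ascale +%R.
Proof. by move=> a; apply: (gmapD (am a)). Qed.

Lemma at_ind (P : atens X M -> Prop) :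
  (forall x y, P x -> P y -> P (x + y)) -> (forall u v, P (at_ u v)) -> forall x, P x.
Proof. exact: gt_ind. Qed.

Lemma at_eq (Z : zmodType) (f g : atens X M -> Z) :
  {morph f : x y / x + y} -> {morph g : x y / x + y} ->
  (forall u v, f (at_ u v) = g (at_ u v)) -> forall x, f x = g x.
Proof. exact: gt_eq. Qed.

Let ascaleDl x : {morph ascale^~ x : a b / a + b}.
Proof.
move=> a b; elim/at_ind: x => [x y xE yE|x m]; last first.
  by rewrite !ascaleE tensDl scalerDl atDl.
by rewrite !ascaleDr xE yE addrACA.
Qed.
Let ascale1 : left_id 1 ascale.
Proof.
move=> x; elim/at_ind: x => [x y xE yE|x m]; last by rewrite ascaleE tens1 scale1r.
by rewrite ascaleDr xE yE.
Qed.
Let ascaleA a b x : ascale a (ascale b x) = ascale (a * b) x.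
Proof.
elim/at_ind: x => [x y xE yE|x m].
  by rewrite !ascaleDr xE yE.
by rewrite !ascaleE scalerA tensM mulr1.
Qed.

HB.instance Definition _ := GRing.Zmodule_isLmodule.Build A (atens X M)
  ascaleA ascale1 ascaleDr ascaleDl.

Lemma atZ a x m : a *: at_ x m = at_ (tens a 1 *: x) m.
Proof. by rewrite [LHS]ascaleE. Qed.

End Structure.
Arguments at_ {X M} x m.

Variable B : {vspace A}.
Hypothesis B1 : 1 \in B.
Local Notation Se := (env_sub B).
Local Notation Sr := (tensor_sub B {: A^c}).
Variable M : lmodType A.
Implicit Types (X Y Z : lmodType (env A)).

Definition amap X Y (h : X -> Y) : atens X M -> atens Y M :=
  @gmap _ _ _ _ _ (@ract X) (@lact M) (@ract Y) (@lact M) h id.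

Section AMap.
Variables (X Y : lmodType (env A)) (h : X -> Y) (hS : linear_over Sr h).
Let hm : gmorph (@ract X) (@lact M) (@ract Y) (@lact M) h id.
Proof.
split=> //; first exact: lo_D hS.
by move=> a x; rewrite /ract (lo_Z _ hS) // tens_mem // memvf.
Qed.
Lemma amapE x m : amap h (at_ x m) = at_ (h x) m.
Proof. exact: (gmapE hm). Qed.
Lemma amapD : {morph amap h : x y / x + y}. Proof. exact: (gmapD hm). Qed.
Lemma lo_amap : linear_over B (amap h).
Proof.
split=> [|b x bB]; first exact: amapD.
elim/at_ind: x => [x y xE yE|x m]; first by rewrite scalerDr !amapD scalerDr xE yE.
by rewrite atZ !amapE atZ (lo_Z _ hS) // tens_mem // memvf.
Qed.
Lemma lo_amapA : linear_over {: env A} h -> linear_over {:A} (amap h).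
Proof.
move=> hA; split=> [|b x _]; first exact: amapD.
elim/at_ind: x => [x y xE yE|x m]; first by rewrite scalerDr !amapD scalerDr xE yE.
by rewrite atZ !amapE atZ (lo_Z _ hA) // memvf.
Qed.
End AMap.

Lemma ses_atens K X Y : ses Sr K X Y -> ses B (atens K M) (atens X M) (atens Y M).
Proof.
move=> [i [p [s [r [[iA pA sB rB] [ps ri d]]]]]].
have iB := lo_full Sr iA; have pB := lo_full Sr pA.
exists (amap i), (amap p), (amap s), (amap r); split; split.
- exact: lo_amapA.
- exact: lo_amapA.
- exact: lo_amap.
- exact: lo_amap.
- by apply: at_eq => // [x y|x m]; rewrite ?amapD // !amapE // ps.
- by apply: at_eq => // [x y|x m]; rewrite ?amapD // !amapE // ri.
by apply: at_eq => // [x y|x m]; rewrite ?amapD 1?addrACA // !amapE // -atDl d.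
Qed.

Let Se1 : 1 \in Se := env_sub1 B1.

(** The section X -> A (x)_B X of [relproj_resl_section] commutes with right multiplication by A;
    pushed along x |-> x (x) m it is therefore balanced over A. *)
Lemma relproj_atens X : relproj Se X -> relproj B (atens X M).
Proof.
move=> /(relproj_resl_section B1 (op_sub1 B1))[s [sA sE sC]].
pose j m (y : resl X) : atens X M := at_ (y : X) m.
have jA m : linear_over {:A} (j m).
  by split=> [x y|c x _]; rewrite ?atZ //; apply: atDl.
have jB m := lo_full B (jA m).
have bal : balanced (@ract X) (@lact M) (fun x m => imap (B := B) (j m) (s x)).
  split=> [m x y|x m n|a x m].
  - by rewrite (lo_D sA) (lo_D (lo_imap B1 (jB m))).
  - move: (s x); apply: ind_eq => [||a y]; first exact: lo_D (lo_imap B1 (jB _)).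
      exact: lo_D (lo_add (lo_imap B1 (jB _)) (lo_imap B1 (jB _))).
    by rewrite !imapE // -itensDr; congr itens; apply: atDr.
  have aB : linear_over B (fun y : resl X => tens 1 (a : A^c) *: (y : X) : resl X).
    by split=> [y z|c y _]; rewrite ?scalerDr // !reslE !scalerA !tensM !mul1r !mulr1.
  rewrite /ract sC imap_comp //; congr (imap _ _); apply/funext => y.
  exact: at_bal.
pose v : atens X M -> ind B (atens X M) := glift (fun x m => imap (B := B) (j m) (s x)).
have vD : {morph v : x y / x + y} := gliftD bal.
have vE x m : v (at_ x m) = imap (B := B) (j m) (s x) := gliftE bal x m.
exists v; split.
  split=> // a x _; elim/at_ind: x => [x y xE yE|x m].
    by rewrite scalerDr !vD scalerDr xE yE.
  rewrite atZ !vE -(lo_Z _ (lo_imap B1 (jB m))) ?memvf //; congr (imap _ _).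
  by rewrite -(lo_Z _ sA) ?memvf.
apply: at_eq => // [x y|x m]; first by rewrite vD ind_mulD.
by rewrite vE (imap_mul B1 (jB m) (jA m)) sE.
Qed.

Lemma rpd_atens n X : right_proj B X -> rpd Se n X -> rpd B n (atens X M).
Proof.
elim: n X => [|n IHn] X Xr; first exact: relproj_atens.
have [Kr sK] := right_proj_omega B1 Xr.
move=> /(IHn _ Kr); apply: (rpd_ses B1 n (ses_atens sK) _).1.
exact/relproj_atens/relproj_ind.
Qed.

(** The syzygy sequences of A stay split after - (x)_A M, and M is a retract of A (x)_A M. *)
Lemma rpd_bimod n : rpd Se n (regular_bimod A) -> rpd B n M.
Proof.
move=> /(rpd_atens (right_proj_regular B1)).
pose X : lmodType (env A) := regular_bimod A.
have bal : balanced (@ract X) (@lact M) (fun x m => (x : A) *: m).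
  split=> [m x y|x m n'|a x m]; rewrite ?scalerDl ?scalerDr //.
  by rewrite /ract bimodZ mul1r scalerA.
pose g : atens X M -> M := glift (fun x m => (x : A) *: m).
have gD : {morph g : x y / x + y} := gliftD bal.
have gE x m : g (at_ x m) = (x : A) *: m := gliftE bal x m.
apply: (rpd_retract B1 (f := fun m => at_ ((1 : A) : X) m) (g := g)).
- split=> [x y|a m _]; first exact: atDr.
  by rewrite atZ -at_bal !bimodZ !mul1r !mulr1.
- split=> // a x _; elim/at_ind: x => [x y xE yE|x m].
    by rewrite scalerDr !gD scalerDr xE yE.
  by rewrite atZ !gE bimodZ mulr1 scalerA.
by move=> m; rewrite gE scale1r.
Qed.

End ATens.

(** * Transport along an isomorphism of extensions *)

Section Transfer.
Variables (k : fieldType) (R R' : falgType k) (S : {vspace R}) (S' : {vspace R'}).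
Variables (t : {rmorphism R -> R'}) (u : R' -> R).
Hypotheses (tu : cancel u t) (ut : cancel t u).
Hypotheses (tS : forall s, s \in S -> t s \in S') (uS : forall s, s \in S' -> u s \in S).
Hypotheses (S1 : 1 \in S) (S1' : 1 \in S').

Let uD : {morph u : x y / x + y}.
Proof. by move=> x y; apply: (can_inj ut); rewrite rmorphD !tu. Qed.
Let uM : {morph u : x y / x * y}.
Proof. by move=> x y; apply: (can_inj ut); rewrite rmorphM !tu. Qed.

Lemma lo_resmod (M N : lmodType R') (h : M -> N) : linear_over S' h ->
  linear_over S (h : resmod t M -> resmod t N).
Proof.
move=> hS; split=> [x y|c x cS]; first exact: (lo_D hS x y).
by apply: (lo_Z (b := t c) x hS); apply: tS.
Qed.

Lemma lo_resmod_full (M N : lmodType R') (h : M -> N) : linear_over {:R'} h ->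
  linear_over {:R} (h : resmod t M -> resmod t N).
Proof.
move=> hS; split=> [x y|c x cS]; first exact: (lo_D hS x y).
exact: (lo_Z (b := t c) x hS (memvf _)).
Qed.

Lemma relproj_resmod (X : lmodType R') : relproj S' X -> relproj S (resmod t X).
Proof.
move=> [s [sA sE]]; pose Y : lmodType R := resmod t X.
pose f (r : R') (x : X) := itens S (u r) (x : Y).
have fDl x : {morph f^~ x : a b / a + b} by move=> a b; rewrite /f uD itensDl.
have fDr r : {morph f r : x y / x + y} by move=> x y; rewrite /f (itensDr S (M := Y)).
have fB a b x : b \in S' -> f (a * b) x = f a (b *: x).
  by move=> bS; rewrite /f uM (itens_bal (M := Y)) ?uS // resE tu.
have gE := ind_liftE S1' fDl fDr fB; have gD := ind_liftD S1' fDl fDr fB.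
exists (fun x => ind_lift f (s x)); split.
  split=> [x y|a x _]; first by rewrite (lo_D sA) gD.
  rewrite resE (lo_Z _ sA) ?memvf //.
  elim/ind_ind: (s x) => [y z yE zE|b y]; first by rewrite scalerDr !gD yE zE scalerDr.
  by rewrite itensZ !gE /f uM ut itensZ.
move=> x; rewrite -[RHS]sE; elim/ind_ind: (s x) => [y z yE zE|b y].
  by rewrite gD !ind_mulD yE zE.
by rewrite gE /f !ind_mulE resE tu.
Qed.

Lemma rpd_resmod n (X : lmodType R') : rpd S' n X -> rpd S n (resmod t X).
Proof.
elim: n X => [|n IHn] X; first exact: relproj_resmod.
move=> /IHn; have [[iA pA sB rB] eqs] := ses_omega_split S' X.
apply: (rpd_ses S1 n (P := resmod t (ind S' X)) _ (relproj_resmod (relproj_ind S1' X))).1.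
exists (@kerin _ _ _ (imul S' X)), (@ind_mul _ _ S' X), (itens S' 1), (@orho _ _ S' X).
split=> //; split; [exact: lo_resmod_full iA|exact: lo_resmod_full pA| |].
  exact: lo_resmod sB.
exact: lo_resmod rB.
Qed.

End Transfer.

(** * Exchanging the middle factors between (A (x) C)^e and A^e (x) C^e *)

Section Interchange.
Variables (k : fieldType) (A C : falgType k).
Local Notation AC := (tensor A C).
Local Notation R := (env AC).
Local Notation R' := (tensor (env A) (env C)).

Definition pure4 (a : A) (c : C) (a' : A) (c' : C) : R :=
  tens (tens a c) (tens a' c' : AC^c).
Definition pure4' (a : A) (c : C) (a' : A) (c' : C) : R' :=
  tens (tens a (a' : A^c)) (tens c (c' : C^c)).

Lemma pure4_ind (P : R -> Prop) : (forall x y, P x -> P y -> P (x + y)) ->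
  (forall a c a' c', P (pure4 a c a' c')) -> forall x, P x.
Proof.
move=> PD Pp; apply: tens_ind => // u v.
elim/tens_ind: u => [u u' uP u'P|a c]; first by rewrite tensDl; apply: PD.
elim/(@tens_ind _ A C): v => [v v' vP v'P|a' c'].
  by rewrite (tensDr (A := AC) (C := AC^c)); apply: PD.
exact: Pp.
Qed.

Lemma pure4'_ind (P : R' -> Prop) : (forall x y, P x -> P y -> P (x + y)) ->
  (forall a c a' c', P (pure4' a c a' c')) -> forall x, P x.
Proof.
move=> PD Pp; apply: tens_ind => // u v.
elim/tens_ind: u => [u u' uP u'P|a c]; first by rewrite tensDl; apply: PD.
elim/tens_ind: v => [v v' vP v'P|a' c']; first by rewrite tensDr; apply: PD.
exact: Pp.
Qed.

Lemma pure4M a c a' c' b d b' d' :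
  pure4 a c a' c' * pure4 b d b' d' = pure4 (a * b) (c * d) (b' * a') (d' * c').
Proof. by rewrite /pure4 (envM (A := AC)) !tensM. Qed.

Lemma pure4'M a c a' c' b d b' d' :
  pure4' a c a' c' * pure4' b d b' d' = pure4' (a * b) (c * d) (b' * a') (d' * c').
Proof. by rewrite /pure4' tensM !envM. Qed.

(** The lift is made in stages, first in the pair a', c', then in a, c. The opposite of A (x) C has
    the same elements as A (x) C, so elements of [AC^c] are decomposed as tensors of A and C. *)
Let f1 a c a' c' := pure4' a c a' c'.
Let f2 a c (v : AC^c) : R' := tlift (fun a' c' => f1 a c a' c') (v : AC).
Let f3 (u : AC) (v : AC^c) : R' := tlift (fun a c => f2 a c v) u.

Definition interchange (z : R) : R' := tlift f3 z.

Let f2D a c : {morph f2 a c : x y / x + y}.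
Proof.
by apply: (tliftD (A := A) (C := C)) => a' x y; rewrite /f1 /pure4' !tensDr.
Qed.
Let f2E a c a' c' : f2 a c (tens a' c') = pure4' a c a' c'.
Proof.
apply: (tliftE (A := A) (C := C)) => [d x y|x b d].
  by rewrite /f1 /pure4' (tensDr (A := A) (C := A^c)) tensDl.
rewrite /f1 /pure4' (tensZr (A := A) (C := A^c)) (tensZr (A := C) (C := C^c)).
by rewrite tensZl tensZr.
Qed.
Let f2Dl c v : {morph (fun a => f2 a c v) : x y / x + y}.
Proof.
move=> x y; elim/(@tens_ind _ A C): v => [v v' vE v'E|a' c'].
  by rewrite !f2D vE v'E addrACA.
by rewrite !f2E /pure4' !tensDl.
Qed.
Let f2Dr a v : {morph (fun c => f2 a c v) : x y / x + y}.
Proof.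
move=> x y; elim/(@tens_ind _ A C): v => [v v' vE v'E|a' c'].
  by rewrite !f2D vE v'E addrACA.
by rewrite !f2E /pure4' tensDl tensDr.
Qed.
Let f2B v (x : k) a c : f2 (x *: a) c v = f2 a (x *: c) v.
Proof.
elim/(@tens_ind _ A C): v => [v v' vE v'E|a' c']; first by rewrite !f2D vE v'E.
by rewrite !f2E /pure4' !tensZl tensZr.
Qed.
Let f3Dl v : {morph f3^~ v : x y / x + y}.
Proof. by apply: tliftD => a x y; apply: f2Dr. Qed.
Let f3E a c v : f3 (tens a c) v = f2 a c v.
Proof.
by apply: (tliftE (A := A) (C := C)) => [d x y|x b d]; [apply: f2Dl|apply: f2B].
Qed.
Let f3Dr u : {morph f3 u : x y / x + y}.
Proof.
move=> x y; elim/tens_ind: u => [u u' uE u'E|a c]; last by rewrite !f3E f2D.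
by rewrite !f3Dl uE u'E addrACA.
Qed.
Let f3B (x : k) u v : f3 (x *: u) v = f3 u (x *: v).
Proof.
elim/tens_ind: u => [u u' uE u'E|a c]; first by rewrite scalerDr !f3Dl uE u'E.
rewrite -tensZl !f3E; elim/(@tens_ind _ A C): v => [v v' vE v'E|a' c'].
  by rewrite (scalerDr (s := AC^c)) !f2D vE v'E.
rewrite -[x *: _](tensZl x a' c') !f2E /pure4' tensZl (tensZr x a).
by [].
Qed.

Lemma interchangeD : {morph interchange : x y / x + y}. Proof. exact: tliftD. Qed.
Lemma interchangeE a c a' c' : interchange (pure4 a c a' c') = pure4' a c a' c'.
Proof. by rewrite [LHS](tliftE f3Dl f3B) f3E f2E. Qed.

Lemma interchange_mul : monoid_morphism interchange.
Proof.
split=> [|x y]; first exact: (interchangeE 1 1 1 1).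
elim/pure4_ind: x => [x x' xE x'E|a c a' c'].
  by rewrite mulrDl !interchangeD xE x'E mulrDl.
elim/pure4_ind: y => [y y' yE y'E|b d b' d'].
  by rewrite mulrDr !interchangeD yE y'E mulrDr.
by rewrite pure4M !interchangeE pure4'M.
Qed.
HB.instance Definition _ := GRing.isZmodMorphism.Build R R' interchange
  (additiveB interchangeD).
HB.instance Definition _ := GRing.isMonoidMorphism.Build R R' interchange interchange_mul.

Let g1 (u : env A) c c' : R :=
  tlift (fun a (a' : A^c) => pure4 a c a' c') u.
Let g2 (u : env A) (v : env C) : R := tlift (fun c (c' : C^c) => g1 u c c') v.
Definition interchange_inv (z : R') : R := tlift g2 z.

Let g1D c c' : {morph (fun u => g1 u c c') : x y / x + y}.
Proof.
apply: tliftD => a x y; rewrite /pure4.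
by rewrite (tensDl (A := A) (C := C)) (tensDr (A := AC) (C := AC^c)).
Qed.
Let g1E a a' c c' : g1 (tens a (a' : A^c)) c c' = pure4 a c a' c'.
Proof.
apply: (tliftE (A := A) (C := A^c)) => [d x y|x b d]; rewrite /pure4.
  by rewrite (tensDl (A := A) (C := C)) tensDl.
rewrite (tensZl (A := A) (C := C)) (tensZl (A := A) (C := C)) tensZl.
by rewrite (tensZr (A := AC) (C := AC^c)).
Qed.
Let g1Dl u c' : {morph (fun c => g1 u c c') : x y / x + y}.
Proof.
move=> x y; elim/tens_ind: u => [u u' uE u'E|a a'].
  by rewrite !g1D uE u'E addrACA.
by rewrite !g1E /pure4 (tensDr (A := A) (C := C)) tensDl.
Qed.
Let g1Dr u c : {morph (fun c' => g1 u c c') : x y / x + y}.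
Proof.
move=> x y; elim/tens_ind: u => [u u' uE u'E|a a'].
  by rewrite !g1D uE u'E addrACA.
by rewrite !g1E /pure4 (tensDr (A := A) (C := C)) (tensDr (A := AC) (C := AC^c)).
Qed.
Let g1B u (x : k) c c' : g1 u (x *: c) c' = g1 u c (x *: c').
Proof.
elim/tens_ind: u => [u u' uE u'E|a a']; first by rewrite !g1D uE u'E.
rewrite !g1E /pure4 !(tensZr (A := A) (C := C)) tensZl.
by rewrite (tensZr (A := AC) (C := AC^c)).
Qed.
Let g2D u : {morph g2 u : x y / x + y}.
Proof. by apply: tliftD => c x y; apply: g1Dr. Qed.
Let g2E u c c' : g2 u (tens c (c' : C^c)) = g1 u c c'.
Proof.
by apply: (tliftE (A := C) (C := C^c)) => [d x y|x b d]; [apply: g1Dl|apply: g1B].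
Qed.
Let g2Dl v : {morph g2^~ v : x y / x + y}.
Proof.
move=> x y; elim/tens_ind: v => [v v' vE v'E|c c']; last by rewrite !g2E g1D.
by rewrite !g2D vE v'E addrACA.
Qed.
Let g2B (x : k) u v : g2 (x *: u) v = g2 u (x *: v).
Proof.
elim/tens_ind: v => [v v' vE v'E|c c']; first by rewrite scalerDr !g2D vE v'E.
rewrite -tensZl !g2E; elim/tens_ind: u => [u u' uE u'E|a a'].
  by rewrite scalerDr !g1D uE u'E.
rewrite -tensZl !g1E /pure4 (tensZl (A := A) (C := C)).
by rewrite (tensZr (A := A) (C := C)).
Qed.

Lemma interchange_invD : {morph interchange_inv : x y / x + y}. Proof. exact: tliftD. Qed.
Lemma interchange_invE a c a' c' : interchange_inv (pure4' a c a' c') = pure4 a c a' c'.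
Proof. by rewrite [LHS](tliftE g2Dl g2B) g2E g1E. Qed.

Lemma interchangeK : cancel interchange interchange_inv.
Proof.
elim/pure4_ind => [x y xE yE|a c a' c'].
  by rewrite interchangeD interchange_invD xE yE.
by rewrite interchangeE interchange_invE.
Qed.

Lemma interchange_invK : cancel interchange_inv interchange.
Proof.
elim/pure4'_ind => [x y xE yE|a c a' c'].
  by rewrite interchange_invD interchangeD xE yE.
by rewrite interchange_invE interchangeE.
Qed.

Variables (B : {vspace A}) (D : {vspace C}).
Hypotheses (B1 : 1 \in B) (D1 : 1 \in D).
Local Notation S := (env_sub (tensor_sub B D)).
Local Notation S' := (tensor_sub (env_sub B) (env_sub D)).

Lemma interchange_sub s : s \in S -> interchange s \in S'.
Proof.
move: s; apply: tensor_sub_ind => [|x y xS yS|u v uS vS]; first by rewrite rmorph0 mem0v.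
  by rewrite rmorphD rpredD.
move: u uS; apply: tensor_sub_ind => [|x y xS yS|b d bB dD].
- by rewrite tens0l rmorph0 mem0v.
- by rewrite tensDl rmorphD rpredD.
move: vS; rewrite (mem_op_sub (tensor_sub B D) v); move: v.
apply: tensor_sub_ind => [|x y xS yS|b' d' bB' dD'].
- by rewrite (additive0 (tensDr (A := AC) (C := AC^c) _)) rmorph0 mem0v.
- by rewrite (tensDr (A := AC) (C := AC^c)) rmorphD rpredD.
rewrite [interchange _]interchangeE; apply: tens_mem; apply: tens_mem => //.
  by rewrite (mem_op_sub B b').
by rewrite (mem_op_sub D d').
Qed.

Lemma interchange_inv_sub s : s \in S' -> interchange_inv s \in S.
Proof.
have h0 : interchange_inv 0 = 0 by apply: (additive0 interchange_invD).
move: s; apply: tensor_sub_ind => [|x y xS yS|u v uS vS]; first by rewrite h0 mem0v.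
  by rewrite interchange_invD rpredD.
move: u uS; apply: tensor_sub_ind => [|x y xS yS|b b' bB bB'].
- by rewrite tens0l h0 mem0v.
- by rewrite tensDl interchange_invD rpredD.
move: v vS; apply: tensor_sub_ind => [|x y xS yS|d d' dD dD'].
- by rewrite (additive0 (tensDr _)) h0 mem0v.
- by rewrite tensDr interchange_invD rpredD.
rewrite [interchange_inv _]interchange_invE; apply: tens_mem; first exact: tens_mem.
rewrite (mem_op_sub (tensor_sub B D) (tens _ _)); apply: tens_mem.
  by rewrite -(mem_op_sub B b').
by rewrite -(mem_op_sub D d').
Qed.

(** After the exchange of factors, the A^e (x) C^e-module A (x)_k C is the regular bimodule of A (x)
    C. *)
Lemma rpd_bimod_tensor m n : rpd (env_sub B) m (regular_bimod A) ->
  rpd (env_sub D) n (regular_bimod C) -> rpd S (m + n) (regular_bimod AC).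
Proof.
move=> Am Cn; have AB1 := env_sub1 B1; have CD1 := env_sub1 D1.
have S1 : 1 \in S := env_sub1 (tensor_sub1 B1 D1).
have S1' : 1 \in S' := tensor_sub1 AB1 CD1.
have := rpd_resmod (t := interchange) interchange_invK interchangeK interchange_sub
  interchange_inv_sub S1 S1' (rpd_mtens AB1 CD1 Am Cn).
pose X : lmodType (env A) := regular_bimod A; pose Y : lmodType (env C) := regular_bimod C.
have sA (x : k) (a : A) : kact x (a : X) = x *: a.
  by rewrite /kact -tensZl bimodZ mulr1 -scalerAl mul1r.
have sC (x : k) (a : C) : kact x (a : Y) = x *: a.
  by rewrite /kact -tensZl bimodZ mulr1 -scalerAl mul1r.
pose f (z : AC) : mtens X Y := tlift (fun a c => mt (a : X) (c : Y)) z.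
have fDl (c : C) : {morph (fun a : A => mt (a : X) (c : Y)) : a b / a + b}.
  exact: (mtDl (M := X)).
have fDr (a : A) : {morph (fun c : C => mt (a : X) (c : Y)) : a b / a + b}.
  exact: (mtDr (N := Y)).
have fB (x : k) (a : A) (c : C) : mt (x *: a : X) (c : Y) = mt (a : X) (x *: c : Y).
  by rewrite -sA -sC mt_bal.
have fD : {morph f : x y / x + y} := tliftD fDr.
have fE a c : f (tens a c) = mt (a : X) (c : Y) := tliftE fDl fB a c.
have bal : balanced (@kact k (env A) X) (@kact k (env C) Y)
    (fun (a : A) (c : C) => tens a c : AC).
  split=> [c x y|a x y|x a c]; [exact: tensDl|exact: tensDr|].
  by rewrite sA sC tensZl tensZr.
pose g : mtens X Y -> AC := glift (fun (a : A) (c : C) => tens a c : AC).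
have gD : {morph g : x y / x + y} := gliftD bal.
have gE (a : A) (c : C) : g (mt (a : X) (c : Y)) = tens a c := gliftE bal a c.
pose Z : lmodType R := resmod interchange (mtens X Y).
pose reg : lmodType R := regular_bimod AC.
have lin4 (M N : lmodType R) (h : M -> N) : {morph h : x y / x + y} ->
    (forall a c a' c' x, h (pure4 a c a' c' *: x) = pure4 a c a' c' *: h x) ->
    linear_over {:R} h.
  move=> hD hZ; split=> // z x _; elim/pure4_ind: z => [z w zE wE|a c a' c'].
    by rewrite !scalerDl hD zE wE.
  exact: hZ.
have p4 a c a' c' (b : A) (d : C) : pure4 a c a' c' *: (mt (b : X) (d : Y) : Z) =
    mt (a * b * a' : X) (c * d * c' : Y).
  by rewrite resE /= interchangeE mtZ !bimodZ.
have r4 a c a' c' (b : A) (d : C) : pure4 a c a' c' *: (tens b d : reg) =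
    tens (a * b * a') (c * d * c').
  by rewrite (bimodZ (A := AC)) !tensM.
apply: (rpd_retract S1 (f := f : reg -> Z) (g := g : Z -> reg)).
- apply: lin4 => [|a c a' c' x]; first exact: fD.
  elim/(@tens_ind _ A C): x => [x y xE yE|b d].
    by rewrite (scalerDr (s := reg)) !fD xE yE (scalerDr (s := Z)).
  by rewrite r4 !fE p4.
- apply: lin4 => [|a c a' c' x]; first exact: gD.
  elim/(@mt_ind _ _ _ X Y): x => [x y xE yE|b d].
    by rewrite (scalerDr (s := Z)) !gD xE yE (scalerDr (s := reg)).
  by rewrite p4 !gE r4.
move=> x; elim/(@tens_ind _ A C): x => [x y xE yE|b d]; last by rewrite fE gE.
by rewrite fD gD xE yE.
Qed.

End Interchange.

(** * Jacobson radicals *)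

Section VspaceExtremal.
Variables (k : fieldType) (V : vectType k).
Implicit Types (U W : {vspace V}).

Lemma vspace_maximal (P : {vspace V} -> Prop) U : P U ->
  exists W, [/\ P W, (U <= W)%VS & forall W', P W' -> (W <= W')%VS -> W' = W].
Proof.
move=> PU; pose Q n := `[< exists W, [/\ P W, (U <= W)%VS & \dim W = n] >].
have exQ : exists n, Q n by exists (\dim U); apply/asboolP; exists U.
have boundQ n : Q n -> (n <= \dim {:V})%N.
  by move=> /asboolP[W [_ _ <-]]; apply: dimvS (subvf W).
case: (ex_maxnP exQ boundQ) => n /asboolP[W [PW UW Wn]] maxn.
exists W; split=> // W' PW' WW'; apply/esym/eqP; rewrite eqEdim WW' /= Wn.
by apply: maxn; apply/asboolP; exists W'; split=> //; apply: subv_trans WW'.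
Qed.

(** A maximal subspace inside W is all of W, since any further vector of W could be adjoined. *)
Lemma vspace_of_prop (W : V -> Prop) : W 0 -> (forall x y, W x -> W y -> W (x + y)) ->
  (forall c x, W x -> W (c *: x)) -> exists U, forall x, x \in U <-> W x.
Proof.
move=> W0 WD WZ.
have P0 : forall x : V, x \in 0%VS -> W x by move=> x; rewrite memv0 => /eqP ->.
have [U [PU _ maxU]] := vspace_maximal (P := fun U => forall x, x \in U -> W x) P0.
exists U => x; split=> [/PU //|Wx].
have <- : (U + <[x]>)%VS = U.
  apply: maxU (addvSl _ _) => y /memv_addP[u uU [_ /vlineP[c ->] ->]].
  by apply: WD; [apply: PU|apply: WZ].
by rewrite memvE addvSr.
Qed.

End VspaceExtremal.

Section Jacobson.
Variables (k : fieldType) (A : falgType k) (B : {vspace A}).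
Hypothesis Bsub : unital_subalgebra B.
Implicit Types (I L W : {vspace A}).
Local Notation J := (jacobson B).

Let B1 : 1 \in B. Proof. by have /andP[] := Bsub. Qed.
Let BM b c : b \in B -> c \in B -> b * c \in B.
Proof. by have /andP[_ /prodvP] := Bsub; apply. Qed.

Lemma left_idealP L : left_ideal B L <->
  (forall x, x \in L -> x \in B) /\ (forall b x, b \in B -> x \in L -> b * x \in L).
Proof.
split=> [/andP[/subvP LB /prodvP BL]|[LB BL]]; first by split.
by apply/andP; split; [apply/subvP|apply/prodvP].
Qed.

Lemma left_idealB : left_ideal B B.
Proof. by apply/left_idealP; split. Qed.

Lemma left_ideal_add L W : left_ideal B L -> left_ideal B W -> left_ideal B (L + W).
Proof.
move=> /left_idealP[LB BL] /left_idealP[WB BW]; apply/left_idealP.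
split=> [x|b x bB] /memv_addP[u uL [v vW ->]]; first by apply: rpredD; [apply: LB|apply: WB].
by rewrite mulrDr memv_add ?BL ?BW.
Qed.

Lemma left_ideal_cap L W : left_ideal B L -> left_ideal B W -> left_ideal B (L :&: W).
Proof.
move=> /left_idealP[LB BL] /left_idealP[WB BW]; apply/left_idealP.
split=> [x|b x bB]; rewrite !memv_cap => /andP[xL xW]; first exact: LB.
by rewrite BL ?BW.
Qed.

Lemma left_ideal1 L : left_ideal B L -> 1 \in L -> L = B.
Proof.
move=> /left_idealP[LB BL] L1; apply/eqP; rewrite eqEsubv.
apply/andP; split; apply/subvP => // x xB.
by rewrite -[x]mulr1 BL.
Qed.

Lemma jacobson_left : left_ideal B J.
Proof.
apply/left_idealP; split=> [x /jacobsonP[]|b x bB /jacobsonP[xB xI]] //.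
apply/jacobsonP; split=> [|I Imax]; first exact: BM.
have [/left_idealP[_ BI] _ _] := Imax.
exact: BI (xI I Imax).
Qed.

Let JB x : x \in J -> x \in B. Proof. by case/jacobsonP. Qed.
Let BJ b x : b \in B -> x \in J -> b * x \in J.
Proof. by have /left_idealP[_] := jacobson_left; apply. Qed.

Lemma jacobson_sub_maximal I : maximal_left_ideal B I -> (J <= I)%VS.
Proof. by move=> Imax; apply/subvP => x /jacobsonP[_]; apply. Qed.

(* Nakayama: if [W] is a maximal proper submodule of [V] and [v \notin W], then
   the annihilator of [v] in [V / W] is a maximal left ideal. *)
Lemma nakayama (V : {vspace A}) : (B * V <= V)%VS -> (J * V)%VS = V -> V = 0%VS.
Proof.
move=> /prodvP BV JV; apply: contrapT => V0.
pose P W := [/\ forall b x, b \in B -> x \in W -> b * x \in W, (W <= V)%VS & W <> V].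
have [|W [[BW WV nWV] _ maxW]] := @vspace_maximal _ _ P 0%VS.
  split=> [b x _|//|]; last exact: nesym.
    by rewrite !memv0 => /eqP ->; rewrite mulr0.
  exact: sub0v.
apply: nWV; apply/eqP; rewrite eqEsubv WV /= -JV; apply/prodvP => j v jJ vV.
have [vW|/negP vW] := boolP (v \in W); first by apply: BW => //; apply: JB.
have [I IE] : exists I : {vspace A}, forall x, x \in I <-> x \in B /\ x * v \in W.
  apply: vspace_of_prop => [|x y [xB xW] [yB yW]|c x [xB xW]].
  - by rewrite mul0r !mem0v.
  - by rewrite mulrDl !rpredD.
  by rewrite -scalerAl !rpredZ.
suff Imax : maximal_left_ideal B I.
  by have /subvP/(_ j jJ)/IE[] := jacobson_sub_maximal Imax.
have Il : left_ideal B I.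
  apply/left_idealP; split=> [x /IE[] //|b x bB /IE[xB xW]].
  by apply/IE; split; [exact: BM|rewrite -mulrA; apply: BW].
split=> // [IB|K Kl IK]; first by have /IE[_] : 1 \in I; rewrite ?IB // mul1r.
have [KI|/subvPn[x xK xI]] := boolP (K <= I)%VS.
  by left; apply/eqP; rewrite eqEsubv KI.
right; apply: (left_ideal1 Kl); have /left_idealP[KB BK] := Kl.
(* W' = K v + W is strictly larger than W because x v is not in W, so it equals V. Writing v = c v +
   w gives 1 - c in I, and hence 1 in K. *)
have [W' W'E] : exists W' : {vspace A}, forall y, y \in W' <->
    exists c w, [/\ c \in K, w \in W & y = c * v + w].
  apply: vspace_of_prop => [|y z [c [w [cK wW ->]]] [d [u [dK uW ->]]]|a y [c [w [cK wW ->]]]].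
  - by exists 0, 0; rewrite !mem0v mul0r addr0.
  - by exists (c + d), (w + u); rewrite !rpredD // mulrDl addrACA.
  by exists (a *: c), (a *: w); rewrite !rpredZ // -scalerAl scalerDr.
have WW' : (W <= W')%VS.
  by apply/subvP => w wW; apply/W'E; exists 0, w; rewrite mem0v mul0r add0r.
have W'V : W' = V.
  apply: contrapT => nW'V; apply/(negP xI)/IE; split; first exact: KB.
  rewrite -(maxW W') //; last first.
    split=> // [b y bB /W'E[c [w [cK wW ->]]]|].
      apply/W'E; exists (b * c), (b * w).
      by rewrite mulrDr mulrA; split=> //; [apply: BK|apply: BW].
    apply/subvP => y /W'E[c [w [cK wW ->]]].
    by apply: rpredD; [apply: BV => //; apply: KB|apply: (subvP WV)].
  by apply/W'E; exists x, 0; rewrite mem0v addr0.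
have := vV; rewrite -W'V => /W'E[c [w [cK wW vE]]].
suff : 1 - c \in K by move=> H; rewrite -(subrK c 1) rpredD.
apply: (subvP IK); apply/IE; split; first by rewrite rpredB // KB.
by rewrite mulrBl mul1r {1}vE addrC addKr.
Qed.

Lemma left_ideal_expv L n : left_ideal B L -> (B * L ^+ n.+1 <= L ^+ n.+1)%VS.
Proof.
by move=> /andP[_ BL]; rewrite expvSl prodvA prodvSl.
Qed.

(** By Nakayama the powers of J strictly decrease in dimension as long as they are nonzero. *)
Lemma jacobson_nilpotent : exists n, (J ^+ n.+1 = 0)%VS.
Proof.
have step n : (J ^+ n.+1)%VS <> 0%VS -> (\dim (J ^+ n.+2) < \dim (J ^+ n.+1))%N.
  move=> Jn; rewrite ltnNge; apply/negP => dimJ; apply: Jn; apply: nakayama.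
    exact: left_ideal_expv jacobson_left.
  apply/eqP; rewrite -expvSl eqEdim dimJ andbT.
  have /andP[JBv BJv] := jacobson_left.
  rewrite expvSl; apply: subv_trans (left_ideal_expv n jacobson_left).
  exact: prodvSl.
apply: contrapT => H.
have dimJ n : (\dim (J ^+ n.+1) + n <= \dim J)%N.
  elim: n => [|n IHn]; first by rewrite addn0 expv1.
  apply: leq_trans IHn; rewrite addnS -addSn leq_add2r; apply: step => Jn.
  by apply: H; exists n.
by have := leq_trans (leq_addl _ _) (dimJ (\dim J).+1); rewrite ltnn.
Qed.

(** If a maximal left ideal I did not contain L, then I + L = B and 1 = i + u with u in L nilpotent;
    the geometric series inverts i = 1 - u, so I = B. *)
Lemma nilpotent_sub_jacobson L n : left_ideal B L -> (L ^+ n = 0)%VS -> (L <= J)%VS.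
Proof.
move=> Ll Ln; have /left_idealP[LB BL] := Ll; apply/subvP => x xL.
apply/jacobsonP; split=> [|I Imax]; first exact: LB.
have [Il nIB maxI] := Imax; apply: contrapT => xI; apply: nIB.
have [LI|] := maxI _ (left_ideal_add Il Ll) (addvSl _ _).
  by case: xI; rewrite -LI memvE; apply: subv_trans (addvSr _ _); rewrite -memvE.
move=> IL; have : 1 \in (I + L)%VS by rewrite IL.
move=> /memv_addP[i iI [u uL one]]; apply: (left_ideal1 Il).
have un : u ^+ n = 0.
  apply/eqP; rewrite -memv0 -Ln; elim: {Ln} n => [|m IHm]; first by rewrite expv0 memv_line.
  by rewrite exprS expvSl memv_mul.
have iE : i = 1 - u by rewrite one addrK.
have -> : 1 = (\sum_(j < n) u ^+ j) * i.
  have comm1 : GRing.comm 1 u by apply: commr_sym; apply: commr1.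
  have := subrXX_comm n comm1; rewrite expr1n un subr0 -iE => {1}->.
  have iu : GRing.comm i u by rewrite iE; apply: commr_sym; apply: commrB; [apply: commr1|].
  rewrite mulr_sumr mulr_suml; apply: eq_bigr => j _.
  by rewrite expr1n mul1r; apply: commrX.
have /left_idealP[_ BI] := Il; apply: BI => //; apply: rpred_sum => j _.
by elim: (val j) => [|m IHm]; rewrite ?expr0 // exprS BM // LB.
Qed.

(** Not visible from maximal left ideals: J B is a left ideal whose powers satisfy (J B)^n <= J^n B,
    so it is nilpotent and lies in J. *)
Lemma jacobson_right x b : x \in J -> b \in B -> x * b \in J.
Proof.
move=> xJ bB; have /andP[JBv BJv] := jacobson_left.
have [n Jn] := jacobson_nilpotent.
suff /subvP H : (J * B <= J)%VS by apply/H/memv_mul.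
apply: (nilpotent_sub_jacobson (n := n.+1)).
  apply/andP; split; last by rewrite prodvA prodvSl.
  by apply/prodvP => j c jJ cB; apply: BM => //; apply: JB.
apply/eqP; rewrite -subv0 -(prod0v B) -Jn; elim: n {Jn} => [|n IHn]; first by rewrite !expv1.
rewrite (expvSl (J * B)) (expvSl J).
apply: subv_trans (prodvSr _ IHn) _; rewrite -prodvA -[X in (_ <= X)%VS]prodvA prodvSr //.
by rewrite prodvA prodvSl // (left_ideal_expv _ jacobson_left).
Qed.

(** Semisimplicity of B/J. If L is larger than J, some maximal left ideal I cuts it down, and a
    complement W' of the intersection of L and I is replaced by the intersection of W' and I. *)
Lemma left_ideal_complement L : left_ideal B L -> (J <= L)%VS ->
  exists W, [/\ left_ideal B W, (L + W)%VS = B & (L :&: W)%VS = J].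
Proof.
have [n] := ubnP (\dim L); elim: n L => // n IHn L /ltnSE Ln Ll JL.
have LB : (L <= B)%VS by have /andP[] := Ll.
have [LJ|nLJ] := boolP (L <= J)%VS.
  have -> : L = J by apply/eqP; rewrite eqEsubv LJ.
  have JBv : (J <= B)%VS by apply/subvP.
  exists B; split; [exact: left_idealB|exact/addv_idPr|exact/capv_idPl].
have [x xL xJ] := subvPn nLJ.
have [I Imax xI] : exists2 I, maximal_left_ideal B I & x \notin I.
  apply: contrapT => H; move/negP: xJ; apply; apply/jacobsonP; split=> [|I Imax].
    exact: (subvP LB).
  by apply: contrapT => /negP xI; apply: H; exists I.
have [Il nIB maxI] := Imax; have JI := jacobson_sub_maximal Imax.
have IB : (I <= B)%VS by have /andP[] := Il.
have [||W' [W'l LIW' capW']] := IHn (L :&: I)%VS _ (left_ideal_cap Ll Il).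
- apply: leq_trans Ln; rewrite ltn_neqAle dimvS ?capvSl // andbT.
  apply: contra xI => /eqP dimE; have /eqP LI : (L :&: I)%VS == L.
    by rewrite eqEdim capvSl dimE /=.
  by move: xL; rewrite -LI memv_cap => /andP[].
- by rewrite subv_cap JL.
have W'B : (W' <= B)%VS by have /andP[] := W'l.
have JW' : (J <= W')%VS by rewrite -capW' capvSr.
exists (W' :&: I)%VS; split; first exact: left_ideal_cap.
- have Wl := left_ideal_add Ll (left_ideal_cap W'l Il).
  have IW : (I <= L + W' :&: I)%VS.
    apply/subvP => y yI; have := subvP IB _ yI; rewrite -LIW' => /memv_addP[u].
    rewrite memv_cap => /andP[uL uI] [v vW' yE]; rewrite yE; apply: memv_add => //.
    rewrite memv_cap vW' /=.
    have -> : v = y - u by rewrite yE addrC addKr.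
    by rewrite rpredB.
  have [LI|//] := maxI _ Wl IW.
  by case/negP: xI; rewrite -LI memvE; apply: subv_trans (addvSl _ _); rewrite -memvE.
apply/eqP; rewrite eqEsubv; apply/andP; split; last by rewrite !subv_cap JL JW' JI.
by rewrite -capW' capvA (capvC L W') -capvA capvC capvS.
Qed.

(** With W a complement of L modulo J, the L-component l of 1 = l + w works: s - s l = s w lies in
    both L and W. *)
Lemma left_ideal_right_unit L : left_ideal B L -> (J <= L)%VS ->
  exists2 l, l \in L & forall s, s \in L -> s - s * l \in J.
Proof.
move=> Ll JL; have [W [Wl LW capW]] := left_ideal_complement Ll JL.
have : 1 \in (L + W)%VS by rewrite LW.
have /left_idealP[LB BL] := Ll; have /left_idealP[WB BW] := Wl.
move=> /memv_addP[l lL [w wW one]]; exists l => // s sL.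
rewrite -capW memv_cap; apply/andP; split; first by rewrite rpredB // BL // LB.
have -> : s - s * l = s * w by rewrite -{1}[s]mulr1 one mulrDr addrC addKr.
by rewrite BW // LB.
Qed.

(** For the left ideal B s + J the right unit is some x s up to J. *)
Lemma regular_mod_jacobson s : s \in B -> exists2 x, x \in B & s - s * x * s \in J.
Proof.
move=> sB; have Bsl : left_ideal B (B * <[s]>).
  have /andP[_ BB] := Bsub.
  apply/andP; split; last by rewrite prodvA prodvSl.
  by apply: subv_trans BB; rewrite prodvSr // -memvE.
have [l] := left_ideal_right_unit (left_ideal_add Bsl jacobson_left) (addvSr _ _).
move=> /memv_addP[u + [j jJ ->]] H; rewrite -limg_amulr => /memv_imgP[x xB uE].
rewrite uE lfunE /= in H; exists x => //.
have sL : s \in (B * <[s]> + J)%VS.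
  by apply: (subvP (addvSl _ _)); rewrite -[X in X \in _]mul1r memv_mul ?memv_line.
have := H s sL; rewrite mulrDr opprD addrA mulrA => HJ.
have sj : s * j \in J by apply: BJ.
by rewrite -[X in X \in J](subrK (s * j)) rpredD.
Qed.

(** Modules killed by J(B) are semisimple over B. The lift is built on the B-span of a list of
    vectors and extended by one vector at a time. *)
Lemma semisimple_lift (M N N' : lmodType A) (f : M -> N) (p : N' -> N) : fd M ->
  (forall j m, j \in J -> j *: (m : M) = 0) -> (forall j n, j \in J -> j *: (n : N') = 0) ->
  linear_over B f -> linear_over B p -> (forall m, exists n, p n = f m) ->
  exists2 g : M -> N', linear_over B g & forall m, p (g m) = f m.
Proof.
move=> [n [gen genM]] JM JN fB pB pS.
pose inB := fix inB (s : seq M) (x : M) : Prop :=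
  if s is y :: s' then exists b z, [/\ b \in B, inB s' z & x = z + b *: y] else x = 0.
have in0 s : inB s 0.
  elim: s => //= y s IHs; exists 0, 0; rewrite mem0v scale0r addr0; by split.
have inD s x y : inB s x -> inB s y -> inB s (x + y).
  elim: s x y => [|z s IHs] x y /=; first by move=> -> ->; rewrite addr0.
  move=> [b [u [bB us ->]]] [c [v [cB vs ->]]]; exists (b + c), (u + v).
  by rewrite rpredD // scalerDl addrACA; split=> //; apply: IHs.
have inZ s a x : a \in B -> inB s x -> inB s (a *: x).
  move=> aB; elim: s x => [|z s IHs] x /=; first by move=> ->; rewrite scaler0.
  move=> [b [u [bB us ->]]]; exists (a * b), (a *: u).
  by rewrite BM // scalerDr scalerA; split=> //; apply: IHs.
pose good s (g : M -> N') := [/\ forall x y, inB s x -> inB s y -> g (x + y) = g x + g y,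
  forall b x, b \in B -> inB s x -> g (b *: x) = b *: g x &
  forall x, inB s x -> p (g x) = f x].
suff H s : exists g, good s g.
  have all x : inB [seq gen i | i <- enum 'I_n] x.
    have [c ->] := genM x; rewrite -big_enum /=.
    elim: (enum 'I_n) => [|i s IHs] /=; first by rewrite big_nil.
    rewrite big_cons addrC; exists (c i)%:A; eexists; split; [exact: rpredZ|exact: IHs|by []].
  have [g [gD gZ gp]] := H [seq gen i | i <- enum 'I_n].
  by exists g => [|m]; [split=> [x y|b x bB]; [apply: gD|apply: gZ]|apply: gp].
elim: s => [|y s [g [gD gZ gp]]].
  exists (fun=> 0); split=> [x z _ _|b x _ _|x ->]; rewrite ?addr0 ?scaler0 //.
  by rewrite (lo_0 pB) (lo_0 fB).
(* L measures the overlap of B y with the span already treated. *)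
have [L LE] : exists L : {vspace A}, forall b, b \in L <-> b \in B /\ inB s (b *: y).
  apply: vspace_of_prop => [|b c [bB bs] [cB cs]|c b [bB bs]].
  - by rewrite mem0v scale0r; split.
  - by rewrite rpredD // scalerDl; split=> //; apply: inD.
  rewrite rpredZ //; split=> //.
  have -> : (c *: b) *: y = c%:A *: (b *: y) by rewrite scalerA -scalerAl mul1r.
  by apply: inZ => //; apply: rpredZ.
have Ll : left_ideal B L.
  apply/left_idealP; split=> [b /LE[] //|c b cB /LE[bB bs]].
  by apply/LE; rewrite -scalerA BM //; split=> //; apply: inZ.
have JL : (J <= L)%VS.
  by apply/subvP => j jJ; apply/LE; rewrite JM //; split=> //; apply: JB.
have [l lL lE] := left_ideal_right_unit Ll JL; have [lB ls] := (LE l).1 lL.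
have [w0 pw0] := pS y.
(* As l y is in the span of [s], the vectors y and y' generate the same module modulo that span, and
   B y' meets it only in 0. The same factor 1 - l on w0 makes b w' vanish whenever b y' lies in the
   span. *)
pose y' := (1 - l) *: y; pose w' := (1 - l) *: w0.
have l1B : 1 - l \in B by rewrite rpredB.
have pw' : p w' = f y' by rewrite (lo_Z _ pB) // pw0 (lo_Z _ fB).
(* [b y'] in the span forces [b (1 - l)] into the radical. *)
have indep b : b \in B -> inB s (b *: y') -> b *: y' = 0 /\ b *: w' = 0.
  move=> bB; rewrite /y' /w' !scalerA => bs.
  have tL : b * (1 - l) \in L by apply/LE; split=> //; apply: BM.
  have lJ : (1 - l) * l \in J by rewrite mulrBl mul1r lE.
  have tJ : b * (1 - l) \in J.
    rewrite -[X in X \in J](subrK (b * (1 - l) * l)) rpredD ?lE //.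
    by rewrite -mulrA BJ.
  by rewrite JM ?JN.
(* The graph of the extended map; [indep] makes it single-valued. *)
pose rel x v := exists b z, [/\ b \in B, inB s z, x = z + b *: y' & v = g z + b *: w'].
have relI x v v' : rel x v -> rel x v' -> v = v'.
  move=> [b [z [bB zs xE ->]]] [c [u [cB us]]]; rewrite xE => zu ->.
  have uz : u - z = (b - c) *: y'.
    rewrite scalerBl; apply/eqP; rewrite subr_eq addrAC eq_sym subr_eq.
    by rewrite addrC zu addrC.
  have [bc0 bc0'] : (b - c) *: y' = 0 /\ (b - c) *: w' = 0.
    apply: indep; first by rewrite rpredB.
    by rewrite -uz -scaleN1r; apply: inD => //; apply: inZ; rewrite ?rpredN.
  have -> : z = u by apply/esym/eqP; rewrite -subr_eq0 uz bc0.
  by congr (_ + _); apply/eqP; rewrite -subr_eq0 -scalerBl bc0'.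
have relT x : inB (y :: s) x -> exists v, rel x v.
  move=> [b [z [bB zs ->]]]; exists (g (z + (b * l) *: y) + b *: w').
  exists b, (z + (b * l) *: y); split=> //.
    by apply: inD => //; rewrite -scalerA; apply: inZ.
  by rewrite -addrA /y' !scalerA -scalerDl mulrBr mulr1 [X in X *: y]addrC subrK.
have [g' g'E] : exists g' : M -> N', forall x, inB (y :: s) x -> rel x (g' x).
  have /choice[g' g'E] : forall x, exists v, inB (y :: s) x -> rel x v.
    move=> x; have [/relT[v xv]|nx] := pselect (inB (y :: s) x); first by exists v.
    by exists 0.
  by exists g'.
exists g'; split=> [x z xs zs|b x bB xs|x xs].
- apply: (relI (x + z)); first exact/g'E/inD.
  have [b [u [bB us xE ->]]] := g'E _ xs; have [c [v [cB vs zE ->]]] := g'E _ zs.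
  exists (b + c), (u + v); rewrite rpredD // xE zE !scalerDl gD //.
  by split=> //; rewrite 1?addrACA //; apply: inD.
- apply: (relI (b *: x)); first exact/g'E/inZ.
  have [c [u [cB us xE ->]]] := g'E _ xs.
  exists (b * c), (b *: u); rewrite BM // xE !scalerDr !scalerA gZ //.
  by split=> //; apply: inZ.
have [b [u [bB us -> ->]]] := g'E _ xs.
by rewrite (lo_D pB) (lo_Z _ pB) // pw' gp // (lo_D fB) (lo_Z _ fB).
Qed.

End Jacobson.

(** * Tensor products of semisimple algebras over a perfect field *)

Section NilpotentTrace.
Variable k : fieldType.

(* With [N = C R] a rank factorisation, [R C] has the trace of [N] and a
   smaller nilpotency exponent. *)
Lemma nilpotent_trace m n (N : 'M[k]_n) : N ^+ m = 0 -> \tr N = 0.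
Proof.
elim: m n N => [|m IHm] n N Nm.
  by rewrite -[N]mul1r -(expr0 N) Nm mul0r mxtrace0.
rewrite -{1}(mulmx_base N) mxtrace_mulC; apply: IHm.
have key j : N ^+ j.+1 = col_base N *m (row_base N *m col_base N) ^+ j *m row_base N.
  elim: j => [|j IHj]; first by rewrite expr0 mulmx1 mulmx_base.
  have -> : N ^+ j.+2 = N *m N ^+ j.+1 by rewrite exprS.
  have -> : (row_base N *m col_base N) ^+ j.+1 =
      row_base N *m col_base N *m (row_base N *m col_base N) ^+ j by rewrite exprS.
  by rewrite IHj -[X in X *m _](mulmx_base N) !mulmxA.
apply: (row_full_inj (col_base_full N)); apply: (row_free_inj (row_base_free N)).
by rewrite /= mulmx0 mul0mx -key.
Qed.

(** In a rank factorisation N = C R of an idempotent, R C is the identity matrix of size rank N. *)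
Lemma idempotent_trace n (N : 'M[k]_n) : N *m N = N -> \tr N = (\rank N)%:R.
Proof.
move=> NN; rewrite -{1}(mulmx_base N) mxtrace_mulC.
suff -> : row_base N *m col_base N = 1%:M by rewrite mxtrace1.
apply: (row_full_inj (col_base_full N)); apply: (row_free_inj (row_base_free N)).
by rewrite mulmx1 mulmxA -mulmxA !mulmx_base.
Qed.
End NilpotentTrace.

Section RegularTrace.
Variables (k : fieldType) (S : falgType k).
Local Notation e := (vbasis {:S}).

(** Left multiplication by x acting on row vectors, hence the reversed product in [regmxM]. *)
Definition regmx (x : S) : 'M[k]_(\dim {:S}) := \matrix_(i, j) coord e j (x * e`_i).
Definition rtrace (x : S) : k := \tr (regmx x).

Lemma regmxM x y : regmx (x * y) = regmx y *m regmx x.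
Proof.
apply/matrixP => i j; rewrite !mxE -mulrA [y * _ in LHS](coord_vbasis_full (y * e`_i)).
rewrite mulr_sumr linear_sum; apply: eq_bigr => l _.
by rewrite !mxE -scalerAr linearZ.
Qed.

Lemma regmxX x n : regmx (x ^+ n) = regmx x ^+ n.
Proof.
elim: n => [|n IHn]; last by rewrite exprSr regmxM IHn exprS.
apply/matrixP => i j; rewrite !mxE mul1r coord_free ?(basis_free (vbasisP _)) //.
Qed.

Lemma regmx_eq0 x : regmx x = 0 -> x = 0.
Proof.
move=> /matrixP x0; rewrite -[x]mulr1 (coord_vbasis_full 1) mulr_sumr big1 // => i _.
rewrite -scalerAr (coord_vbasis_full (x * e`_i)) big1 ?scaler0 // => j _.
by have := x0 i j; rewrite !mxE => ->; rewrite scale0r.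
Qed.

Lemma rtraceD : {morph rtrace : x y / x + y}.
Proof.
move=> x y; rewrite /rtrace -mxtraceD; congr (\tr _).
by apply/matrixP => i j; rewrite !mxE mulrDl linearD.
Qed.

Lemma rtraceZ a x : rtrace (a *: x) = a * rtrace x.
Proof.
rewrite /rtrace -mxtraceZ; congr (\tr _).
by apply/matrixP => i j; rewrite !mxE -scalerAl linearZ.
Qed.

Lemma rtrace_nilpotent x n : x ^+ n = 0 -> rtrace x = 0.
Proof.
move=> xn; apply: (@nilpotent_trace _ n); rewrite -regmxX xn.
by apply/matrixP => i j; rewrite !mxE mul0r linear0.
Qed.

(** Computing with a family other than [vbasis] is needed for tensor products, where the products of
    basis vectors are the convenient family. *)
Lemma rtrace_dual (I : finType) (b : I -> S) (c : I -> S -> k) (x : S) :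
  (forall i, scalar (c i)) -> (forall y, y = \sum_i c i y *: b i) ->
  rtrace x = \sum_i c i (x * b i).
Proof.
move=> cL bc; rewrite /rtrace /mxtrace.
transitivity (\sum_(i < \dim {:S}) \sum_j c j e`_i * coord e i (x * b j)).
  apply: eq_bigr => i _; rewrite mxE [e`_i in LHS](bc e`_i) mulr_sumr linear_sum.
  by apply: eq_bigr => j _; rewrite -scalerAr linearZ.
rewrite exchange_big; apply: eq_bigr => j _.
have cD : {morph c j : y z / y + z}.
  by move=> y z; have := cL j 1 y z; rewrite scale1r mul1r.
have cZ a y : c j (a *: y) = a * c j y.
  by have := cL j a y 0; rewrite (additive0 cD) !addr0.
rewrite [x * b j in RHS](coord_vbasis_full (x * b j)) (additive_sum _ _ _ cD).
by apply: eq_bigr => i _; rewrite cZ mulrC.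
Qed.

Definition regular_ring : Prop := forall s : S, exists x, s * x * s = s.

(** With x y x = x, the element x y is idempotent and its trace is a rank, which in characteristic 0
    vanishes only for x y = 0. *)
Lemma rtrace_nondegenerate x : regular_ring -> [pchar k] =i pred0 ->
  (forall y, rtrace (x * y) = 0) -> x = 0.
Proof.
move=> Sreg /pcharf0P char0 xT; have [y xyx] := Sreg x.
have idem : regmx (x * y) *m regmx (x * y) = regmx (x * y).
  by rewrite -regmxM mulrA xyx.
have := xT y; rewrite /rtrace (idempotent_trace idem) => /eqP.
rewrite char0 mxrank_eq0 => /eqP /regmx_eq0 xy0.
by rewrite -xyx xy0 mul0r.
Qed.

End RegularTrace.

(** * Roots of order p over a perfect field *)

Section PerfectRoot.
Variables (k : fieldType) (p : nat).
Hypotheses (k_perfect : perfect_field k) (pk : p \in [pchar k]).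

(** Write f = X^p - c as h g^i with g irreducible and i maximal. As f' = 0 and g is separable, p
    divides i; comparing degrees, i = p and g is linear. *)
Lemma perfect_root (c : k) : exists b, b ^+ p = c.
Proof.
have p_gt0 : (0 < p)%N by apply: prime_gt0; case/andP: pk.
pose f : {poly k} := 'X^p - c%:P.
have fsize : size f = p.+1 by rewrite size_XnsubC.
have f0 : f != 0 by rewrite -size_poly_eq0 fsize.
have f'0 : f^`() = 0.
  by rewrite derivB derivC subr0 derivXn -scaler_nat (pcharf0 pk) scale0r.
(* An irreducible factor is found as a non-constant divisor of least size; [size] is the degree plus
   one, whence [n.-1] below. *)
pose Q n := `[< exists g : {poly k}, [/\ size g = n, (1 < n)%N & g %| f] >].
have exQ : exists n, Q n.
  by exists p.+1; apply/asboolP; exists f; rewrite fsize.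
case: (ex_minnP exQ) => n /asboolP[g [gn n1 gf]] nmin.
have g0 : g != 0 by rewrite -size_poly_gt0 gn (ltn_trans _ n1).
have girr : irreducible_poly g.
  split=> [|q q1 qg]; first by rewrite gn.
  have q0 : q != 0 by apply: contraNneq g0 => q0; move: qg; rewrite q0 dvd0p.
  rewrite -dvdp_size_eqp // eqn_leq dvdp_leq //= gn; apply: nmin; apply/asboolP.
  exists q; split=> //; last exact: dvdp_trans gf.
  by rewrite ltn_neqAle eq_sym q1 size_poly_gt0.
have gsep : coprimep g g^`() by have := k_perfect girr; rewrite unlock.
pose E i := g ^+ i %| f.
have exE : exists i, E i by exists 0%N; rewrite /E expr0 dvd1p.
have sizeE i : E i -> (n.-1 * i <= p)%N.
  by move=> /(dvdp_leq f0); rewrite fsize -add1n -leq_subLR subn1 size_exp gn.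
have boundE i : E i -> (i <= p)%N.
  move=> /sizeE; apply: leq_trans; rewrite -[X in (X <= _)%N]mul1n leq_mul2r.
  by rewrite -ltnS (ltn_predK n1) n1 orbT.
case: (ex_maxnP exE boundE) => i Ei imax.
have i_gt0 : (0 < i)%N by apply: imax; rewrite /E expr1.
have [h fE] := dvdpP _ _ Ei.
have gh : coprimep g h.
  rewrite (irreducible_poly_coprime _ girr); apply/negP => /dvdpP[u hE].
  have : E i.+1 by rewrite /E fE hE -mulrA -exprS dvdp_mull.
  by move=> /imax; rewrite ltnn.
(* Otherwise f' = 0 would make g divide h g', although g is coprime to both factors. *)
have i0 : i%:R = 0 :> k.
  apply/eqP/negPn/negP => i0; have := f'0; rewrite fE derivM deriv_exp => H.
  have {}H : (h^`() * g + (h * g^`()) *+ i) * g ^+ i.-1 = 0.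
    rewrite -[RHS]H mulrDl -mulrA -exprS prednK //; congr (_ + _).
    by rewrite mulrnAl -mulrA mulrnAr.
  have ghg : g %| h * g^`().
    move/eqP: H; rewrite mulf_eq0 expf_eq0 (negPf g0) andbF orbF addrC addr_eq0 => /eqP H.
    rewrite -(dvdpZr _ _ i0) scaler_nat H -mulNr dvdp_mull //.
  have : coprimep g (h * g^`()) by rewrite coprimepMr gh gsep.
  move=> /coprimepP/(_ g (dvdpp g) ghg); rewrite -size_poly_eq1 gn => /eqP n1'.
  by move: n1; rewrite n1'.
have ip : i = p.
  apply/eqP; rewrite eqn_leq boundE //=; apply: dvdn_leq => //.
  by rewrite (dvdn_pcharf pk) i0.
have n2 : size g = 2.
  have := sizeE _ Ei; rewrite ip -[X in (_ <= X)%N]mul1n gn.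
  by rewrite leq_mul2r eqn0Ngt p_gt0 /= => H; apply/eqP; rewrite eqn_leq n1 andbT -(ltn_predK n1).
have [r rg] := poly2_root n2; exists r.
have : root f r by have [q ->] := dvdpP _ _ gf; rewrite rootM rg orbT.
by rewrite /root !hornerE subr_eq0 => /eqP.
Qed.
End PerfectRoot.

(** * Centres of corner algebras *)

Section CornerCenter.
Variables (k : fieldType) (T : falgType k).
Implicit Types (s c d h v y : T).

(** For idempotent h, membership of d in the centre of the corner algebra h T h. *)
Definition corner_center h d : Prop :=
  [/\ h * d = d, d * h = d & forall v, h * v = v -> v * h = v -> d * v = v * d].

(* Martindale's argument: [s x c = c x s] for all [x] makes [c] a central
   multiple of [s]. *)
Lemma corner_center_of_comm s c y : s * y * s = s -> (forall x, s * x * c = c * x * s) ->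
  corner_center (s * y) (c * y * (s * y)).
Proof.
move=> sys sxc; split=> [||v hv vh].
- have -> : s * y * (c * y * (s * y)) = s * y * (c * y * s) * y by rewrite !mulrA.
  by rewrite -sxc !mulrA sys sxc.
- by rewrite -(mulrA (c * y)); congr (_ * _); rewrite mulrA sys.
transitivity (v * c * y).
  rewrite -mulrA hv -{1}vh.
  have -> : c * y * (v * (s * y)) = c * (y * v) * s * y by rewrite !mulrA.
  by rewrite -sxc !mulrA hv.
have -> : v * (c * y * (s * y)) = v * (c * y * s) * y by rewrite !mulrA.
by rewrite -sxc !mulrA -(mulrA v s y) vh.
Qed.

Lemma corner_center0 h : corner_center h 0.
Proof. by split=> [||v _ _]; rewrite ?mulr0 ?mul0r. Qed.

Lemma corner_centerD h d c : corner_center h d -> corner_center h c ->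
  corner_center h (d + c).
Proof.
move=> [hd dh dv] [hc ch cv]; split=> [||v hv vh]; rewrite ?mulrDr ?mulrDl ?hd ?hc ?dh ?ch //.
by rewrite dv // cv.
Qed.

Lemma corner_centerZ h a d : corner_center h d -> corner_center h (a *: d).
Proof.
move=> [hd dh dv]; split=> [||v hv vh]; rewrite -?scalerAr -?scalerAl ?hd ?dh //.
by rewrite dv.
Qed.

Lemma corner_center_comm h d c : corner_center h d -> corner_center h c -> d * c = c * d.
Proof. by move=> [_ _ dv] [hc ch _]; apply: dv. Qed.

Lemma corner_centerX h d n : h * h = h -> corner_center h d -> corner_center h (d ^+ n.+1).
Proof.
move=> hh dc; elim: n => [|n IHn] //.
have [hd dh dv] := dc; have [hx xh xv] := IHn.
rewrite exprS; split=> [||v hv vh]; first by rewrite mulrA hd.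
  by rewrite -mulrA xh.
by rewrite -mulrA xv // mulrA dv // mulrA.
Qed.

(** The centre of a regular ring is reduced: with v = h w h in the corner, d w d = d becomes d = d^2
    v, hence d = d^(m+1) v^m for every m. *)
Lemma corner_center_reduced h d n : regular_ring T -> h * h = h -> corner_center h d ->
  d ^+ n = 0 -> d = 0.
Proof.
move=> Treg hh [hd dh dv] dn; have [w dwd] := Treg d.
pose v := h * w * h.
have hv : h * v = v by rewrite /v !mulrA hh.
have vh : v * h = v by rewrite /v -mulrA hh.
have ddv : d * d * v = d.
  rewrite -mulrA (dv v hv vh) /v !mulrA dh.
  by rewrite -(mulrA (d * w) h d) hd dwd.
have key m : d = d ^+ m.+1 * v ^+ m.
  elim: m => [|m IHm]; first by rewrite expr0 mulr1.
  rewrite {1}IHm [in RHS]exprSr (exprSr d) -!mulrA; congr (_ * _).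
  by rewrite -{1}ddv exprS !mulrA.
by rewrite (key n) exprS dn mulr0 mul0r.
Qed.

End CornerCenter.

(** * Nil ideals in a tensor product of regular algebras *)

Section NilIdeal.
Variables (k : fieldType) (S T : falgType k).
Hypotheses (k_perfect : perfect_field k) (Sreg : regular_ring S) (Treg : regular_ring T).
Variable I : tensor S T -> Prop.
Hypotheses (ID : forall x y, I x -> I y -> I (x + y))
  (Il : forall x y, I y -> I (x * y)) (Ir : forall x y, I x -> I (x * y))
  (Inil : forall x, I x -> exists n, x ^+ n = 0).
Local Notation e := (vbasis {:S}).

Let IB x y : I x -> I y -> I (x - y).
Proof. by move=> Ix Iy; apply: ID => //; rewrite -mulN1r; apply: Il. Qed.

Let mul1tE t (z : tensor S T) i : (tens 1 t * z) i = t * z i.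
Proof.
elim/tens_ind: z => [x y xE yE|a c]; first by rewrite mulrDr !ffunE xE yE mulrDr.
by rewrite tensM mul1r !ffunE scalerAr.
Qed.

Let mult1E t (z : tensor S T) i : (z * tens 1 t) i = z i * t.
Proof.
elim/tens_ind: z => [x y xE yE|a c]; first by rewrite mulrDl !ffunE xE yE mulrDl.
by rewrite tensM mulr1 !ffunE scalerAl.
Qed.

(** The products z (s (x) t) are nilpotent and so have trace 0. Traces multiply on pure tensors, and
    nondegeneracy of the trace form, used over S and then over T, kills the coordinates of z. *)
Lemma nil_ideal_char0 : [pchar k] =i pred0 -> forall z, I z -> z = 0.
Proof.
move=> char0 z Iz.
have trace_tens (a : S) (c : T) : rtrace (tens a c) = rtrace a * rtrace c.
  pose b (ij : 'I_(\dim {:S}) * 'I_(\dim {:T})) := tens e`_ij.1 (vbasis {:T})`_ij.2.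
  pose cf (ij : 'I_(\dim {:S}) * 'I_(\dim {:T})) (w : tensor S T) :=
    coord (vbasis {:T}) ij.2 (w ij.1).
  rewrite (@rtrace_dual _ _ _ b cf).
  - rewrite -(pair_bigA _ (fun i j => cf (i, j) (tens a c * b (i, j)))) /=.
    rewrite /rtrace /mxtrace big_distrlr /=; apply: eq_bigr => i _; apply: eq_bigr => j _.
    by rewrite /cf /b /= tensM !mxE ffunE linearZ.
  - by move=> ij x u v; rewrite /cf !ffunE linearP.
  move=> w; rewrite {1}(tens_basis w).
  rewrite -(pair_bigA _ (fun i j => cf (i, j) w *: b (i, j))) /=; apply: eq_bigr => i _.
  rewrite {1}(coord_vbasis_full (w i)) (additive_sum _ _ _ (tensDr _)).
  by apply: eq_bigr => j _; rewrite tensZr.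
have trz s t : rtrace (z * tens s t) = 0.
  have [n] := Inil (Ir (tens s t) Iz); exact: rtrace_nilpotent.
apply/ffunP => i; rewrite [RHS]ffunE; apply: rtrace_nondegenerate => // t.
pose w := \sum_(j < \dim {:S}) rtrace (z j * t) *: e`_j.
suff w0 : w = 0.
  have := congr1 (coord e i) w0; rewrite linear0 linear_sum (bigD1 i) //= big1.
    by rewrite addr0 linearZ /= coord_free ?(basis_free (vbasisP _)) // eqxx mulr1.
  by move=> j ji; rewrite linearZ /= coord_free ?(basis_free (vbasisP _)) // (negPf ji) mulr0.
apply: rtrace_nondegenerate => // s; rewrite -[RHS](trz s t).
rewrite [z in RHS]tens_basis /w !mulr_suml !(additive_sum _ _ _ (@rtraceD _ _)).
by apply: eq_bigr => j _; rewrite tensM trace_tens -scalerAl rtraceZ mulrC.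
Qed.

Lemma tens_free n (f : 'I_n -> T) (g : 'I_n -> S) :
  (forall a : 'I_n -> k, \sum_j a j *: f j = 0 -> forall j, a j = 0) ->
  \sum_j tens (g j) (f j) = 0 -> forall j, g j = 0.
Proof.
move=> ffree /ffunP gf j; rewrite (coord_vbasis_full (g j)) big1 // => i _.
rewrite (ffree (fun j => coord e i (g j))) ?scale0r //.
transitivity ((\sum_j tens (g j) (f j)) i); last by rewrite gf ffunE.
by rewrite sum_ffunE; apply: eq_bigr => l _; rewrite ffunE.
Qed.

Section PositiveChar.
Variable p : nat.
Hypothesis pk : p \in [pchar k].

Lemma frobenius_sum (R : falgType k) (J : Type) (r : seq J) (F : J -> R) :
  (forall i j, GRing.comm (F i) (F j)) ->
  (\sum_(j <- r) F j) ^+ p = \sum_(j <- r) F j ^+ p.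
Proof.
move=> Fc; have pR : p \in [pchar R] by rewrite (pchar_lalg R).
elim: r => [|j r IHr]; first by rewrite !big_nil -(pFrobenius_autE pR) pFrobenius_aut0.
rewrite !big_cons -IHr -!(pFrobenius_autE pR); apply: pFrobenius_autD_comm.
by apply: commr_sum => l _.
Qed.

(* In a nonzero element of [I] with few nonzero coordinates on a basis of
   [S], Martindale's identity holds between the coordinates. *)
Lemma nil_ideal_corner z0 : I z0 -> z0 <> 0 ->
  exists h z, [/\ h * h = h, I z, z <> 0 & forall i, corner_center h (z i)].
Proof.
move=> Iz0 nz0; pose supp (z : tensor S T) := #|[pred i | z i != 0]|.
pose Q n := `[< exists z, [/\ I z, z <> 0 & supp z = n] >].
have exQ : exists n, Q n by exists (supp z0); apply/asboolP; exists z0.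
case: (ex_minnP exQ) => n /asboolP[z [Iz nz zn]] nmin.
have [i0 zi0] : exists i0, z i0 != 0.
  apply: contrapT => H; apply: nz; apply/ffunP => i; rewrite [RHS]ffunE.
  by apply/eqP/negPn/negP => zi; apply: H; exists i.
have mart y i : z i0 * y * z i = z i * y * z i0.
  pose w := tens 1 (z i0 * y) * z - z * tens 1 (y * z i0).
  have wE j : w j = z i0 * y * z j - z j * y * z i0.
    by rewrite !ffunE mul1tE mult1E mulrA.
  suff w0 : w = 0 by apply/eqP; rewrite -subr_eq0 -wE w0 ffunE.
  apply: contrapT => nw; have /nmin : Q (supp w).
    by apply/asboolP; exists w; split=> //; apply: IB; [apply: Il|apply: Ir].
  rewrite leqNgt -zn => /negP; apply; apply: proper_card; apply/fintype.properP; split.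
    apply/fintype.subsetP => j; rewrite !inE wE; apply: contra => /eqP ->.
    by rewrite mulr0 !mul0r subrr.
  by exists i0; rewrite !inE // wE subrr eqxx.
have [y zyz] := Treg (z i0); pose h := z i0 * y.
have hh : h * h = h by rewrite /h mulrA zyz.
(* Right multiplication by y h moves every coordinate into the centre of h T h and turns the one at
   i0 into h itself, which is nonzero. *)
exists h, (z * tens 1 (y * h)); split=> //; first exact: Ir.
  move=> /ffunP/(_ i0); rewrite mult1E ffunE mulrA -/h hh => h0.
  by move/eqP: zi0; apply; rewrite -zyz -/h h0 mul0r.
move=> i; rewrite mult1E mulrA; exact: corner_center_of_comm.
Qed.

(** Once the coordinates are in the centre of h T h, the same reduction on the S side gives a
    nilpotent w, the sum of c_j (x) f_j, with all c_j central in a corner q S q and one of them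
    equal to q. Powers of exponent p^l act termwise and keep the f_j independent, so the idempotent
    q would be 0. *)
Lemma nil_ideal_pchar z0 : I z0 -> z0 = 0.
Proof.
move=> Iz0; apply: contrapT => nz0.
have [h [z [hh Iz nz zc]]] := nil_ideal_corner Iz0 nz0.
have [Z ZE] : exists Z : {vspace T}, forall x, x \in Z <-> corner_center h x.
  apply: vspace_of_prop => [|x y|a x]; first exact: corner_center0.
    exact: corner_centerD.
  exact: corner_centerZ.
pose m := \dim Z; pose f (j : 'I_m) := (vbasis Z)`_j.
have fc j : corner_center h (f j).
  by apply/ZE; apply: vbasis_mem; apply: mem_nth; rewrite size_tuple.
have Zfree := basis_free (vbasisP Z).
have ffree (a : 'I_m -> k) : \sum_j a j *: f j = 0 -> forall j, a j = 0.
  by move=> af j; have /freeP := Zfree; apply.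
pose el (g : {ffun 'I_m -> S}) : tensor S T := \sum_j tens (g j) (f j).
pose Q n := `[< exists g : {ffun 'I_m -> S}, [/\ I (el g), g <> 0 & #|[pred j | g j != 0]| = n] >].
have exQ : exists n, Q n.
  (* z is expanded again, along a basis of the centre of h T h on the T side instead of a basis of
     S. *)
  pose g : {ffun 'I_m -> S} := [ffun j => \sum_i coord (vbasis Z) j (z i) *: e`_i].
  have gz : el g = z.
    rewrite [RHS]tens_basis /el.
    transitivity (\sum_(j < m) \sum_(i < \dim {:S}) tens e`_i (coord (vbasis Z) j (z i) *: f j)).
      apply: eq_bigr => j _; rewrite ffunE tens_suml; apply: eq_bigr => i _.
      by rewrite tensZl tensZr.
    rewrite exchange_big; apply: eq_bigr => i _.
    rewrite -(additive_sum _ _ _ (tensDr _)); congr tens.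
    by rewrite [RHS](coord_vbasis (U := Z)) //; apply/ZE.
  exists #|[pred j | g j != 0]|; apply/asboolP; exists g; rewrite gz; split=> // g0.
  by apply: nz; rewrite -gz g0 /el big1 // => j _; rewrite ffunE tens0l.
case: (ex_minnP exQ) => n /asboolP[g [Ig ng gn]] nmin.
have [j0 gj0] : exists j0, g j0 != 0.
  apply: contrapT => H; apply: ng; apply/ffunP => i; rewrite [RHS]ffunE.
  by apply/eqP/negPn/negP => zi; apply: H; exists i.
have mart x j : g j0 * x * g j = g j * x * g j0.
  pose w := [ffun j => g j0 * x * g j - g j * x * g j0] : {ffun 'I_m -> S}.
  suff w0 : w = 0 by apply/eqP; rewrite -subr_eq0; move/ffunP/(_ j): w0; rewrite !ffunE => ->.
  apply: contrapT => nw; have /nmin : Q #|[pred j | w j != 0]|.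
    apply/asboolP; exists w; split=> //.
    have -> : el w = tens (g j0 * x) 1 * el g - el g * tens (x * g j0) 1.
      rewrite /el mulr_sumr mulr_suml -sumrB; apply: eq_bigr => l _.
      by rewrite ffunE !tensM mul1r mulr1 (additiveB (tensDl _)) mulrA.
    by apply: IB; [apply: Il|apply: Ir].
  rewrite leqNgt -gn => /negP; apply; apply: proper_card; apply/fintype.properP; split.
    apply/fintype.subsetP => l; rewrite !inE ffunE; apply: contra => /eqP ->.
    by rewrite mulr0 !mul0r subrr.
  by exists j0; rewrite !inE // ffunE subrr eqxx.
have [x gxg] := Sreg (g j0); pose q := g j0 * x.
have qq : q * q = q by rewrite /q mulrA gxg.
have nq : q <> 0 by move=> q0; move/eqP: gj0; apply; rewrite -gxg -/q q0 mul0r.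
(* Multiplication by x q moves the coefficients into the centre of q S q; at j0 the coefficient
   becomes q. *)
pose c j := g j * x * q.
have cc j : corner_center q (c j) by apply: corner_center_of_comm.
pose w := \sum_j tens (c j) (f j).
have Iw : I w.
  have -> : w = el g * tens (x * q) 1.
    by rewrite /el mulr_suml; apply: eq_bigr => j _; rewrite tensM mulr1 mulrA.
  exact: Ir.
have frob l : w ^+ (p ^ l) = \sum_j tens (c j ^+ (p ^ l)) (f j ^+ (p ^ l)).
  elim: l => [|l IHl]; first by rewrite expn0.
  have tX (a : S) (b : T) i : tens a b ^+ i = tens (a ^+ i) (b ^+ i).
    by elim: i => [|i IHi]; rewrite ?expr0 // !exprS IHi tensM.
  rewrite expnSr exprM IHl frobenius_sum => [|i j].
    by apply: eq_bigr => j _; rewrite tX -!exprM.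
  rewrite /GRing.comm !tensM; congr tens; apply: commrX; apply/commr_sym/commrX.
    exact: corner_center_comm.
  exact: corner_center_comm.
have p_gt1 : (1 < p)%N by apply: prime_gt1; case/andP: pk.
have pl l : (0 < p ^ l)%N by rewrite expn_gt0 (ltn_trans _ p_gt1).
(* A vanishing combination of the f_j^(p^(l+1)) is the p-th power of a combination of the f_j^(p^l),
   with p-th roots as coefficients; the latter is 0 because the centre of the corner is reduced. *)
have fpfree l (a : 'I_m -> k) : \sum_j a j *: f j ^+ (p ^ l) = 0 -> forall j, a j = 0.
  elim: l a => [|l IHl] a; first exact: ffree.
  have /choice[b bE] : forall j, exists bj, bj ^+ p = a j.
    by move=> j; apply: perfect_root.
  move=> af; have bf : \sum_j b j *: f j ^+ (p ^ l) = 0.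
    apply: (corner_center_reduced (h := h) (n := p) Treg hh).
      elim/big_ind: _ => [|u v|j _]; first exact: corner_center0.
        exact: corner_centerD.
      by apply: corner_centerZ; rewrite -(prednK (pl l)); apply: corner_centerX.
    rewrite frobenius_sum => [|i j].
      by rewrite -[RHS]af; apply: eq_bigr => j _; rewrite exprZn bE -exprM -expnSr.
    rewrite /GRing.comm -!scalerAl -!scalerAr [LHS]scalerA [RHS]scalerA mulrC; congr (_ *: _).
    by apply: commrX; apply/commr_sym/commrX; apply: corner_center_comm.
  by move=> j; rewrite -bE (IHl b bf) expr0n gtn_eqF // (ltn_trans _ p_gt1).
have [N wN] := Inil Iw.
have : w ^+ (p ^ N) = 0.
  by rewrite -(subnK (ltnW (ltn_expl N p_gt1))) exprD wN mulr0.
rewrite frob => /(tens_free (fpfree N))/(_ j0).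
have cq : c j0 = q by rewrite /c -/q qq.
rewrite cq -(prednK (pl N)).
have -> i : q ^+ i.+1 = q by elim: i => // i IHi; rewrite exprS IHi.
exact: nq.
Qed.

End PositiveChar.

Lemma nil_ideal_eq0 z : I z -> z = 0.
Proof.
have [char0|nchar] := pselect ([pchar k] =i pred0); first exact: nil_ideal_char0.
have [p pk] : exists p, p \in [pchar k].
  apply: contrapT => H; apply: nchar => p; rewrite inE; apply/negP => pk.
  by apply: H; exists p.
exact: (nil_ideal_pchar pk).
Qed.

End NilIdeal.

(** * The radical of a tensor product *)

(* The semisimple algebra [B / J(B)], carried by a complement of [J(B)] in [B]. *)
Definition ssq (k : fieldType) (A : falgType k) (B : {vspace A})
  (Bsub : unital_subalgebra B) : Type := subvs_of (B :\: jacobson B).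

HB.instance Definition _ (k : fieldType) (A : falgType k) (B : {vspace A})
  (Bsub : unital_subalgebra B) :=
  Vector.copy (ssq Bsub) (subvs_of (B :\: jacobson B)).

Section SemisimpleQuotient.
Variables (k : fieldType) (A : falgType k) (B : {vspace A}) (Bsub : unital_subalgebra B).
Local Notation J := (jacobson B).
Local Notation S := (ssq Bsub).

Let B1 : 1 \in B. Proof. by have /andP[] := Bsub. Qed.
Let BM b c : b \in B -> c \in B -> b * c \in B.
Proof. by have /andP[_ /prodvP] := Bsub; apply. Qed.
Let BJ b x : b \in B -> x \in J -> b * x \in J.
Proof. by have /left_idealP[_] := jacobson_left Bsub; apply. Qed.

(** Projection along J(B) onto the chosen complement. It is a map on all of A but is meant for
    elements of B, where it is multiplicative. *)
Definition ssq_pi (x : A) : S := vsproj (B :\: J) (addv_pi1 B J x).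
Definition ssq_in (s : S) : A := vsval (s : subvs_of (B :\: J)).

Lemma ssq_pi_linear : linear ssq_pi.
Proof. by move=> a x y; rewrite /ssq_pi !linearP. Qed.
Lemma ssq_piD : {morph ssq_pi : x y / x + y}.
Proof. by move=> x y; have := ssq_pi_linear 1 x y; rewrite !scale1r. Qed.
Lemma ssq_piZ a x : ssq_pi (a *: x) = a *: ssq_pi x.
Proof. by have := ssq_pi_linear a x 0; rewrite (additive0 ssq_piD) !addr0. Qed.
Lemma ssq_inD : {morph ssq_in : x y / x + y}. Proof. by []. Qed.
Lemma ssq_inZ a x : ssq_in (a *: x) = a *: ssq_in x. Proof. by []. Qed.

Lemma ssq_inK : cancel ssq_in ssq_pi.
Proof.
move=> s; rewrite /ssq_pi /addv_pi1 daddv_pi_id ?capv_diff ?subvsP //; exact: vsvalK.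
Qed.

Lemma ssq_in_mem s : ssq_in s \in B.
Proof. exact: (subvP (diffvSl _ _) _ (subvsP _)). Qed.

Lemma ssq_pi_rad x : x \in B -> x - ssq_in (ssq_pi x) \in J.
Proof.
move=> xB; have xBJ : x \in (B + J)%VS by apply: (subvP (addvSl _ _)).
rewrite /ssq_in /ssq_pi vsprojK; last exact: memv_pi.
have -> : x - addv_pi1 B J x = addv_pi2 B J x.
  by apply/eqP; rewrite subr_eq addrC eq_sym addv_pi1_pi2.
exact: memv_pi2.
Qed.

Lemma ssq_pi_eq0 x : x \in J -> ssq_pi x = 0.
Proof.
move=> xJ; have xBJ : x \in (B + J)%VS by apply: (subvP (addvSr _ _)).
rewrite /ssq_pi; have := addv_pi1_pi2 xBJ; rewrite addv_pi2_id //.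
by rewrite -[X in _ = X -> _]add0r => /addIr ->; rewrite linear0.
Qed.

Definition ssq_mul (s t : S) : S := ssq_pi (ssq_in s * ssq_in t).

Lemma ssq_piM x y : x \in B -> y \in B -> ssq_mul (ssq_pi x) (ssq_pi y) = ssq_pi (x * y).
Proof.
move=> xB yB; apply/eqP; rewrite eq_sym -subr_eq0 -(additiveB ssq_piD); apply/eqP.
apply: ssq_pi_eq0; set x' := ssq_in _; set y' := ssq_in _.
have -> : x * y - x' * y' = (x - x') * y + x' * (y - y').
  by rewrite mulrBl mulrBr subrKA.
by rewrite rpredD //; [apply: (jacobson_right Bsub)|apply: BJ]; rewrite ?ssq_pi_rad ?ssq_in_mem.
Qed.

Lemma ssq_mulA : associative ssq_mul.
Proof.
move=> x y z; rewrite -(ssq_inK x) -(ssq_inK y) -(ssq_inK z).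
by rewrite !ssq_piM ?BM ?ssq_in_mem // mulrA.
Qed.
Lemma ssq_mul1 : left_id (ssq_pi 1) ssq_mul.
Proof. by move=> x; rewrite -(ssq_inK x) ssq_piM ?ssq_in_mem // mul1r. Qed.
Lemma ssq_mulr1 : right_id (ssq_pi 1) ssq_mul.
Proof. by move=> x; rewrite -(ssq_inK x) ssq_piM ?ssq_in_mem // mulr1. Qed.
Lemma ssq_mulDl : left_distributive ssq_mul +%R.
Proof. by move=> x y z; rewrite /ssq_mul ssq_inD mulrDl ssq_piD. Qed.
Lemma ssq_mulDr : right_distributive ssq_mul +%R.
Proof. by move=> x y z; rewrite /ssq_mul ssq_inD mulrDr ssq_piD. Qed.
Lemma ssq_mulZl a x y : ssq_mul (a *: x) y = a *: ssq_mul x y.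
Proof. by rewrite /ssq_mul ssq_inZ -scalerAl ssq_piZ. Qed.
Lemma ssq_mulZr a x y : ssq_mul x (a *: y) = a *: ssq_mul x y.
Proof. by rewrite /ssq_mul ssq_inZ -scalerAr ssq_piZ. Qed.

Lemma jacobson1 : 1 \notin J.
Proof.
apply/negP => J1; have [n Jn] := jacobson_nilpotent Bsub.
suff : 1 \in (J ^+ n.+1)%VS by rewrite Jn memv0 oner_eq0.
elim: {Jn} n => [|n IHn]; first by rewrite expv1.
by rewrite expvSl -[1]mulr1 memv_mul.
Qed.

Lemma ssq_1neq0 : ssq_pi 1 != 0.
Proof.
apply: contra jacobson1 => /eqP p1.
by have := ssq_pi_rad B1; rewrite p1 (additive0 ssq_inD) subr0.
Qed.

HB.instance Definition _ := GRing.Zmodule_isNzRing.Build S ssq_mulA ssq_mul1 ssq_mulr1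
  ssq_mulDl ssq_mulDr ssq_1neq0.
HB.instance Definition _ := GRing.Lmodule_isLalgebra.Build k S
  (fun a x y => esym (ssq_mulZl a x y)).
HB.instance Definition _ := GRing.Lalgebra_isAlgebra.Build k S
  (fun a x y => esym (ssq_mulZr a x y)).
HB.instance Definition _ := Algebra_isFalgebra.Build k S.

Lemma ssq_pi_mul x y : x \in B -> y \in B -> ssq_pi (x * y) = ssq_pi x * ssq_pi y.
Proof. by move=> xB yB; rewrite -ssq_piM. Qed.

Lemma ssq_regular : regular_ring S.
Proof.
move=> s; have [x xB] := regular_mod_jacobson Bsub (ssq_in_mem s).
move=> /ssq_pi_eq0; rewrite (additiveB ssq_piD) ssq_inK => /eqP.
rewrite subr_eq0 => /eqP sE; exists (ssq_pi x).
by rewrite [RHS]sE !ssq_pi_mul ?BM ?ssq_in_mem // ssq_inK.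
Qed.

End SemisimpleQuotient.

Lemma prodv_ind (k : fieldType) (A : falgType k) (U V : {vspace A}) (P : A -> Prop) :
  P 0 -> (forall x y, P x -> P y -> P (x + y)) -> (forall c x, P x -> P (c *: x)) ->
  (forall u v, u \in U -> v \in V -> P (u * v)) -> forall x, x \in (U * V)%VS -> P x.
Proof.
move=> P0 PD PZ PM; have [W WE] := vspace_of_prop P0 PD PZ.
suff UVW : (U * V <= W)%VS by move=> x /(subvP UVW)/WE.
by apply/prodvP => u v uU vV; apply/WE/PM.
Qed.

Section RadicalTensor.
Variables (k : fieldType) (A C : falgType k) (B : {vspace A}) (D : {vspace C}).
Hypotheses (Bsub : unital_subalgebra B) (Dsub : unital_subalgebra D).
Local Notation JB := (jacobson B).
Local Notation JD := (jacobson D).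
Local Notation R := (tensor A C).
Local Notation BD := (tensor_sub B D).

Let B1 : 1 \in B. Proof. by have /andP[] := Bsub. Qed.
Let D1 : 1 \in D. Proof. by have /andP[] := Dsub. Qed.

Lemma tensor_sub_mul (B' B'' B3 : {vspace A}) (D' D'' D3 : {vspace C}) :
  (B' * B'' <= B3)%VS -> (D' * D'' <= D3)%VS ->
  (tensor_sub B' D' * tensor_sub B'' D'' <= tensor_sub B3 D3)%VS.
Proof.
move=> /prodvP HB /prodvP HD; apply/prodvP => u v + vE; move: u.
apply: tensor_sub_ind => [|x y xS yS|b d bB dD].
- by rewrite mul0r mem0v.
- by rewrite mulrDl rpredD.
move: v vE; apply: tensor_sub_ind => [|x y xS yS|b' d' bB' dD'].
- by rewrite mulr0 mem0v.
- by rewrite mulrDr rpredD.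
by rewrite tensM; apply: tens_mem; [apply: HB|apply: HD].
Qed.

Lemma tensor_sub_unital : unital_subalgebra BD.
Proof.
have /andP[_ BB] := Bsub; have /andP[_ DD] := Dsub.
by apply/andP; split; [apply: tensor_sub1|apply: tensor_sub_mul].
Qed.
Let BDsub := tensor_sub_unital.

Lemma tensor_subS (B' B'' : {vspace A}) (D' D'' : {vspace C}) :
  (B' <= B'')%VS -> (D' <= D'')%VS -> (tensor_sub B' D' <= tensor_sub B'' D'')%VS.
Proof.
move=> /subvP HB /subvP HD; apply/subvP; apply: tensor_sub_ind => [|x y xS yS|b d bB dD].
- by rewrite mem0v.
- by rewrite rpredD.
by apply: tens_mem; [apply: HB|apply: HD].
Qed.

(** J(B) (x) D is a left ideal, nilpotent since its powers lie in J(B)^m (x) D. *)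
Lemma jacobson_tensor_l : (tensor_sub JB D <= jacobson BD)%VS.
Proof.
have [n Jn] := jacobson_nilpotent Bsub; have /andP[JBv BJv] := jacobson_left Bsub.
have /andP[_ DD] := Dsub.
apply: (nilpotent_sub_jacobson (n := n.+1) BDsub).
  apply/andP; split; first exact: tensor_subS.
  exact: tensor_sub_mul.
have step m : (tensor_sub JB D ^+ m.+1 <= tensor_sub (JB ^+ m.+1) D)%VS.
  elim: m => [|m IHm]; first by rewrite !expv1.
  rewrite expvSl (expvSl JB); apply: subv_trans (prodvSr _ IHm) _.
  exact: tensor_sub_mul.
apply/eqP; rewrite -subv0; apply: subv_trans (step n) _; rewrite Jn.
apply/subvP; apply: tensor_sub_ind => [|x y xS yS|b d bB dD].
- by rewrite mem0v.
- by rewrite rpredD.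
by move: bB; rewrite memv0 => /eqP ->; rewrite tens0l mem0v.
Qed.

Lemma jacobson_tensor_r : (tensor_sub B JD <= jacobson BD)%VS.
Proof.
have [n Jn] := jacobson_nilpotent Dsub; have /andP[JDv DJv] := jacobson_left Dsub.
have /andP[_ BB] := Bsub.
apply: (nilpotent_sub_jacobson (n := n.+1) BDsub).
  apply/andP; split; first exact: tensor_subS.
  exact: tensor_sub_mul.
have step m : (tensor_sub B JD ^+ m.+1 <= tensor_sub B (JD ^+ m.+1))%VS.
  elim: m => [|m IHm]; first by rewrite !expv1.
  rewrite expvSl (expvSl JD); apply: subv_trans (prodvSr _ IHm) _.
  exact: tensor_sub_mul.
apply/eqP; rewrite -subv0; apply: subv_trans (step n) _; rewrite Jn.
apply/subvP; apply: tensor_sub_ind => [|x y xS yS|b d bB dD].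
- by rewrite mem0v.
- by rewrite rpredD.
move: dD; rewrite memv0 => /eqP ->; rewrite (additive0 (tensDr _)) mem0v //.
Qed.

Hypothesis k_perfect : perfect_field k.

(** The image of J(B (x) D) in B/J(B) (x) D/J(D) is a nil two-sided ideal in a tensor product of
    regular algebras, so [nil_ideal_eq0] makes it vanish; perfectness of k enters there. *)
Lemma jacobson_tensor : (jacobson BD <= tensor_sub JB D + tensor_sub B JD)%VS.
Proof.
apply/subvP => z zJ; pose S := ssq Bsub; pose T := ssq Dsub.
pose pB : A -> S := @ssq_pi _ _ _ Bsub; pose pD : C -> T := @ssq_pi _ _ _ Dsub.
pose f (a : A) (c : C) : tensor S T := tens (pB a) (pD c).
have fDl c : {morph f^~ c : x y / x + y} by move=> x y; rewrite /f /pB ssq_piD tensDl.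
have fDr a : {morph f a : x y / x + y} by move=> x y; rewrite /f /pD ssq_piD tensDr.
have fB (x : k) a c : f (x *: a) c = f a (x *: c).
  by rewrite /f /pB /pD !ssq_piZ tensZl tensZr.
pose P (w : R) : tensor S T := tlift f w.
have PD : {morph P : x y / x + y} := tliftD fDr.
have PE a c : P (tens a c) = f a c := tliftE fDl fB a c.
have P0 := additive0 PD.
have PM x y : x \in BD -> y \in BD -> P (x * y) = P x * P y.
  move=> + yBD; move: x; apply: tensor_sub_ind => [|u v uE vE|b d bB dD].
  - by rewrite mul0r P0 mul0r.
  - by rewrite mulrDl !PD mulrDl uE vE.
  move: y yBD; apply: tensor_sub_ind => [|u v uE vE|b' d' bB' dD'].
  - by rewrite mulr0 P0 mulr0.
  - by rewrite mulrDr !PD mulrDr uE vE.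
  by rewrite tensM !PE /f /pB /pD !ssq_pi_mul // tensM.
have Psurj w : exists2 x, x \in BD & P x = w.
  elim/tens_ind: w => [u v [x xB xE] [y yB yE]|s t].
    by exists (x + y); rewrite ?rpredD // PD xE yE.
  exists (tens (ssq_in s) (ssq_in t)); first by apply: tens_mem; apply: ssq_in_mem.
  by rewrite PE /f /pB /pD !ssq_inK.
have /left_idealP[JBD BDJ] := jacobson_left BDsub.
have Pz0 : P z = 0.
  apply: (@nil_ideal_eq0 k S T k_perfect (@ssq_regular _ _ _ Bsub) (@ssq_regular _ _ _ Dsub)
    (fun w => exists2 x, x \in jacobson BD & P x = w)).
  - by move=> _ _ [x xJ <-] [y yJ <-]; exists (x + y); rewrite ?rpredD.
  - move=> w _ [y yJ <-]; have [x xB <-] := Psurj w.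
    by exists (x * y); rewrite ?PM ?BDJ // JBD.
  - move=> _ w [y yJ <-]; have [x xB <-] := Psurj w.
    by exists (y * x); rewrite ?PM ?(jacobson_right BDsub) // JBD.
  - move=> _ [x xJ <-]; have [n Jn] := jacobson_nilpotent BDsub; exists n.+1.
    have PX m : P (x ^+ m.+1) = P x ^+ m.+1 /\ x ^+ m.+1 \in (jacobson BD ^+ m.+1)%VS /\ x ^+ m.+1 \in BD.
      elim: m => [|m [IH1 [IH2 IH3]]]; first by rewrite expv1 expr1; split=> //; split=> //; apply: JBD.
      rewrite exprS PM ?IH1 -?exprS //; last exact: JBD.
      split=> //; rewrite exprS expvSl memv_mul //; split=> //.
      by have /andP[_ /prodvP] := BDsub; apply=> //; apply: JBD.
    have [<- [xn _]] := PX n; move: xn; rewrite Jn memv0 => /eqP ->; exact: P0.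
  by exists z.
(* G is the linear section of P given by the complements. On B (x) D the difference x - G (P x) lies
   in the sum of the two ideals, which bounds the kernel of P there. *)
pose g (s : S) (t : T) : R := tens (@ssq_in _ _ _ Bsub s) (@ssq_in _ _ _ Dsub t).
pose G (w : tensor S T) : R := tlift g w.
have gDl t : {morph g^~ t : x y / x + y} by move=> x y; rewrite /g ssq_inD tensDl.
have gDr s : {morph g s : x y / x + y} by move=> x y; rewrite /g ssq_inD tensDr.
have gB (x : k) s t : g (x *: s) t = g s (x *: t) by rewrite /g !ssq_inZ tensZl tensZr.
have GD : {morph G : x y / x + y} := tliftD gDr.
have GE s t : G (tens s t) = g s t := tliftE gDl gB s t.
have key x : x \in BD -> x - G (P x) \in (tensor_sub JB D + tensor_sub B JD)%VS.
  move: x; apply: tensor_sub_ind => [|u v uE vE|b d bB dD].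
  - by rewrite P0 (additive0 GD) subr0 mem0v.
  - by rewrite PD GD opprD addrACA rpredD.
  rewrite PE GE /g; set b' := ssq_in _; set d' := ssq_in _.
  have -> : tens b d - tens b' d' = tens (b - b') d + tens b' (d - d').
    by rewrite (additiveB (tensDl _)) (additiveB (tensDr _)) subrKA.
  apply: memv_add; apply: tens_mem => //; rewrite ?ssq_in_mem //; exact: ssq_pi_rad.
by have := key z (JBD z zJ); rewrite Pz0 (additive0 GD) subr0.
Qed.

(** Only multiplication on the right matters. [jacobson_tensor] reduces it to generators such as (j
    (x) d)(a (x) c) = j a (x) d c, where j a lies in A J(B) by hypothesis. *)
Lemma two_sided_tensor : two_sided_ideal ({:A} * JB)%VS ->
  two_sided_ideal ({:C} * JD)%VS -> two_sided_ideal ({:R} * jacobson BD)%VS.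
Proof.
move=> /andP[_ HA] /andP[_ HC]; apply/andP; split; first by rewrite prodvA prodvSl ?subvf.
have leftR r x : x \in ({:R} * jacobson BD)%VS -> r * x \in ({:R} * jacobson BD)%VS.
  move=> xJ; have : r * x \in ({:R} * ({:R} * jacobson BD))%VS by rewrite memv_mul ?memvf.
  by apply: subvP; rewrite prodvA prodvSl ?subvf.
have lA c y : y \in ({:A} * JB)%VS -> tens y c \in ({:R} * jacobson BD)%VS.
  move: y; apply: prodv_ind => [|x y xE yE|a x xE|a j _ jJ].
  - by rewrite tens0l mem0v.
  - by rewrite tensDl rpredD.
  - by rewrite tensZl rpredZ.
  rewrite -[c]mulr1 -tensM memv_mul ?memvf //.
  by apply: (subvP jacobson_tensor_l); apply: tens_mem.
have lC a y : y \in ({:C} * JD)%VS -> tens a y \in ({:R} * jacobson BD)%VS.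
  move: y; apply: prodv_ind => [|x y xE yE|x y xE|c j _ jJ].
  - by rewrite (additive0 (tensDr _)) mem0v.
  - by rewrite tensDr rpredD.
  - by rewrite tensZr rpredZ.
  rewrite -[a]mulr1 -tensM memv_mul ?memvf //.
  by apply: (subvP jacobson_tensor_r); apply: tens_mem.
have rJ x r : x \in jacobson BD -> x * r \in ({:R} * jacobson BD)%VS.
  move=> /(subvP jacobson_tensor) /memv_addP[u uJ [v vJ ->]]; rewrite mulrDl rpredD //.
    move: u uJ; apply: tensor_sub_ind => [|x' y xE yE|j d jJ dD].
    - by rewrite mul0r mem0v.
    - by rewrite mulrDl rpredD.
    elim/tens_ind: r => [r r' rE r'E|a c]; first by rewrite mulrDr rpredD.
    rewrite tensM; apply: lA; apply: (subvP HA); rewrite memv_mul ?memvf //.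
    by rewrite -[j]mul1r memv_mul ?memvf.
  move: v vJ; apply: tensor_sub_ind => [|x' y xE yE|b j bB jJ].
  - by rewrite mul0r mem0v.
  - by rewrite mulrDl rpredD.
  elim/tens_ind: r => [r r' rE r'E|a c]; first by rewrite mulrDr rpredD.
  rewrite tensM; apply: lC; apply: (subvP HC); rewrite memv_mul ?memvf //.
  by rewrite -[j]mul1r memv_mul ?memvf.
apply/prodvP => x r + _; move: x; apply: prodv_ind => [|x y xE yE|a x xE|s x _ xJ].
- by rewrite mul0r mem0v.
- by rewrite mulrDl rpredD.
- by rewrite -scalerAl rpredZ.
by rewrite -mulrA; apply/leftR/rJ.
Qed.

End RadicalTensor.

(** * Absolute and relative dimension *)

Section QuotientMorphism.
Variables (k : fieldType) (A : falgType k) (X : {vspace A}).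

Lemma qproj_zmod : zmod_morphism (@qproj k A X).
Proof. exact: (additiveB (@qprojD k A X)). Qed.
Lemma qproj_monoid : monoid_morphism (@qproj k A X).
Proof. by split=> // a b; rewrite -[LHS]qprojM. Qed.
HB.instance Definition _ := GRing.isZmodMorphism.Build A (quot_alg X) (@qproj k A X)
  qproj_zmod.
HB.instance Definition _ := GRing.isMonoidMorphism.Build A (quot_alg X) (@qproj k A X)
  qproj_monoid.

Lemma qproj_eq0 a : a \in ideal_of X -> qproj X a = 0.
Proof. by move=> aI; rewrite -(rmorph0 (@qproj k A X)); apply/qproj_eq; rewrite subr0. Qed.

Lemma mem_ideal_of a : a \in X -> a \in ideal_of X.
Proof. by move=> aX; rewrite -[a]mul1r -[1 * a]mulr1 !memv_mul ?memvf. Qed.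

Definition killed (N : lmodType A) : Prop :=
  forall a (x : N), a \in ideal_of X -> a *: x = 0.

Definition resq (M : lmodType (quot_alg X)) : lmodType A := resmod (@qproj k A X) M.

Lemma resqE (M : lmodType (quot_alg X)) a (x : resq M) : a *: x = qproj X a *: (x : M).
Proof. by []. Qed.

Lemma resq_killed M : killed (resq M).
Proof. by move=> a x aI; rewrite resqE qproj_eq0 // scale0r. Qed.

(** N itself, with the quotient acting through chosen representatives. Restricted back to A, the
    action agrees with that of N only propositionally, so the identity maps both ways are recorded
    as A-linear. *)
Definition qmod (N : lmodType A) (Nk : killed N) : Type := N.

Section QMod.
Variables (N : lmodType A) (Nk : killed N).
HB.instance Definition _ := GRing.Zmodule.on (qmod Nk).
Definition qact (q : quot_alg X) (x : qmod Nk) : qmod Nk := qrepr q *: (x : N).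

Lemma qact_proj a x : qact (qproj X a) x = (a *: (x : N)).
Proof.
apply/eqP; rewrite -subr_eq0 -scalerBl; apply/eqP/Nk.
exact: (qproj_eq _ _ _).1 (qreprK _).
Qed.
Lemma qactA p q x : qact p (qact q x) = qact (p * q) x.
Proof.
by rewrite -(qreprK p) -(qreprK q) -rmorphM !qact_proj scalerA.
Qed.
Lemma qact1 : left_id 1 qact.
Proof. by move=> x; rewrite -(rmorph1 (@qproj k A X)) qact_proj scale1r. Qed.
Lemma qactDr : right_distributive qact +%R.
Proof. by move=> q x y; rewrite /qact scalerDr. Qed.
Lemma qactDl x : {morph qact^~ x : p q / p + q}.
Proof.
by move=> p q; rewrite -(qreprK p) -(qreprK q) -rmorphD !qact_proj scalerDl.
Qed.
HB.instance Definition _ := GRing.Zmodule_isLmodule.Build (quot_alg X) (qmod Nk)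
  qactA qact1 qactDr qactDl.

Lemma resq_qmod_lo : linear_over {:A} ((fun x => x) : N -> resq (qmod Nk)).
Proof. by split=> // a x _; rewrite resqE [RHS]qact_proj. Qed.
Lemma qmod_resq_lo : linear_over {:A} ((fun x => x) : resq (qmod Nk) -> N).
Proof. by split=> // a x _; rewrite resqE [LHS]qact_proj. Qed.
End QMod.

Lemma lo_resq_linear U (M N : lmodType (quot_alg X)) (f : {linear M -> N}) :
  linear_over U (f : resq M -> resq N).
Proof. by split=> [x y|a x _]; [apply: linearD|rewrite !resqE; apply: linearZ]. Qed.

Lemma resq_bundle (M N : lmodType (quot_alg X)) (h : M -> N) :
  linear_over {:A} (h : resq M -> resq N) ->
  exists g : {linear M -> N}, forall x, g x = h x.
Proof.
move=> [hD hZ]; have hD' : {morph h : x y / x + y} := hD.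
have hZ' q x : h (q *: x) = q *: h x.
  by rewrite -(qreprK q); apply: (hZ (qrepr q) x (memvf _)).
by exists (lin_of hD' hZ').
Qed.

Lemma resq_fd (M : lmodType (quot_alg X)) : fin_gen M <-> fd (resq M).
Proof.
rewrite fd_fin_gen; split=> [[n [g gM]]|[n [g gM]]]; exists n, g => x.
  have [c ->] := gM x; exists (fun i => qrepr (c i)); apply: eq_bigr => i _.
  by rewrite resqE qreprK.
by have [c ->] := gM x; exists (fun i => qproj X (c i)).
Qed.

End QuotientMorphism.

Section AbsoluteDimension.
Variables (k : fieldType) (A : falgType k) (B : {vspace A}).
Hypotheses (Bsub : unital_subalgebra B).
Local Notation J := (jacobson B).
Hypothesis AJ : two_sided_ideal ({:A} * J)%VS.
Local Notation Q := (quot_alg J).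
Implicit Types (M N : lmodType Q).

Let B1 : 1 \in B. Proof. by have /andP[] := Bsub. Qed.

(** Two-sidedness lets an element of the ideal absorb the b of b (x) m while staying in A J(B); then
    (a j) (x) m = a (x) j m = 0. *)
Lemma ind_killed (M : lmodType A) : (forall j (m : M), j \in J -> j *: m = 0) ->
  killed J (ind B M).
Proof.
move=> JM a x; elim/ind_ind: x => [x y xE yE aI|b m aI].
  by rewrite scalerDr xE ?yE ?addr0.
rewrite itensZ; have : a * b \in ({:A} * J)%VS.
  by have /andP[_ H] := AJ; apply: (subvP H); apply: ideal_of_mulr.
move: (a * b) => c cJ; move: c cJ m => c cJ.
apply: (prodv_ind (P := fun c => forall m : M, itens B c m = 0) _ _ _ _ cJ).
- by move=> m; apply: (additive0 (@itensDl _ _ B M m)).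
- by move=> u v uE vE m; rewrite itensDl uE vE addr0.
- by move=> t u uE m; rewrite itens_scale uE.
move=> u j _ jJ m; rewrite itens_bal ?JM //; last first.
  by have /andP[H _] := jacobson_left Bsub; apply: (subvP H).
exact: (additive0 (itensDr B _)).
Qed.

Lemma resq_jacobson M j (m : resq M) : j \in J -> j *: m = 0.
Proof. by move=> jJ; apply/resq_killed/mem_ideal_of. Qed.

Definition qind M : lmodType Q := qmod (ind_killed (@resq_jacobson M)).

Lemma relproj_qind M : relproj B (resq (qind M)).
Proof.
have to := resq_qmod_lo (ind_killed (@resq_jacobson M)).
have from := qmod_resq_lo (ind_killed (@resq_jacobson M)).
exact: (relproj_retract B1 from to (fun _ => erefl) (relproj_ind B1 (resq M))).
Qed.

(** [semisimple_lift] lifts f through p over B, and the section of A (x)_B M -> M turns the B-linear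
    lift into an A-linear one. *)
Lemma relproj_projective M : fd (resq M) -> relproj B (resq M) -> projective M.
Proof.
move=> Mfd [s [sA sE]] N' N p f pS.
have [g gB pg] : exists2 g : resq M -> resq N', linear_over B g & forall m, p (g m) = f m.
  apply: (semisimple_lift Bsub (f := f : resq M -> resq N) (p := p : resq N' -> resq N)) => //.
  - by move=> j m; apply: resq_jacobson.
  - by move=> j m; apply: resq_jacobson.
  - exact: lo_resq_linear.
  - exact: lo_resq_linear.
have fA := lo_resq_linear {:A} f; have pA := lo_resq_linear {:A} p.
pose h (x : resq M) : resq N' := ind_mul (imap (B := B) g (s x)).
have hA : linear_over {:A} h := lo_comp (lo_imul _ _ _) (lo_comp (lo_imap B1 gB) sA).
have [h' h'E] := resq_bundle hA; exists h' => x; rewrite h'E /h -[in RHS](sE x).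
move: (s x); apply: ind_eq => [||a m].
- exact: (lo_D (lo_comp pA (lo_comp (lo_imul B _ _) (lo_imap B1 gB)))).
- exact: (lo_D (lo_comp fA (lo_imul B _ _))).
by rewrite imapE // !ind_mulE (lo_Z _ pA) ?memvf // (lo_Z _ fA) ?memvf // pg.
Qed.

Definition qmul M (x : qind M) : M := ind_mul (x : ind B (resq M)).
Lemma lo_qmul M : linear_over {:A} (@qmul M : resq (qind M) -> resq M).
Proof. exact: (lo_comp (lo_imul B {:A} (resq M)) (qmod_resq_lo _)). Qed.

Lemma qmul_section M : @split_ses _ _ B (omega B (resq M)) (resq (qind M)) (resq M)
  (@kerin _ _ _ (imul B (resq M))) (@qmul M : resq (qind M) -> resq M)
  (itens B 1 : resq M -> resq (qind M)) (@orho _ _ B (resq M)).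
Proof.
have [[iA pA sB rB] eqs] := ses_omega_split B (resq M).
have to := resq_qmod_lo (ind_killed (@resq_jacobson M)).
have from := qmod_resq_lo (ind_killed (@resq_jacobson M)).
split; last by [].
split; [exact: (lo_comp to iA)|exact: lo_qmul| |].
  exact: (lo_comp (lo_full B to) sB).
exact: (lo_comp rB (lo_full B from)).
Qed.

(** The surjection [qind M] -> M splits, and [qind M] is an induced module. *)
Lemma projective_relproj M : projective M -> relproj B (resq M).
Proof.
move=> Mp; have [p pE] := resq_bundle (lo_qmul M).
have [|s sE] := Mp _ _ p (idfun : {linear M -> M}).
  by move=> m; exists (itens B 1 (m : resq M) : qind M); rewrite pE /qmul ind_mulE scale1r.
apply: (relproj_retract B1 (lo_resq_linear {:A} s) (lo_qmul M) _ (relproj_qind M)) => m.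
by rewrite -pE sE.
Qed.

Definition has_res l M := exists (P : nat -> lmodType Q)
  (d : forall n, {linear augment M P n.+1 -> augment M P n}),
  [/\ forall n, fin_gen (P n), forall n, projective (P n),
      exact_complex d & vanishes_above P l].

Lemma projective_zeromod M : projective (zeromod M).
Proof.
move=> N' N p f _; exists (zero_lin _ _) => x.
by rewrite (zeromod0 x) !linear0.
Qed.

Lemma has_res0 M : fin_gen M -> projective M -> has_res 0 M.
Proof.
move=> Mfg Mp.
exists (splice M (fun=> zeromod M)),
  (splice_d (zero_lin (zeromod M) M) (idfun : {linear M -> M}) (zero_d M)).
split.
- by case=> [|n] //; apply: zeromod_fin_gen.
- by case=> [|n] //; apply: projective_zeromod.
- apply: splice_exact => //; last exact: zero_exact.
  + by move=> x y _; rewrite (zeromod0 x) (zeromod0 y).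
  + by move=> x /= ->; exists 0.
  by move=> x; exists x.
by case=> [|n] // _ x; apply: zeromod0.
Qed.

(** The resolution is built from induced modules [qind], which are relatively projective and also
    projective over the quotient. *)
Lemma rpd_has_res l M : fd (resq M) -> rpd B l (resq M) -> has_res l M.
Proof.
elim: l M => [|l IHl] M Mfd.
  by move=> Mp; apply: has_res0; [apply/resq_fd|apply: relproj_projective].
have [p pE] := resq_bundle (lo_qmul M).
have pS m : exists x, p x = m.
  by exists (itens B 1 (m : resq M) : qind M); rewrite pE /qmul ind_mulE scale1r.
have Pfd : fd (resq (qind M)).
  apply: (fd_surj (f := (fun z => z) : ind B (resq M) -> resq (qind M)) _ _ _
    (fd_ind B Mfd)) => [//|c x|y]; last by exists y.
  exact: (lo_Z x (resq_qmod_lo (ind_killed (@resq_jacobson M))) (memvf _)).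
have [[_ _ sB _] [ps _ _]] := qmul_section M.
pose K := kermod p.
have sesK : ses B (resq K) (resq (qind M)) (resq M).
  have rP x : p (x - (itens B 1 (qmul x : resq M) : qind M)) = 0.
    by rewrite linearB /= !pE ps subrr.
  have H := lo_subr (lo_id B (resq (qind M))) (lo_comp sB (lo_full B (lo_qmul M))).
  exists (@kerin _ _ _ p), (@qmul M), (itens B 1), (fun x => kermk (rP x)).
  split; split=> //.
  - exact: lo_qmul.
  - split=> [x y|b x bB]; apply: kerin_inj; first exact: (lo_D H x y).
    exact: (lo_Z x H bB).
  - move=> y; apply: kerin_inj; rewrite kermkK.
    have -> : qmul (kerin y) = 0 by rewrite -pE kerinP.
    by rewrite (additive0 (itensDr B _)) subr0.
  by move=> x; rewrite kermkK subrK.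
move=> /(rpd_ses B1 l sesK (relproj_qind M)).2 Kl.
have Kfd := fd_ses_l B1 sesK Pfd.
have [P [d [Pfg Pp dE Pl]]] := IHl _ Kfd Kl.
exists (splice (qind M) P), (splice_d (lin_of (@kerinD _ _ _ p) (@kerinZ _ _ _ p)) p d); split.
- by case=> [|n]; [apply/resq_fd|apply: Pfg].
- by case=> [|n]; [apply: relproj_projective => //; apply: relproj_qind|apply: Pp].
- apply: splice_exact => //.
  + exact: kerinP.
  + exact: kerin_inj.
  by move=> x px; exists (kermk px).
exact: splice_vanish.
Qed.

Lemma has_res_rpd l M : fd (resq M) -> has_res l M -> rpd B l (resq M).
Proof.
elim: l M => [|l IHl] M Mfd [P [d [Pfg Pp dE Pl]]].
  have [dd d0 dex] := dE.
  have P1 (x : P 1%N) : x = 0 by apply: Pl.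
  have dI (x y : P 0%N) : d 0%N x = d 0%N y -> x = y.
    move=> dxy; apply/eqP; rewrite -subr_eq0; apply/eqP.
    have [|z <-] := dex 0%N (x - y); first by rewrite linearB /= dxy subrr.
    by rewrite (P1 z) linear0.
  have /choice[h hE] := d0.
  have hA : linear_over {:A} (h : resq M -> resq (P 0%N)).
    split=> [x y|a x _]; apply: dI; first by rewrite linearD !hE.
    by rewrite !resqE linearZ /= !hE.
  apply: (relproj_retract B1 hA (lo_resq_linear {:A} (d 0%N)) hE).
  exact: projective_relproj (Pp 0%N).
have [dd d0 dex] := dE; pose K := kermod (d 0%N).
have P0fd : fd (resq (P 0%N)) by apply/resq_fd.
(* An absolute resolution is automatically B-split: the identity of M lifts through d 0 by
   semisimplicity of B/J(B). *)
have [s sB sE] : exists2 s : resq M -> resq (P 0%N), linear_over B s &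
    forall m, d 0%N (s m) = m.
  apply: (semisimple_lift Bsub (f := (fun x => x) : resq M -> resq M)
    (p := d 0%N : resq (P 0%N) -> resq M)) => //.
  - by move=> j m; apply: resq_jacobson.
  - by move=> j m; apply: resq_jacobson.
  exact: lo_resq_linear.
have sesK : ses B (resq K) (resq (P 0%N)) (resq M).
  have rP (x : P 0%N) : d 0%N (x - s (d 0%N x)) = 0 by rewrite linearB /= sE subrr.
  have H := lo_subr (lo_id B (resq (P 0%N))) (lo_comp sB (lo_resq_linear B (d 0%N))).
  exists (@kerin _ _ _ (d 0%N)), (d 0%N), s, (fun x => kermk (rP x)).
  split; split=> //.
  - exact: lo_resq_linear.
  - split=> [x y|b x bB]; apply: kerin_inj; first exact: (lo_D H x y).
    exact: (lo_Z x H bB).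
  - move=> y; apply: kerin_inj; rewrite kermkK.
    by rewrite (kerinP y) (lo_0 sB) subr0.
  by move=> x; rewrite kermkK subrK.
apply: (rpd_ses B1 l sesK (projective_relproj (Pp 0%N))).1.
apply: IHl; first exact: (fd_ses_l B1 sesK P0fd).
exists (unsplice P), (unsplice_d dd); split=> [n|n||].
- exact: Pfg.
- exact: Pp.
- exact: unsplice_exact.
exact: unsplice_vanish.
Qed.

(** Modules over the quotient are the A-modules killed by the ideal, and on these the absolute and
    relative dimensions agree. *)
Lemma gldim_quot_le l : (gldim Q <= (Posz l)%:E)%E <->
  forall N : lmodType A, fd N -> killed J N -> rpd B l N.
Proof.
have pd_le M : fd (resq M) -> (pd M <= (Posz l)%:E)%E <-> rpd B l (resq M).
  move=> Mfd; rewrite /pd least_le => [|m n mn [P [d [? ? ? Pm]]]]; last first.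
    by exists P, d; split=> //; apply: vanishes_mono Pm.
  by split; [apply: has_res_rpd|apply: rpd_has_res].
rewrite /gldim least_le => [|m n mn H M /H Hm]; last first.
  by apply: (Order.POrderTheory.le_trans Hm); rewrite lee_fin lez_nat.
split=> [H N Nfd Nk|H M /resq_fd Mfd]; last first.
  by apply/pd_le => //; apply: H => //; apply: resq_killed.
have Qfd : fd (resq (qmod Nk)).
  apply: (fd_surj (f := (fun z => z) : N -> resq (qmod Nk)) _ _ _ Nfd)
    => [//|c x|y]; last by exists y.
  exact: (lo_Z x (resq_qmod_lo Nk) (memvf _)).
have /(pd_le _ Qfd) := H (qmod Nk) (proj2 (resq_fd _) Qfd).
exact: (rpd_retract B1 (resq_qmod_lo Nk) (qmod_resq_lo Nk)).
Qed.

End AbsoluteDimension.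

(** * Additivity of the dimension *)

Section Coordinates.
Variable k : fieldType.

(** The map v |-> v - proj_W v kills W but not x; one of its coordinates that is nonzero at x is
    rescaled. *)
Lemma vspace_separate (V : vectType k) (W : {vspace V}) (x : V) : x \notin W ->
  exists f : V -> k, [/\ {morph f : u v / u + v}, forall a u, f (a *: u) = a * f u,
    forall w, w \in W -> f w = 0 & f x = 1].
Proof.
move=> xW; pose q (v : V) := v - projv W v.
have qD u v : q (u + v) = q u + q v by rewrite /q linearD opprD addrACA.
have qZ a v : q (a *: v) = a *: q v by rewrite /q linearZ scalerBr.
have qx : q x != 0.
  apply: contra xW; rewrite /q subr_eq0 => /eqP ->; exact: memv_proj.
have [i ci] : exists i, coord (vbasis {:V}) i (q x) != 0.
  apply: contrapT => H; move/eqP: qx; apply.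
  rewrite (coord_vbasis (memvf (q x))) big1 // => i _.
  have [->|ci] := eqVneq (coord (vbasis {:V}) i (q x)) 0; first by rewrite scale0r.
  by case: H; exists i.
exists (fun v => (coord (vbasis {:V}) i (q x))^-1 * coord (vbasis {:V}) i (q v)).
split=> [u v|a u|w wW|].
- by rewrite /= qD -mulrDr (linearD (coord (vbasis {:V}) i) (q u) (q v)).
- by rewrite /= qZ [coord _ i (a *: _)]linearZ mulrCA.
- have -> : q w = 0 by rewrite /q projv_id // subrr.
  by rewrite linear0 mulr0.
by rewrite mulVf.
Qed.

Definition functional (A : falgType k) (M : lmodType A) (f : M -> k) : Prop :=
  {morph f : x y / x + y} /\ forall a x, f (kact a x) = a * f x.

(** Scalars provided by [fd] depend on choices; they become linear in x after the component along K,
    the relations between the generators, is removed. *)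
Lemma fd_coord (A : falgType k) (M : lmodType A) : fd M ->
  exists n (b : 'I_n -> M) (c : 'I_n -> M -> k), (forall i, functional (c i)) /\
  forall x, x = \sum_i kact (c i x) (b i).
Proof.
move=> [n [g gM]].
pose ev (v : 'rV[k]_n) : M := \sum_i kact (v 0 i) (g i).
have evD u v : ev (u + v) = ev u + ev v.
  by rewrite /ev -big_split; apply: eq_bigr => i _; rewrite mxE /kact !scalerDl.
have evZ a v : ev (a *: v) = kact a (ev v).
  rewrite /ev /kact scaler_sumr; apply: eq_bigr => i _.
  by rewrite mxE scalerA -scalerAl mul1r scalerA.
have ev0 : ev 0 = 0 by rewrite -[0](scale0r 0) evZ /kact !scale0r.
have [K KE] : exists K : {vspace 'rV[k]_n}, forall v, v \in K <-> ev v = 0.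
  apply: vspace_of_prop => [//|u v uE vE|a v vE]; first by rewrite evD uE vE addr0.
  by rewrite evZ vE /kact scaler0.
have /choice[h hE] : forall x, exists v : 'rV[k]_n, ev v = x.
  move=> x; have [c ->] := gM x; exists (\row_i c i).
  by apply: eq_bigr => i _; rewrite mxE.
pose q (v : 'rV[k]_n) := v - projv K v.
have qD u v : q (u + v) = q u + q v by rewrite /q linearD opprD addrACA.
have qZ a v : q (a *: v) = a *: q v by rewrite /q linearZ scalerBr.
have evN u v : ev u = ev v -> q u = q v.
  move=> uv; have : u - v \in K.
    by apply/KE; rewrite evD -scaleN1r evZ uv /kact scaleN1r scaleN1r subrr.
  move=> uvK; apply/eqP; rewrite -subr_eq0 -scaleN1r -qZ -qD scaleN1r /q projv_id //.
  by rewrite subrr.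
exists n, g, (fun i x => q (h x) 0 i); split=> [i|x].
  split=> [x y|a x].
    by rewrite (evN (h (x + y)) (h x + h y)) ?qD ?mxE // evD !hE.
  by rewrite (evN (h (kact a x)) (a *: h x)) ?qZ ?mxE // evZ !hE.
rewrite -{1}(hE x) -{1}(subrK (projv K (h x)) (h x)) evD (_ : ev (projv _ _) = 0) ?addr0 //.
by apply/KE/memv_proj.
Qed.

Lemma fd_functional (A : falgType k) (M : lmodType A) (x : M) : fd M -> x <> 0 ->
  exists2 f : M -> k, functional f & f x = 1.
Proof.
move=> /fd_coord[n [b [c [cf xE]]]] nx.
have [i ci] : exists i, c i x != 0.
  apply: contrapT => H; apply: nx; rewrite (xE x) big1 // => i _.
  have [->|ci] := eqVneq (c i x) 0; first by rewrite /kact !scale0r.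
  by case: H; exists i.
exists (fun y => (c i x)^-1 * c i y); last by rewrite mulVf.
have [cD cZ] := cf i.
by split=> [u v|a u]; [rewrite cD mulrDr|rewrite cZ mulrCA].
Qed.

Lemma fd_mtens (A C : falgType k) (M : lmodType A) (N : lmodType C) :
  fd M -> fd N -> fd (mtens M N).
Proof.
move=> /fd_coord[m [b [c [cf bE]]]] /fd_coord[n [b' [c' [cf' bE']]]].
apply: (fd_fintype (g := fun ij : 'I_m * 'I_n => mt (b ij.1) (b' ij.2))).
elim/mt_ind => [x y [d ->] [d' ->]|u v].
  exists (fun ij => d ij + d' ij); rewrite -big_split; apply: eq_bigr => ij _.
  by rewrite scalerDl scalerDl.
exists (fun ij => c ij.1 u * c' ij.2 v).
rewrite -(pair_bigA _ (fun i j => (c i u * c' j v)%:A *: mt (b i) (b' j))) /=.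
rewrite [in LHS](bE u) (additive_sum _ _ _ (mtDl _)); apply: eq_bigr => i _.
rewrite [in LHS](bE' v) (additive_sum _ _ _ (mtDr _)); apply: eq_bigr => j _.
rewrite mtens_scale -mt_bal; congr mt.
by rewrite /kact scalerA -scalerAl mul1r scalerA mulrC.
Qed.

End Coordinates.

(** * Tensor products of relative dimension at most one *)

Section Kunneth.
Variables (k : fieldType) (A C : falgType k) (B : {vspace A}) (D : {vspace C}).
Hypotheses (B1 : 1 \in B) (D1 : 1 \in D).
Local Notation S := (tensor_sub B D).
Let S1 : 1 \in S := tensor_sub1 B1 D1.

(** h kills the kernel of multiplication, so it factors through M, and m |-> h (1 (x) m) is an
    A'-linear section. *)
Lemma relproj_of_retraction (A' : falgType k) (U : {vspace A'}) (M : lmodType A')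
    (h : ind U M -> ind U M) : 1 \in U -> linear_over {:A'} h ->
  (forall y : omega U M, h (kerin y) = 0) -> (forall x, ind_mul (h x) = ind_mul x) ->
  relproj U M.
Proof.
move=> U1 hA hK hp; have [[iA pA sB rB] [ps ri d]] := ses_omega_split U M.
have hI x y : ind_mul x = ind_mul y -> h x = h y.
  move=> xy; apply/eqP; rewrite -subr_eq0 -(lo_B hA); apply/eqP.
  have := d (x - y); rewrite (lo_B pA) xy subrr (lo_0 sB) addr0 => <-.
  exact: hK.
have tA : linear_over {:A'} (fun m : M => h (itens U 1 m)).
  split=> [x y|a x _].
    by rewrite -(lo_D hA); apply: hI; rewrite ps (lo_D pA) !ps.
  by rewrite -(lo_Z _ hA) ?memvf //; apply: hI; rewrite ps (lo_Z _ pA) ?memvf // ps.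
apply: (relproj_retract U1 tA pA _ (relproj_ind U1 M)) => m.
by rewrite hp ps.
Qed.

Section Contraction.
Variables (M : lmodType A) (N : lmodType C).

Definition contractl (c : M -> k) : mtens M N -> N := glift (fun m n => kact (c m) n).
Definition contractr (c : N -> k) : mtens M N -> M := glift (fun m n => kact (c n) m).

Section Left.
Variables (c : M -> k) (cf : functional c).
Let bal : balanced (@kact k A M) (@kact k C N) (fun m n => kact (c m) n).
Proof.
have [cD cZ] := cf; split=> [n x y|m x y|a x n]; rewrite /kact ?scalerDr //.
  by rewrite cD !scalerDl.
by rewrite cZ scalerA -scalerAl mul1r scalerA mulrC.
Qed.
Lemma contractlE m n : contractl c (mt m n) = kact (c m) n. Proof. exact: gliftE. Qed.
Lemma contractlD : {morph contractl c : x y / x + y}. Proof. exact: gliftD. Qed.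
Lemma contractlZ a x : contractl c (tens 1 a *: x) = a *: contractl c x.
Proof.
elim/mt_ind: x => [x y xE yE|m n].
  by rewrite scalerDr !contractlD xE yE scalerDr.
by rewrite mtZ !contractlE scale1r kact_scaleC.
Qed.
End Left.

Section Right.
Variables (c : N -> k) (cf : functional c).
Let bal : balanced (@kact k A M) (@kact k C N) (fun m n => kact (c n) m).
Proof.
have [cD cZ] := cf; split=> [n x y|m x y|a x n]; rewrite /kact ?scalerDr //.
  by rewrite cD !scalerDl.
by rewrite cZ scalerA -scalerAl mul1r scalerA mulrC.
Qed.
Lemma contractrE m n : contractr c (mt m n) = kact (c n) m. Proof. exact: gliftE. Qed.
Lemma contractrD : {morph contractr c : x y / x + y}. Proof. exact: gliftD. Qed.
Lemma contractrZ a x : contractr c (tens a 1 *: x) = a *: contractr c x.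
Proof.
elim/mt_ind: x => [x y xE yE|m n].
  by rewrite scalerDr !contractrD xE yE scalerDr.
by rewrite mtZ !contractrE scale1r kact_scale.
Qed.
End Right.
End Contraction.

Variables (M : lmodType A) (N : lmodType C).
Hypotheses (Mfd : fd M) (Nfd : fd N).
Local Notation P0 := (ind B M).
Local Notation P1 := (omega B M).
Local Notation Q0 := (ind D N).
Local Notation Q1 := (omega D N).
Local Notation i := (@kerin _ _ _ (imul B M) : P1 -> P0).
Local Notation j := (@kerin _ _ _ (imul D N) : Q1 -> Q0).
Local Notation p := (@ind_mul k A B M : P0 -> M).
Local Notation q := (@ind_mul k C D N : Q0 -> N).

(** E is the kernel of P0 (x) Q0 -> M (x) N, relatively projective because the dimension is at most
    1. Applying q to the second factor sends E to P1 (x) N, and u lifts this map to P1 (x) Q0. The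
    maps [el] and [er], induced by the inclusions i and j, agree on P1 (x) Q1. *)
Lemma kunneth_lift : rpd S 1 (mtens M N) ->
  exists E : lmodType (tensor A C), exists (u : E -> mtens P1 Q0)
    (el : mtens P1 Q0 -> E) (er : mtens P0 Q1 -> E),
  [/\ linear_over {: tensor A C} u, linear_over {: tensor A C} el,
    linear_over {: tensor A C} er,
    forall y, mmap (@id P1) q (u (el y)) = mmap (@id P1) q y &
    forall (x : P1) (y : Q1), er (mt (i x) y) = el (mt x (j y))].
Proof.
move=> MN1.
have [[iA pA sB rB] [ps ri isr]] := ses_omega_split B M.
have [[jC qC sD rD] [qs rj jsr]] := ses_omega_split D N.
have iB := lo_full B iA; have pB := lo_full B pA.
have jD := lo_full D jC; have qD := lo_full D qC.
have I0 := lo_id B P0; have I1 := lo_id B P1; have I0' := lo_id D Q0; have IN := lo_id D N.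
have pi x : p (i x) = 0 := kerinP x.
have qj x : q (j x) = 0 := kerinP x.
have pqA := lo_mmap_full B1 D1 pB qD pA qC.
pose pq : {linear mtens P0 Q0 -> mtens M N} :=
  lin_of (lo_D pqA) (fun a x => lo_Z x pqA (memvf a)).
pose E := kermod pq.
have Eproj : relproj S E.
  have relPQ := relproj_mtens B1 D1 (relproj_ind B1 M) (relproj_ind D1 N).
  have ssB := lo_mmap B1 D1 sB sD.
  have pqss x : mmap p q (mmap (itens B 1) (itens D 1) x) = x.
    by rewrite (mmap_comp B1 D1) // (mmap_id B1 D1).
  have rP x : pq (x - mmap (itens B 1) (itens D 1) (mmap p q x)) = 0.
    by rewrite linearB /= pqss subrr.
  apply: (rpd_ses S1 0 _ relPQ).2 MN1.
  have H := lo_subr (lo_id S (mtens P0 Q0)) (lo_comp ssB (lo_full S pqA)).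
  exists (@kerin _ _ _ pq), (mmap p q), (mmap (itens B 1) (itens D 1)), (fun x => kermk (rP x)).
  split; split=> //.
  - by split=> [x y|b x bS]; apply: kerin_inj; rewrite ?kerinD ?kerinZ !kermkK
      ?(lo_D H) ?(lo_Z _ H).
  - move=> y; apply: kerin_inj; rewrite kermkK.
    have -> : mmap p q (kerin y) = 0 := kerinP y.
    by rewrite (lo_0 ssB) subr0.
  by move=> x; rewrite kermkK subrK.
have mi_inj (x y : mtens P1 N) : mmap i (@id N) x = mmap i (@id N) y -> x = y.
  move=> xy; have := congr1 (mmap (@orho _ _ B M) (@id N)) xy.
  by rewrite !(mmap_comp B1 D1) // !(mmap_id B1 D1).
(* The image of e under 1 (x) q dies in M (x) N, so it comes from P1 (x) N, where [orho] recovers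
   it. *)
pose phi (e : E) : mtens P1 N := mmap (@orho _ _ B M) q (kerin e).
have phiE e : mmap i (@id N) (phi e) = mmap (@id P0) q (kerin e).
  rewrite /phi (mmap_comp B1 D1) //.
  have : mmap (fun x => itens B 1 (p x)) q (kerin e) = 0.
    have -> : mmap (fun x => itens B 1 (p x)) q (kerin e) =
      mmap (itens B 1) (@id N) (mmap p q (kerin e)) by rewrite (mmap_comp B1 D1).
    have -> : mmap p q (kerin e) = 0 := kerinP e.
    exact: lo_0 (lo_mmap B1 D1 sB IN).
  have irB := lo_comp iB rB; have spB := lo_comp sB pB.
  move=> H; rewrite -[LHS]addr0 -H -(mmap_addl B1 D1 irB spB qD).
  by congr (mmap _ _ _); apply/funext => x; rewrite isr.
have miA := lo_mmap_full B1 D1 iB IN iA (lo_id {:C} N).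
have mqA := lo_mmap_full B1 D1 I0 qD (lo_id {:A} P0) qC.
have mqA1 := lo_mmap_full B1 D1 I1 qD (lo_id {:A} P1) qC.
have phiA : linear_over {: tensor A C} phi.
  split=> [x y|a x _]; apply: mi_inj.
    by rewrite (lo_D miA) !phiE kerinD (lo_D mqA).
  by rewrite (lo_Z _ miA) ?memvf // !phiE kerinZ (lo_Z _ mqA) ?memvf.
have [|u uA uE] := relproj_lift S1 Eproj mqA1 (lo_mmap B1 D1 I1 sD) _ phiA.
  by move=> x; rewrite (mmap_comp B1 D1) // (mmap_id B1 D1).
have zl y : pq (mmap i (@id Q0) y) = 0.
  rewrite /= (mmap_comp B1 D1) //; elim/mt_ind: y => [x y xE yE|x y].
    by rewrite (mmapD B1 D1) ?xE ?yE ?addr0 //; apply: lo_comp.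
  rewrite (mmapE B1 D1) //; last exact: lo_comp.
  by rewrite pi (additive0 (mtDl _)).
have zr y : pq (mmap (@id P0) j y) = 0.
  rewrite /= (mmap_comp B1 D1) //; elim/mt_ind: y => [x y xE yE|x y].
    by rewrite (mmapD B1 D1) ?xE ?yE ?addr0 //; apply: lo_comp.
  rewrite (mmapE B1 D1) //; last exact: lo_comp.
  by rewrite qj (additive0 (mtDr _)).
have lA := lo_mmap_full B1 D1 iB I0' iA (lo_id {:C} Q0).
have rA := lo_mmap_full B1 D1 I0 jD (lo_id {:A} P0) jC.
exists E, u, (fun y => kermk (zl y)), (fun y => kermk (zr y)); split=> //.
- by split=> [x y|a x _]; apply: kerin_inj; rewrite ?kerinD ?kerinZ !kermkK
    ?(lo_D lA) ?(lo_Z _ lA) ?memvf.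
- by split=> [x y|a x _]; apply: kerin_inj; rewrite ?kerinD ?kerinZ !kermkK
    ?(lo_D rA) ?(lo_Z _ rA) ?memvf.
- move=> y; rewrite uE /phi kermkK (mmap_comp B1 D1) //.
  by congr (mmap _ _ _); apply/funext => x; rewrite ri.
by move=> x y; apply: kerin_inj; rewrite !kermkK !(mmapE B1 D1).
Qed.

(** On P1 (x) Q0 the map 1 - u el has values in the kernel of 1 (x) q. Contracting the P1 part with
    a functional f that detects the obstruction to splitting M yields G : Q0 -> Q0 with q G = 0. On
    Q1 the contribution of u el extends over P0 and is killed by f, while f(1) = 1 makes G the
    identity there; so 1 - G splits N off Q0. *)
Lemma kunneth_one : rpd S 1 (mtens M N) -> ~ relproj B M -> relproj D N.
Proof.
move=> /kunneth_lift[E [u [el [er [uA elA erA uel erel]]]]] nM.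
have [[iA pA sB rB] [ps ri isr]] := ses_omega_split B M.
have [[jC qC sD rD] [qs rj jsr]] := ses_omega_split D N.
have [m [b [c [cf bE]]]] := fd_coord (fd_omega B1 Mfd).
have [n [b' [v [vf vE]]]] := fd_coord (fd_ind D Nfd).
(* A functional on the endomorphisms of [omega B M] that vanishes on those
   extending to [ind B M] and takes the value 1 at the identity. *)
have [W WE] : exists W : {vspace 'M[k]_m}, forall X, X \in W <->
    exists2 psi : P0 -> P1, linear_over {:A} psi &
      forall s t, X s t = c s (psi (i (b t))).
  apply: vspace_of_prop => [|X Y [f fA fX] [g gA gY]|a X [f fA fX]].
  - exists (fun=> 0) => [|s t]; first by split=> [x y|a x _]; rewrite ?addr0 ?scaler0.
    by rewrite mxE (additive0 (cf s).1).
  - exists (fun x => f x + g x) => [|s t]; first exact: lo_add.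
    by rewrite mxE fX gY (cf s).1.
  exists (fun x => kact a (f x)) => [|s t]; last by rewrite mxE fX (cf s).2.
  split=> [x y|d x _]; first by rewrite (lo_D fA) /kact scalerDr.
  by rewrite (lo_Z _ fA) ?memvf // kact_scale.
pose X1 : 'M[k]_m := \matrix_(s, t) c s (b t).
have X1W : X1 \notin W.
  apply/negP => /WE[psi psiA psiE]; apply: nM.
  have psib t : psi (i (b t)) = b t.
    rewrite [LHS](bE (psi (i (b t)))) [RHS](bE (b t)); apply: eq_bigr => s _.
    by rewrite -psiE mxE.
  have psii y : psi (i y) = y.
    have piA := lo_comp psiA iA.
    rewrite [in LHS](bE y) [RHS](bE y) (additive_sum _ _ _ (lo_D piA)).
    by apply: eq_bigr => t _; rewrite /kact (lo_Z _ piA) ?memvf // psib.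
  apply: (relproj_of_retraction (h := fun x => x - i (psi x)) B1).
  - exact: lo_subr (lo_id _ _) (lo_comp iA psiA).
  - by move=> y; rewrite psii subrr.
  move=> x; rewrite (lo_B pA); have := kerinP (psi x); rewrite /= => ->.
  by rewrite subr0.
have [f [fD fZ fW f1]] := vspace_separate X1W.
pose L s t := f (delta_mx s t).
have fE X : f X = \sum_s \sum_t L s t * X s t.
  rewrite {1}(matrix_sum_delta X) (additive_sum _ _ _ fD); apply: eq_bigr => s _.
  rewrite (additive_sum _ _ _ fD); apply: eq_bigr => t _.
  by rewrite fZ mulrC.
pose y t (x : Q0) : mtens P1 Q0 := mt (b t) x - u (el (mt (b t) x)).
(* The family t |-> y t x is a matrix with entries in Q0, contracted with the matrix L of f. *)
pose G (x : Q0) : Q0 := \sum_s \sum_t kact (L s t) (contractl (c s) (y t x)).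
have yD t : {morph y t : x z / x + z}.
  by move=> x z; rewrite /y mtDr (lo_D elA) (lo_D uA) opprD addrACA.
have yZ t a x : y t (a *: x) = tens 1 a *: y t x.
  by rewrite /y scalerBr -(lo_Z _ uA) ?memvf // -(lo_Z _ elA) ?memvf // mtZ scale1r.
have kactD (z : k) : {morph @kact k C Q0 z : x x' / x + x'}.
  by move=> x x'; rewrite /kact scalerDr.
have GC : linear_over {:C} G.
  split=> [x z|a x _].
    rewrite /G -big_split; apply: eq_bigr => s _; rewrite -big_split; apply: eq_bigr => t _.
    by rewrite yD (contractlD (cf s)) kactD.
  rewrite /G scaler_sumr; apply: eq_bigr => s _; rewrite scaler_sumr; apply: eq_bigr => t _.
  by rewrite yZ (contractlZ (cf s)) kact_scaleC.
have qD := lo_full D qC; have I1 := lo_id B P1.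
have qG x : q (G x) = 0.
  rewrite /G (additive_sum _ _ _ (lo_D qC)) big1 // => s _.
  rewrite (additive_sum _ _ _ (lo_D qC)) big1 // => t _.
  rewrite (lo_kact _ _ (memvf 1) qC).
  have -> : q (contractl (c s) (y t x)) = contractl (c s) (mmap (@id P1) q (y t x)).
    move: (y t x); apply: mt_eq => [z z'|z z'|z z'].
    - by rewrite (contractlD (cf s)) (lo_D qC).
    - by rewrite (mmapD B1 D1 I1 qD) (contractlD (cf s)).
    rewrite (mmapE B1 D1 I1 qD) !(contractlE (cf s)).
    exact: lo_kact (memvf 1) qC.
  rewrite /y (additiveB (mmapD B1 D1 I1 qD)) uel subrr.
  by rewrite (additive0 (contractlD (cf s))) /kact scaler0.
(* By [erel], u (el (b t (x) j z)) = u (er (i (b t) (x) z)), which makes sense with any element of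
   P0 in place of i (b t). Each functional [v l] on Q0 thus gives an extendable endomorphism, on
   which f vanishes. *)
have Gj z : G (j z) = j z.
  have G2 : \sum_s \sum_t kact (L s t) (contractl (c s) (u (el (mt (b t) (j z))))) = 0.
    rewrite (vE (\sum_s _)) big1 // => l _.
    rewrite (additive_sum _ _ _ (vf l).1).
    pose psi (x : P0) : P1 := contractr (v l) (u (er (mt x z))).
    have psiA : linear_over {:A} psi.
      split=> [x x'|a x _]; rewrite /psi.
        by rewrite mtDl (lo_D erA) (lo_D uA) (contractrD (vf l)).
      rewrite -(contractrZ (vf l)) -(lo_Z _ uA) ?memvf // -(lo_Z _ erA) ?memvf //.
      by rewrite mtZ scale1r.
    have : f (\matrix_(s, t) c s (psi (i (b t)))) = 0.
      by apply/fW/WE; exists psi => // s t; rewrite mxE.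
    rewrite fE => psi0; rewrite [X in kact X _](_ : _ = 0) ?/kact ?scale0r //.
    rewrite -[RHS]psi0; apply: eq_bigr => s _.
    rewrite (additive_sum _ _ _ (vf l).1); apply: eq_bigr => t _.
    rewrite (vf l).2 mxE; congr (_ * _).
    rewrite /psi erel; move: (u _); apply: mt_eq => [w w'|w w'|w w'].
    - by rewrite (contractlD (cf s)) (vf l).1.
    - by rewrite (contractrD (vf l)) (cf s).1.
    by rewrite (contractlE (cf s)) (contractrE (vf l)) (vf l).2 (cf s).2 mulrC.
  have G1 : \sum_s \sum_t kact (L s t) (contractl (c s) (mt (b t) (j z))) = j z.
    transitivity (kact (f X1) (j z)); last by rewrite f1 /kact !scale1r.
    rewrite fE /kact scaler_suml scaler_suml; apply: eq_bigr => s _.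
    rewrite scaler_suml scaler_suml; apply: eq_bigr => t _.
    by rewrite (contractlE (cf s)) /kact mxE scalerA -scalerAl mul1r scalerA.
  rewrite /G -[RHS]G1 -[RHS]subr0 -[X in _ = _ - X]G2 -sumrB; apply: eq_bigr => s _.
  rewrite -sumrB; apply: eq_bigr => t _.
  by rewrite /y (additiveB (contractlD (cf s))) (additiveB (kactD _)).
apply: (relproj_of_retraction (h := fun x => x - G x) D1).
- exact: lo_subr (lo_id _ _) GC.
- by move=> z; rewrite Gj subrr.
by move=> x; rewrite (lo_B qC) qG subr0.
Qed.

End Kunneth.

(** * Lower bound for the dimension of M (x) N *)

Section KunnethBound.
Variables (k : fieldType) (A C : falgType k) (B : {vspace A}) (D : {vspace C}).
Hypotheses (B1 : 1 \in B) (D1 : 1 \in D).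
Local Notation S := (tensor_sub B D).
Let S1 : 1 \in S := tensor_sub1 B1 D1.
Implicit Types (M : lmodType A) (N : lmodType C).

(** Each syzygy of M lowers the bound by one for as long as the bound is at least n, which is enough
    for the middle term [ind B M] (x) N. *)
Lemma rpd_mtens_omegal j n M N : rpd S (j + n) (mtens M N) -> rpd D n N ->
  rpd S n (mtens (iter j (@omega _ _ B) M) N).
Proof.
elim: j M => [|j IHj] M // MN Nn; rewrite iterSr; apply: IHj => //.
apply: (rpd_sub S1 (X := mtens (ind B M) N) (M := mtens M N)) MN.
  by do 4 eexists; apply: ses_mtensl (ses_omega_split B M).
apply: (rpd_leq S1 (leq_addl j n)).
exact: (rpd_mtens B1 D1 (m := 0) (relproj_ind B1 M : rpd B 0 _) Nn).
Qed.

Lemma rpd_mtens_omegar j m M N : rpd S (j + m) (mtens M N) -> rpd B m M ->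
  rpd S m (mtens M (iter j (@omega _ _ D) N)).
Proof.
elim: j N => [|j IHj] N // MN Mm; rewrite iterSr; apply: IHj => //.
apply: (rpd_sub S1 (X := mtens M (ind D N)) (M := mtens M N)) MN.
  by do 4 eexists; apply: ses_mtensr (ses_omega_split D N).
apply: (rpd_leq S1 (leq_addl j m)).
rewrite -[m in rpd _ m _]addn0.
exact: (rpd_mtens B1 D1 (n := 0) Mm (relproj_ind D1 N : rpd D 0 _)).
Qed.

(** The m-th syzygy of M and the n-th syzygy of N have dimension exactly 1, where [kunneth_one]
    applies. *)
Lemma rpd_mtens_lower m n M N : fd M -> fd N -> rpd B m.+1 M -> rpd D n.+1 N ->
  ~ rpd B m M -> ~ rpd D n N -> ~ rpd S (m + n).+1 (mtens M N).
Proof.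
move=> Mfd Nfd Mm Nn nM nN; rewrite -addnS => MN.
pose M' := iter m (@omega _ _ B) M; pose N' := iter n (@omega _ _ D) N.
have M'1 : rpd B 1 M' by apply/rpd_iter; rewrite addn1.
have nM' : ~ relproj B M' by move=> H; apply: nM; rewrite -[m]addn0; apply/rpd_iter.
have nN' : ~ relproj D N' by move=> H; apply: nN; rewrite -[n]addn0; apply/rpd_iter.
(* The bound m + (n + 1) drops to n + 1 by m syzygies of M, and then to 1 by n syzygies of N. *)
have := rpd_mtens_omegal MN Nn; rewrite -(addn1 n) => /rpd_mtens_omegar/(_ M'1) MN1.
apply: nN'; apply: kunneth_one MN1 nM' => //; exact: fd_iter_omega.
Qed.

End KunnethBound.

Section KilledModule.
Variables (k : fieldType) (A : falgType k) (B : {vspace A}).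
Hypotheses (Bsub : unital_subalgebra B) (AJ : two_sided_ideal ({:A} * jacobson B)%VS).

(** Otherwise A J(B) = A, hence A J(B)^n = A for all n, against nilpotence. *)
Lemma ideal_of_jacobson1 : 1 \notin ideal_of (jacobson B).
Proof.
apply/negP => I1; have /andP[_ H] := AJ.
have {}I1 := subvP H _ I1; have [n Jn] := jacobson_nilpotent Bsub.
have AJA : ({:A} * jacobson B)%VS = {:A}%VS.
  apply/eqP; rewrite eqEsubv subvf; apply/subvP => a _.
  have : a * 1 \in ({:A} * ({:A} * jacobson B))%VS by rewrite memv_mul ?memvf.
  by rewrite mulr1; apply: subvP; rewrite prodvA prodvSl ?subvf.
have AJn m : ({:A} * jacobson B ^+ m)%VS = {:A}%VS.
  by elim: m => [|m IHm]; [rewrite expv0 prodv1|rewrite expvSl prodvA AJA].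
by have := memvf (1 : A); rewrite -(AJn n.+1) Jn prodv0 memv0 oner_eq0.
Qed.

(** Tensoring with this nonzero module lets [rpd_mtensl] and [rpd_mtensr] carry bounds on M (x) N
    back to a single factor. *)
Lemma killed_module : exists (M : lmodType A) (x : M) (f : M -> k),
  [/\ fd M, killed (jacobson B) M, functional f & f x = 1].
Proof.
pose Q := quot_alg (jacobson B); pose M : lmodType A := resq (Q^o : lmodType Q).
have Mfd : fd M.
  apply/fd_fin_gen; exists 1%N, (fun=> (1 : Q)) => x; exists (fun=> qrepr x).
  by rewrite big_ord1 resqE [RHS]mulr1 qreprK.
have n0 : (1 : Q) <> 0 :> M.
  rewrite -(rmorph1 (@qproj k A (jacobson B))) -(rmorph0 (@qproj k A (jacobson B))).
  by move/qproj_eq; rewrite subr0; apply/negP/ideal_of_jacobson1.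
have [f ff f1] := fd_functional Mfd n0.
by exists M, (1 : Q), f; split=> //; apply: resq_killed.
Qed.

End KilledModule.

(** The radical of B (x) D must be no larger than the ideal coming from J(B) and J(D); this is the
    use of perfectness. *)
Lemma killed_mtens (k : fieldType) (A C : falgType k) (B : {vspace A}) (D : {vspace C})
    (M : lmodType A) (N : lmodType C) : perfect_field k ->
  unital_subalgebra B -> unital_subalgebra D ->
  killed (jacobson B) M -> killed (jacobson D) N ->
  killed (jacobson (tensor_sub B D)) (mtens M N).
Proof.
move=> kp Bsub Dsub Mk Nk a x aI; move: a aI x.
have sum0 (z w : tensor A C) : (forall x : mtens M N, z *: x = 0) ->
    (forall x : mtens M N, w *: x = 0) -> forall x : mtens M N, (z + w) *: x = 0.
  by move=> H H' x; rewrite scalerDl H H' addr0.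
have pure (a : A) (c : C) : (forall m : M, a *: m = 0) \/ (forall n : N, c *: n = 0) ->
    forall x : mtens M N, tens a c *: x = 0.
  move=> H; elim/mt_ind => [x y xE yE|m n]; first by rewrite scalerDr xE yE addr0.
  rewrite mtZ; case: H => ->; first exact: (additive0 (mtDl _)).
  exact: (additive0 (mtDr _)).
have kJ z : z \in jacobson (tensor_sub B D) -> forall x : mtens M N, z *: x = 0.
  move=> /(subvP (jacobson_tensor Bsub Dsub kp)) /memv_addP[u uJ [v vJ ->]].
  apply: (sum0 _ _).
    move: u uJ; apply: tensor_sub_ind => [x|? ? ? ?|j d jJ dD]; first by rewrite scale0r.
      exact: sum0.
    by apply: pure; left=> m; apply/Mk/mem_ideal_of.
  move: v vJ; apply: tensor_sub_ind => [x|? ? ? ?|j d jJ dD]; first by rewrite scale0r.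
    exact: sum0.
  by apply: pure; right=> n; apply/Nk/mem_ideal_of.
have scl (c : k) (z : tensor A C) : (forall x : mtens M N, z *: x = 0) ->
    forall x : mtens M N, (c *: z) *: x = 0.
  by move=> H x; rewrite -[c *: z]mulr1 -scalerAl scalerAr -scalerA H.
apply: prodv_ind => [x|||]; [by rewrite scale0r|exact: sum0|exact: scl|].
move=> u r uI _ x; rewrite -scalerA; move: u uI (r *: x).
apply: prodv_ind => [{}x|||]; [by rewrite scale0r|exact: sum0|exact: scl|].
by move=> s z _ zJ y; rewrite -scalerA (kJ z zJ) scaler0.
Qed.

(** * The chain of inequalities *)

Section Bounds.
Variables (k : fieldType) (A C : falgType k) (B : {vspace A}) (D : {vspace C}).
Hypotheses (k_perfect : perfect_field k).
Hypotheses (Bsub : unital_subalgebra B) (Dsub : unital_subalgebra D).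
Hypotheses (AJ : two_sided_ideal ({:A} * jacobson B)%VS).
Hypotheses (CJ : two_sided_ideal ({:C} * jacobson D)%VS).
Local Notation S := (tensor_sub B D).

Let B1 : 1 \in B. Proof. by have /andP[] := Bsub. Qed.
Let D1 : 1 \in D. Proof. by have /andP[] := Dsub. Qed.
Let S1 : 1 \in S := tensor_sub1 B1 D1.
Let Ssub := tensor_sub_unital Bsub Dsub.
Let SJ := two_sided_tensor Bsub Dsub k_perfect AJ CJ.

Let gldim_cases (R : pzRingType) : gldim R = +oo%E \/ exists n, gldim R = (Posz n)%:E.
Proof. exact: least_cases. Qed.

(** If the right side is finite, so are both summands, by tensoring with a fixed nonzero module.
    Then modules attaining the two dimensions are tensored. *)
Lemma gldim_tensor_ge : (gldim (quot_alg (jacobson B)) + gldim (quot_alg (jacobson D)) <=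
  gldim (quot_alg (jacobson S)))%E.
Proof.
have [->|[l lE]] := gldim_cases (quot_alg (jacobson S)); first exact: leey.
rewrite lE.
have Sl : forall N : lmodType (tensor A C), fd N -> killed (jacobson S) N -> rpd S l N.
  by apply/(gldim_quot_le Ssub SJ); rewrite lE.
have MN M N : fd M -> killed (jacobson B) M -> fd N -> killed (jacobson D) N ->
    rpd S l (mtens M N).
  by move=> Mfd Mk Nfd Nk; apply: Sl; [apply: fd_mtens|apply: killed_mtens].
have [X [x [fx [Xfd Xk [fxD fxZ] fx1]]]] := killed_module Bsub AJ.
have [Y [y [fy [Yfd Yk [fyD fyZ] fy1]]]] := killed_module Dsub CJ.
have Bl : (gldim (quot_alg (jacobson B)) <= (Posz l)%:E)%E.
  apply/(gldim_quot_le Bsub AJ) => M Mfd Mk.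
  exact: (rpd_mtensl B1 D1 fyD fyZ fy1 (MN _ _ Mfd Mk Yfd Yk)).
have Dl : (gldim (quot_alg (jacobson D)) <= (Posz l)%:E)%E.
  apply/(gldim_quot_le Dsub CJ) => N Nfd Nk.
  exact: (rpd_mtensr B1 D1 fxD fxZ fx1 (MN _ _ Xfd Xk Nfd Nk)).
(* A positive finite dimension is attained; when one dimension is 0 the bounds [Bl] and [Dl] already
   suffice, whence the successor. *)
have attained (A' : falgType k) (B' : {vspace A'}) m : unital_subalgebra B' ->
    two_sided_ideal ({:A'} * jacobson B')%VS ->
    gldim (quot_alg (jacobson B')) = (Posz m.+1)%:E ->
    exists M : lmodType A', [/\ fd M, killed (jacobson B') M, rpd B' m.+1 M & ~ rpd B' m M].
  move=> B'sub AJ' gE; apply: contrapT => H.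
  have : (gldim (quot_alg (jacobson B')) <= (Posz m)%:E)%E.
    apply/(gldim_quot_le B'sub AJ') => M Mfd Mk; apply: contrapT => nM; apply: H; exists M.
    split=> //; move: M Mfd Mk {nM}; apply/(gldim_quot_le B'sub AJ').
    by rewrite gE lee_fin.
  by rewrite gE lee_fin lez_nat ltnn.
move: Bl Dl.
have [->|[b gB]] := gldim_cases (quot_alg (jacobson B)); first by [].
have [->|[d gD]] := gldim_cases (quot_alg (jacobson D)); first by [].
rewrite gB gD !lee_fin -PoszD !lez_nat.
case: b gB => [|b] gB bl //; case: d gD => [|d] gD dl; first by rewrite addn0.
have [M [Mfd Mk Mb nM]] := attained _ _ _ Bsub AJ gB.
have [N [Nfd Nk Nd nN]] := attained _ _ _ Dsub CJ gD.
rewrite leqNgt; apply/negP => lbd.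
apply: (rpd_mtens_lower B1 D1 Mfd Nfd Mb Nd nM nN).
by apply: (rpd_leq S1 _ (MN _ _ Mfd Mk Nfd Nk)); rewrite -ltnS -addnS -addSn.
Qed.

Lemma gldim_quot_le_rel : (gldim (quot_alg (jacobson S)) <= rel_gldim S)%E.
Proof.
have [->|[l gE]] : rel_gldim S = +oo%E \/ exists l, rel_gldim S = (Posz l)%:E.
- exact: least_cases.
- exact: leey.
rewrite gE; apply/(gldim_quot_le Ssub SJ) => N Nfd _.
by move: N Nfd; apply/(rel_gldim_le S1); rewrite gE.
Qed.

Lemma fd_regular (A' : falgType k) : fd (regular_bimod A').
Proof.
apply/fd_fin_gen; exists 1%N, (fun=> (1 : A')) => x; exists (fun=> tens (x : A') 1).
by rewrite big_ord1 bimodZ !mulr1.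
Qed.

Let rel_pd_bimod_cases (A' : falgType k) (B' : {vspace A'}) :
  rel_pd (env_sub B') (regular_bimod A') = +oo%E \/
  exists n, rel_pd (env_sub B') (regular_bimod A') = (Posz n)%:E.
Proof. exact: least_cases. Qed.

Lemma rel_gldim_le_bimod (A' : falgType k) (B' : {vspace A'}) : 1 \in B' ->
  (rel_gldim B' <= rel_pd (env_sub B') (regular_bimod A'))%E.
Proof.
move=> B'1; have E1 := env_sub1 B'1.
have [->|[l gE]] := rel_pd_bimod_cases B'; first exact: leey.
rewrite gE; apply/(rel_gldim_le B'1) => M _; apply: rpd_bimod => //.
by apply/(rel_pd_le E1 _ (fd_regular A')); rewrite gE.
Qed.

Lemma rel_pd_tensor_le : (rel_pd (env_sub S) (regular_bimod (tensor A C)) <=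
  rel_pd (env_sub B) (regular_bimod A) + rel_pd (env_sub D) (regular_bimod C))%E.
Proof.
have [aE|[a aE]] := rel_pd_bimod_cases B; have [cE|[c cE]] := rel_pd_bimod_cases D; rewrite aE cE ?leey //.
have -> : ((Posz a)%:E + (Posz c)%:E)%E = (Posz (a + c))%:E by [].
apply/(rel_pd_le (env_sub1 S1) _ (fd_regular _)).
apply: rpd_bimod_tensor => //.
  by apply/(rel_pd_le (env_sub1 B1) _ (fd_regular _)); rewrite aE.
by apply/(rel_pd_le (env_sub1 D1) _ (fd_regular _)); rewrite cE.
Qed.

End Bounds.

Theorem theorem4p12 (k : fieldType) (k_perfect : perfect_field k)
    (k_char : 2%N \notin [pchar k])
    (A C : falgType k) (B : {vspace A}) (D : {vspace C})
    (hB : homologically_controllable B) (hD : homologically_controllable D) :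
  homologically_controllable (tensor_sub B D) /\
  rel_gldim (tensor_sub B D) = (rel_gldim B + rel_gldim D)%E.
Proof.
have [Bsub AJ Bc Be] := hB; have [Dsub CJ Dc De] := hD.
have Ssub := tensor_sub_unital Bsub Dsub.
have S1 : 1 \in tensor_sub B D by have /andP[] := Ssub.
have h1 := gldim_tensor_ge k_perfect Bsub Dsub AJ CJ.
have h2 := gldim_quot_le_rel k_perfect Bsub Dsub AJ CJ.
have h3 := rel_gldim_le_bimod S1.
have h4 := rel_pd_tensor_le Bsub Dsub.
(* Controllability puts relative dimensions on the small side of [h1], and the bimodule equalities
   put them on the large side of [h4]; the chain then closes up. *)
rewrite -Bc -Dc in h1; rewrite -Be -De in h4.
have e1 : rel_gldim (tensor_sub B D) = (rel_gldim B + rel_gldim D)%E.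
  apply/Order.POrderTheory.le_anti/andP; split.
    exact: Order.POrderTheory.le_trans h3 h4.
  exact: Order.POrderTheory.le_trans h1 h2.
split=> //; split=> //.
- exact: two_sided_tensor.
- by apply/Order.POrderTheory.le_anti/andP; split=> //; rewrite e1.
by apply/Order.POrderTheory.le_anti/andP; split=> //; rewrite e1.
Qed.
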